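(* Let $\mathbb K$ be a field, let $f:\mathbb N^k\to\mathbb N^\ell$ be a surjective monoid homomorphism, and let $\Gamma$ be a row-finite $\ell$-graph with no sources and finitely many vertices which is strongly aperiodic. Put $A=\mathrm{KP}_{\mathbb K}(f^*\Gamma)$, $H=\ker\bar f$ and $C=\mathbb K[H]$. For $T\in\mathrm{MT}(\Gamma)$ and $\mathfrak m\in\mathrm{MaxSpec}\,C$ put $$P_{T,\mathfrak m}=I_{H_T}+A\,\iota(\mathfrak m).$$ Then the assignment $$\Phi:\mathrm{MT}(\Gamma)\times\mathrm{MaxSpec}\,C\longrightarrow\mathrm{Prim}\,A,\qquad (T,\mathfrak m)\longmapsto P_{T,\mathfrak m},$$ is well defined (each $P_{T,\mathfrak m}$ is a primitive ideal of $A$) and injective, for every field $\mathbb K$. For every pair $(T,\mathfrak m)$ there is an isomorphism $$A/P_{T,\mathfrak m}\cong\mathrm{KP}_{\kappa(\mathfrak m)}(\Gamma_T),\qquad \kappa(\mathfrak m)=C/\mathfrak m.$$ If $\mathbb K$ is uncountable and algebraically closed, then $\Phi$ is bijective.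
   Context: $\mathbb N$ contains $0$. A $k$-graph is a countable small category $\Lambda$ with a functor $d:\Lambda\to\mathbb N^k$ satisfying the factorisation property: if $d(\lambda)=m+n$ there are unique composable $\mu,\nu$ with $\lambda=\mu\nu$, $d(\mu)=m$, $d(\nu)=n$. Objects are identified with $\Lambda^0=d^{-1}(0)$ (vertices); $r,s$ are range and source, and $\mu\nu$ is defined when $s(\mu)=r(\nu)$. Put $v\Lambda^n=\{\lambda: d(\lambda)=n,\ r(\lambda)=v\}$ and $v\Lambda w=\{\lambda:r(\lambda)=v,\ s(\lambda)=w\}$. $\Lambda$ is row-finite if every $v\Lambda^n$ is finite, and has no sources if every $v\Lambda^n$ is nonempty. For a commutative unital ring $R$ and a row-finite $k$-graph $\Lambda$ with no sources, $\mathrm{KP}_R(\Lambda)$ is the universal $R$-algebra generated by $\{p_v:v\in\Lambda^0\}\cup\{s_\lambda,s_{\lambda^*}:\lambda\in\Lambda\setminus\Lambda^0\}$, with $s_v=s_{v^*}=p_v$, subject to: (KP1) the $p_v$ are mutually orthogonal idempotents; (KP2) $s_\lambda s_\mu=s_{\lambda\mu}$ and $s_{\mu^*}s_{\lambda^*}=s_{(\lambda\mu)^*}$ whenever $\lambda\mu$ is defined, and $p_{r(\lambda)}s_\lambda=s_\lambda=s_\lambda p_{s(\lambda)}$, $p_{s(\lambda)}s_{\lambda^*}=s_{\lambda^*}=s_{\lambda^*}p_{r(\lambda)}$; (KP3) if $d(\lambda)=d(\mu)$ then $s_{\lambda^*}s_\mu=\delta_{\lambda,\mu}p_{s(\lambda)}$;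 (KP4) $p_v=\sum_{\lambda\in v\Lambda^n}s_\lambda s_{\lambda^*}$ for $v\in\Lambda^0$, $0\ne n\in\mathbb N^k$. It is unital, with $1=\sum_v p_v$, when $\Lambda^0$ is finite. Infinite paths: $\Gamma^\infty$ is the set of degree-preserving functors $x:\{(p,q):p\le q\in\mathbb N^\ell\}\to\Gamma$ (with $d(x(p,q))=q-p$); $x(n)=x(n,n)$, $v\Gamma^\infty=\{x:x(0)=v\}$, and $(\sigma^mx)(p,q)=x(p+m,q+m)$. An $\ell$-graph $\Gamma$ is aperiodic if for every $v\in\Gamma^0$ there is $x\in v\Gamma^\infty$ with $\sigma^mx\ne\sigma^nx$ whenever $m\ne n$. A set $L\subseteq\Gamma^0$ is hereditary if $v\in L$, $v\Gamma w\ne\varnothing$ imply $w\in L$; it is saturated if $v\in L$ whenever $s(v\Gamma^n)\subseteq L$ for some $0\ne n\in\mathbb N^\ell$. For saturated hereditary $L$, $\Gamma\setminus L=\{\lambda\in\Gamma:s(\lambda)\notin L\}$, an $\ell$-graph with vertex set $\Gamma^0\setminus L$. $\Gamma$ is strongly aperiodic if $\Gamma\setminus L$ is aperiodic for every proper saturated hereditary $L\subsetneq\Gamma^0$. A maximal tail is a nonempty $T\subseteq\Gamma^0$ with: (MT1) $w\in T$, $v\Gamma w\ne\varnothing$ imply $v\in T$; (MT2) for $v\in T$, $n\in\mathbb N^\ell$ there is $\lambda\in v\Gamma^n$ with $s(\lambda)\in T$; (MT3) for $v,w\in T$ there is $z\in T$ with $v\Gamma z\ne\varnothing$ and $w\Gamma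 z\ne\varnothing$. $\mathrm{MT}(\Gamma)$ is the set of maximal tails. For $T\in\mathrm{MT}(\Gamma)$: $H_T=\Gamma^0\setminus T$ (saturated hereditary), $\Gamma_T=\Gamma\setminus H_T$, and $I_{H_T}$ is the two-sided ideal of $A$ generated by $\{p_v:v\in H_T\}$. Pullback: $f^*\Gamma=\{(\lambda,n)\in\Gamma\times\mathbb N^k:d(\lambda)=f(n)\}$, a $k$-graph with degree $d(\lambda,n)=n$ and product $(\lambda,n)(\mu,m)=(\lambda\mu,n+m)$; vertices $(v,0)$ are identified with $v\in\Gamma^0$. $\bar f:\mathbb Z^k\to\mathbb Z^\ell$ is the group completion of $f$. $\mathbb K[H]$ is the group algebra with basis $u_h$ ($h\in H$), $u_hu_g=u_{h+g}$. For $h\in H$ write $h=h_+-h_-$ (coordinatewise positive and negative parts) and put $U_h=\sum_{v\in\Gamma^0}\sum_{\lambda\in v\Gamma^{f(h_+)}}s_{(\lambda,h_+)}s_{(\lambda,h_-)^*}\in A$ (note $f(h_+)=f(h_-)$). The map $\iota:\mathbb K[H]\to A$, $u_h\mapsto U_h$, is an injective unital homomorphism with central image. $\mathrm{Prim}\,A$ is the set of annihilators of simple left $A$-modules; $\mathrm{MaxSpec}\,C$ is the set of maximal ideals of $C$. *)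

(* Defs.v *)
From HB Require Import structures.
From mathcomp Require Import all_boot all_order all_algebra.
From mathcomp Require Import finmap monalg.
From mathcomp Require Import mathcomp_extra boolp classical_sets functions.
From mathcomp Require Import cardinality fsbigop.

Set Implicit Arguments.
Unset Strict Implicit.
Unset Printing Implicit Defensive.

Import GRing.Theory Num.Theory.

Local Open Scope ring_scope.
Local Open Scope classical_set_scope.
Local Open Scope quotient_scope.

Inductive nuterm (R X : Type) : Type :=
| tgen of X
| tzero
| tadd of nuterm R X & nuterm R X
| topp of nuterm R X
| tscale of R & nuterm R X
| tmul of nuterm R X & nuterm R X.

Arguments tgen {R X}.
Arguments tzero {R X}.

HB.instance Definition _ (R X : Type) := gen_eqMixin (nuterm R X).
HB.instance Definition _ (R X : Type) := gen_choiceMixin (nuterm R X).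

(* The least congruence on terms containing E whose quotient is an associative,
   not necessarily unital, R-algebra. *)
Inductive nueq (R : comPzRingType) (X : Type)
    (E : nuterm R X -> nuterm R X -> Prop) :
    nuterm R X -> nuterm R X -> Prop :=
| nueq_rel t u : E t u -> nueq E t u
| nueq_refl t : nueq E t t
| nueq_sym t u : nueq E t u -> nueq E u t
| nueq_trans t u w : nueq E t u -> nueq E u w -> nueq E t w
| nueq_add t t' u u' : nueq E t t' -> nueq E u u' ->
    nueq E (tadd t u) (tadd t' u')
| nueq_opp t t' : nueq E t t' -> nueq E (topp t) (topp t')
| nueq_scale a t t' : nueq E t t' -> nueq E (tscale a t) (tscale a t')
| nueq_mul t t' u u' : nueq E t t' -> nueq E u u' ->
    nueq E (tmul t u) (tmul t' u')
| nueq_addA t u w : nueq E (tadd t (tadd u w)) (tadd (tadd t u) w)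
| nueq_addC t u : nueq E (tadd t u) (tadd u t)
| nueq_add0 t : nueq E (tadd tzero t) t
| nueq_addN t : nueq E (tadd (topp t) t) tzero
| nueq_scaleA a b t : nueq E (tscale a (tscale b t)) (tscale (a * b) t)
| nueq_scale1 t : nueq E (tscale 1 t) t
| nueq_scaleDr a t u :
    nueq E (tscale a (tadd t u)) (tadd (tscale a t) (tscale a u))
| nueq_scaleDl a b t :
    nueq E (tscale (a + b) t) (tadd (tscale a t) (tscale b t))
| nueq_mulA t u w : nueq E (tmul t (tmul u w)) (tmul (tmul t u) w)
| nueq_mulDl t u w : nueq E (tmul (tadd t u) w) (tadd (tmul t w) (tmul u w))
| nueq_mulDr t u w : nueq E (tmul t (tadd u w)) (tadd (tmul t u) (tmul t w))
| nueq_mulZl a t u : nueq E (tmul (tscale a t) u) (tscale a (tmul t u))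
| nueq_mulZr a t u : nueq E (tmul t (tscale a u)) (tscale a (tmul t u)).

Section PresentedAlgebra.
Variables (R : comPzRingType) (X : Type).
Variable E : nuterm R X -> nuterm R X -> Prop.

Definition nueqb (t u : nuterm R X) : bool := `[< nueq E t u >].

Lemma nueqb_refl : reflexive nueqb.
Proof. by move=> t; apply/asboolP; exact: nueq_refl. Qed.

Lemma nueqb_sym : symmetric nueqb.
Proof. by move=> t u; apply/asboolP/asboolP; exact: nueq_sym. Qed.

Lemma nueqb_trans : transitive nueqb.
Proof.
move=> u t w /asboolP tu /asboolP uw; apply/asboolP; exact: nueq_trans tu uw.
Qed.

Canonical nueq_equiv := EquivRel nueqb nueqb_refl nueqb_sym nueqb_trans.

Definition presalg : Type := {eq_quot nueq_equiv}.
HB.instance Definition _ := Choice.on presalg.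

Definition pclass (t : nuterm R X) : presalg := \pi_{eq_quot nueq_equiv} t.
Definition prepr (x : presalg) : nuterm R X :=
  repr (x : {eq_quot nueq_equiv}).

Lemma preprK x : pclass (prepr x) = x.
Proof. exact: reprK. Qed.

Lemma pclassP t u : pclass t = pclass u <-> nueq E t u.
Proof.
rewrite /pclass; split; first by move/eqmodP => /asboolP.
by move=> h; apply/eqmodP/asboolP.
Qed.

Lemma prepr_class t : nueq E (prepr (pclass t)) t.
Proof. by apply/pclassP; rewrite preprK. Qed.

Lemma presalg_ind (P : presalg -> Prop) :
  (forall t, P (pclass t)) -> forall x, P x.
Proof. by move=> h x; rewrite -[x]preprK. Qed.

Definition padd (x y : presalg) : presalg := pclass (tadd (prepr x) (prepr y)).
Definition popp (x : presalg) : presalg := pclass (topp (prepr x)).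
Definition pscale (a : R) (x : presalg) : presalg :=
  pclass (tscale a (prepr x)).
Definition pmul (x y : presalg) : presalg := pclass (tmul (prepr x) (prepr y)).

Lemma paddE t u : padd (pclass t) (pclass u) = pclass (tadd t u).
Proof. by apply/pclassP; apply: nueq_add; exact: prepr_class. Qed.
Lemma poppE t : popp (pclass t) = pclass (topp t).
Proof. by apply/pclassP; apply: nueq_opp; exact: prepr_class. Qed.
Lemma pscaleE a t : pscale a (pclass t) = pclass (tscale a t).
Proof. by apply/pclassP; apply: nueq_scale; exact: prepr_class. Qed.
Lemma pmulE t u : pmul (pclass t) (pclass u) = pclass (tmul t u).
Proof. by apply/pclassP; apply: nueq_mul; exact: prepr_class. Qed.

Let pE := (paddE, poppE, pscaleE, pmulE).

Lemma paddA : associative padd.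
Proof.
elim/presalg_ind=> t; elim/presalg_ind=> u; elim/presalg_ind=> w.
by rewrite !pE; apply/pclassP; exact: nueq_addA.
Qed.
Lemma paddC : commutative padd.
Proof.
elim/presalg_ind=> t; elim/presalg_ind=> u.
by rewrite !pE; apply/pclassP; exact: nueq_addC.
Qed.
Lemma padd0 : left_id (pclass tzero) padd.
Proof. by elim/presalg_ind=> t; rewrite pE; apply/pclassP; exact: nueq_add0. Qed.
Lemma paddN : left_inverse (pclass tzero) popp padd.
Proof. by elim/presalg_ind=> t; rewrite !pE; apply/pclassP; exact: nueq_addN. Qed.

HB.instance Definition _ := GRing.isZmodule.Build presalg
  paddA paddC padd0 paddN.

Lemma pscaleA a b x : pscale a (pscale b x) = pscale (a * b) x.
Proof.
by elim/presalg_ind: x => t; rewrite !pE; apply/pclassP; exact: nueq_scaleA.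
Qed.
Lemma pscale1 : left_id 1 pscale.
Proof.
by elim/presalg_ind=> t; rewrite !pE; apply/pclassP; exact: nueq_scale1.
Qed.
Lemma pscaleDr : right_distributive pscale +%R.
Proof.
move=> a; elim/presalg_ind=> t; elim/presalg_ind=> u.
by rewrite /GRing.add /= !pE; apply/pclassP; exact: nueq_scaleDr.
Qed.
Lemma pscaleDl x : {morph pscale^~ x : a b / a + b}.
Proof.
move=> a b; elim/presalg_ind: x => t.
by rewrite [RHS]/GRing.add /= !pE; apply/pclassP; exact: nueq_scaleDl.
Qed.

HB.instance Definition _ := GRing.Zmodule_isLmodule.Build R presalg
  pscaleA pscale1 pscaleDr pscaleDl.

Lemma pmulA : associative pmul.
Proof.
elim/presalg_ind=> t; elim/presalg_ind=> u; elim/presalg_ind=> w.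
by rewrite !pE; apply/pclassP; exact: nueq_mulA.
Qed.
Lemma pmulDl : left_distributive pmul +%R.
Proof.
elim/presalg_ind=> t; elim/presalg_ind=> u; elim/presalg_ind=> w.
by rewrite /GRing.add /= !pE; apply/pclassP; exact: nueq_mulDl.
Qed.
Lemma pmulDr : right_distributive pmul +%R.
Proof.
elim/presalg_ind=> t; elim/presalg_ind=> u; elim/presalg_ind=> w.
by rewrite /GRing.add /= !pE; apply/pclassP; exact: nueq_mulDr.
Qed.
Lemma pmulZl a x y : pmul (a *: x) y = a *: pmul x y.
Proof.
elim/presalg_ind: x => t; elim/presalg_ind: y => u.
by rewrite /GRing.scale /= !pE; apply/pclassP; exact: nueq_mulZl.
Qed.
Lemma pmulZr a x y : pmul x (a *: y) = a *: pmul x y.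
Proof.
elim/presalg_ind: x => t; elim/presalg_ind: y => u.
by rewrite /GRing.scale /= !pE; apply/pclassP; exact: nueq_mulZr.
Qed.

Lemma pmul0 : left_zero 0 pmul.
Proof. by move=> x; apply: (addIr (pmul 0 x)); rewrite -pmulDl !add0r. Qed.
Lemma pmulr0 : right_zero 0 pmul.
Proof. by move=> x; apply: (addIr (pmul x 0)); rewrite -pmulDr !add0r. Qed.
Lemma pmulNl x y : pmul (- x) y = - pmul x y.
Proof. by apply: (addIr (pmul x y)); rewrite -pmulDl !addNr pmul0. Qed.
Lemma pmulNr x y : pmul x (- y) = - pmul x y.
Proof. by apply: (addIr (pmul x y)); rewrite -pmulDr !addNr pmulr0. Qed.

End PresentedAlgebra.

(* The product [gcomp a b] is meaningful only when [gsrc a = grng b]; its other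
   values are unconstrained and never used.  By the factorisation property,
   [gid] identifies [gvert] with the set of morphisms of degree 0. *)
Record kgraph (k : nat) := KGraph {
  gvert : countType;
  gmor : countType;
  grng : gmor -> gvert;
  gsrc : gmor -> gvert;
  gid : gvert -> gmor;
  gcomp : gmor -> gmor -> gmor;
  gdeg : gmor -> 'rV[nat]_k;
  grng_id : forall v, grng (gid v) = v;
  gsrc_id : forall v, gsrc (gid v) = v;
  grng_comp : forall a b, gsrc a = grng b -> grng (gcomp a b) = grng a;
  gsrc_comp : forall a b, gsrc a = grng b -> gsrc (gcomp a b) = gsrc b;
  gcomp_idl : forall a, gcomp (gid (grng a)) a = a;
  gcomp_idr : forall a, gcomp a (gid (gsrc a)) = a;
  gcompA : forall a b c, gsrc a = grng b -> gsrc b = grng c ->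
    gcomp a (gcomp b c) = gcomp (gcomp a b) c;
  gdeg_id : forall v, gdeg (gid v) = 0;
  gdeg_comp : forall a b, gsrc a = grng b ->
    gdeg (gcomp a b) = gdeg a + gdeg b;
  gfactor : forall a m n, gdeg a = m + n ->
    exists! p : gmor * gmor, [/\ gsrc p.1 = grng p.2, a = gcomp p.1 p.2,
      gdeg p.1 = m & gdeg p.2 = n]
}.

Arguments gid {k} G v : rename.
Arguments grng {k G} a : rename.
Arguments gsrc {k G} a : rename.
Arguments gcomp {k G} a b : rename.
Arguments gdeg {k G} a : rename.

Section KGraphNotions.
Variables (k : nat) (G : kgraph k).

Definition paths_from (v : gvert G) (n : 'rV[nat]_k) : set (gmor G) :=
  [set a | grng a = v /\ gdeg a = n].

Definition paths_between (v w : gvert G) : set (gmor G) :=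
  [set a | grng a = v /\ gsrc a = w].

Definition row_finite : Prop := forall v n, finite_set (paths_from v n).
Definition no_sources : Prop := forall v n, paths_from v n !=set0.
Definition finitely_many_vertices : Prop := finite_set [set: gvert G].

Definition hereditary (L : set (gvert G)) : Prop :=
  forall v w, L v -> paths_between v w !=set0 -> L w.

Definition saturated (L : set (gvert G)) : Prop :=
  forall v n, n != 0 -> gsrc @` paths_from v n `<=` L -> L v.

Record maximal_tail (T : set (gvert G)) : Prop := {
  mt_nonempty : T !=set0;
  mt1 : forall v w, T w -> paths_between v w !=set0 -> T v;
  mt2 : forall v n, T v -> exists2 a, paths_from v n a & T (gsrc a);
  mt3 : forall v w, T v -> T w ->
    exists z, [/\ T z, paths_between v z !=set0 & paths_between w z !=set0]
}.

Definition MT : set (set (gvert G)) := [set T | maximal_tail T].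

Lemma hereditary_compl (T : set (gvert G)) :
  maximal_tail T -> hereditary (~` T).
Proof. by move=> mT v w nTv vw Tw; apply: nTv; exact: (mt1 mT Tw vw). Qed.

Definition lev (p q : 'rV[nat]_k) : bool := [forall i, (p ord0 i <= q ord0 i)%N].

Lemma lev_add2r m p q : lev p q -> lev (p + m) (q + m).
Proof.
by move=> /forallP h; apply/forallP => i; rewrite !mxE leq_add2r; exact: h.
Qed.

Record infpath := InfPath {
  ip_obj : 'rV[nat]_k -> gvert G;
  ip_mor : forall p q, lev p q -> gmor G;
  ip_rng : forall p q (h : lev p q), grng (ip_mor h) = ip_obj p;
  ip_src : forall p q (h : lev p q), gsrc (ip_mor h) = ip_obj q;
  ip_id : forall p (h : lev p p), ip_mor h = gid G (ip_obj p);
  ip_comp : forall p q r (hpq : lev p q) (hqr : lev q r) (hpr : lev p r),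
    ip_mor hpr = gcomp (ip_mor hpq) (ip_mor hqr);
  ip_deg : forall p q (h : lev p q), p + gdeg (ip_mor h) = q
}.

Lemma shift_deg (m : 'rV[nat]_k) (x : infpath) p q (h : lev p q) :
  p + gdeg (ip_mor x (lev_add2r m h)) = q.
Proof.
have := ip_deg x (lev_add2r m h); move=> /rowP e; apply/rowP => i.
have := e i; rewrite !mxE /GRing.add /= => e'.
by apply: (@addIn (m ord0 i)); rewrite -e' addnAC.
Qed.

Definition shift (m : 'rV[nat]_k) (x : infpath) : infpath :=
  @InfPath (fun p => ip_obj x (p + m))
    (fun p q h => ip_mor x (lev_add2r m h))
    (fun p q h => ip_rng x (lev_add2r m h))
    (fun p q h => ip_src x (lev_add2r m h))
    (fun p h => ip_id x (lev_add2r m h))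
    (fun p q r hpq hqr hpr =>
       ip_comp x (lev_add2r m hpq) (lev_add2r m hqr) (lev_add2r m hpr))
    (fun p q h => shift_deg m x h).

Definition aperiodic : Prop :=
  forall v, exists2 x : infpath, ip_obj x 0 = v &
    forall m n, m <> n -> shift m x <> shift n x.

End KGraphNotions.

Arguments MT {k} G.

Section Subgraph.
Variables (k : nat) (G : kgraph k) (L : set (gvert G)) (hL : hereditary L).

Definition sub_vert := {v : gvert G | v \notin L}.
Definition sub_mor := {a : gmor G | gsrc a \notin L}.

HB.instance Definition _ := Countable.on sub_vert.
HB.instance Definition _ := SubType.on sub_vert.
HB.instance Definition _ := Countable.on sub_mor.
HB.instance Definition _ := SubType.on sub_mor.

Lemma sub_rng_subproof (a : sub_mor) : grng (val a) \notin L.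
Proof.
apply: contra (valP a); rewrite !inE => h.
by apply: (hL h); exists (val a).
Qed.

Lemma sub_id_subproof (v : sub_vert) : gsrc (gid G (val v)) \notin L.
Proof. by rewrite gsrc_id; exact: (valP v). Qed.

Definition sub_rng (a : sub_mor) : sub_vert := Sub (grng (val a)) (sub_rng_subproof a).
Definition sub_src (a : sub_mor) : sub_vert := Sub (gsrc (val a)) (valP a).
Definition sub_id (v : sub_vert) : sub_mor := Sub (gid G (val v)) (sub_id_subproof v).
Definition sub_comp (a b : sub_mor) : sub_mor :=
  insubd a (gcomp (val a) (val b)).
Definition sub_deg (a : sub_mor) := gdeg (val a).

Lemma sub_composable a b :
  sub_src a = sub_rng b -> gsrc (val a) = grng (val b).
Proof. by move/(congr1 val). Qed.

Lemma val_sub_comp a b : sub_src a = sub_rng b ->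
  val (sub_comp a b) = gcomp (val a) (val b).
Proof.
move=> /sub_composable h; rewrite val_insubd gsrc_comp //.
by rewrite (valP b).
Qed.

Lemma sub_rng_comp a b : sub_src a = sub_rng b ->
  sub_rng (sub_comp a b) = sub_rng a.
Proof.
move=> h; apply: val_inj => /=.
by rewrite val_sub_comp // grng_comp //; exact: sub_composable.
Qed.

Lemma sub_src_comp a b : sub_src a = sub_rng b ->
  sub_src (sub_comp a b) = sub_src b.
Proof.
move=> h; apply: val_inj => /=.
by rewrite val_sub_comp // gsrc_comp //; exact: sub_composable.
Qed.

Lemma sub_factor a m n : sub_deg a = m + n ->
  exists! p : sub_mor * sub_mor, [/\ sub_src p.1 = sub_rng p.2,
    a = sub_comp p.1 p.2, sub_deg p.1 = m & sub_deg p.2 = n].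
Proof.
move=> /gfactor[[b c] [[/= bc abc db dc] uniq_bc]].
have hc : gsrc c \notin L by have := valP a; rewrite /= abc gsrc_comp.
have hb : gsrc b \notin L.
  by apply: contra hc; rewrite bc !inE => h; apply: (hL h); exists c.
have hbc : sub_src (exist _ b hb) = sub_rng (exist _ c hc) by apply: val_inj.
exists (exist _ b hb, exist _ c hc); split=> /=.
  by split=> //; apply: val_inj; rewrite val_sub_comp.
move=> [b' c'] /= [e1 e2 e3 e4].
have [eb ec] : (b, c) = (val b', val c').
  apply: uniq_bc; split=> //=; first exact: sub_composable.
  by rewrite e2 val_sub_comp.
by congr pair; apply: val_inj.
Qed.

Definition subgraph : kgraph k.
refine (@KGraph k sub_vert sub_mor sub_rng sub_src sub_id sub_comp sub_deg
  _ _ sub_rng_comp sub_src_comp _ _ _ _ _ sub_factor).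
- by move=> v; apply: val_inj; rewrite /= grng_id.
- by move=> v; apply: val_inj; rewrite /= gsrc_id.
- move=> a; apply: val_inj; rewrite val_sub_comp /= ?gcomp_idl //.
  by apply: val_inj; rewrite /= gsrc_id.
- move=> a; apply: val_inj; rewrite val_sub_comp /= ?gcomp_idr //.
  by apply: val_inj; rewrite /= grng_id.
- move=> a b c ab bc; apply: val_inj.
  rewrite !val_sub_comp ?sub_rng_comp ?sub_src_comp //.
  by rewrite gcompA //; exact: sub_composable.
- by move=> v; rewrite /sub_deg /= gdeg_id.
- move=> a b ab; rewrite /sub_deg val_sub_comp // gdeg_comp //.
  exact: sub_composable.
Defined.


Lemma finitely_many_vertices_sub :
  finitely_many_vertices G -> finitely_many_vertices subgraph.
Proof.
move=> /finite_seqP[s hs]; apply/finite_seqP; exists (pmap insub s).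
apply/seteqP; split=> // v _ /=; rewrite mem_pmap_sub.
by have : [set: gvert G] (val v) by []; rewrite hs.
Qed.

End Subgraph.

Section Pullback.
Variables (k l : nat) (f : {additive 'rV[nat]_k -> 'rV[nat]_l}).
Variable G : kgraph l.

Definition pb_mor := {x : gmor G * 'rV[nat]_k | gdeg x.1 == f x.2}.

HB.instance Definition _ := Countable.on pb_mor.
HB.instance Definition _ := SubType.on pb_mor.

Lemma pb_id_subproof (v : gvert G) :
  gdeg (gid G v, 0 : 'rV[nat]_k).1 == f (gid G v, 0 : 'rV[nat]_k).2.
Proof. by rewrite /= gdeg_id raddf0. Qed.

Definition pb_rng (x : pb_mor) : gvert G := grng (val x).1.
Definition pb_src (x : pb_mor) : gvert G := gsrc (val x).1.
Definition pb_id (v : gvert G) : pb_mor := Sub (gid G v, 0) (pb_id_subproof v).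
Definition pb_comp (x y : pb_mor) : pb_mor :=
  insubd x (gcomp (val x).1 (val y).1, (val x).2 + (val y).2).
Definition pb_deg (x : pb_mor) : 'rV[nat]_k := (val x).2.

Lemma val_pb_comp x y : pb_src x = pb_rng y ->
  val (pb_comp x y) = (gcomp (val x).1 (val y).1, (val x).2 + (val y).2).
Proof.
move=> h; rewrite val_insubd /= gdeg_comp // raddfD.
by rewrite (eqP (valP x)) (eqP (valP y)) eqxx.
Qed.

Lemma pb_rng_comp x y : pb_src x = pb_rng y -> pb_rng (pb_comp x y) = pb_rng x.
Proof. by move=> h; rewrite /pb_rng val_pb_comp //= grng_comp. Qed.

Lemma pb_src_comp x y : pb_src x = pb_rng y -> pb_src (pb_comp x y) = pb_src y.
Proof. by move=> h; rewrite /pb_src val_pb_comp //= gsrc_comp. Qed.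

Lemma pb_factor x m n : pb_deg x = m + n ->
  exists! p : pb_mor * pb_mor, [/\ pb_src p.1 = pb_rng p.2,
    x = pb_comp p.1 p.2, pb_deg p.1 = m & pb_deg p.2 = n].
Proof.
case: x => -[a r] /= ar; rewrite /pb_deg /= => er.
have /gfactor[[b c] [[/= bc abc db dc] uniq_bc]] : gdeg a = f m + f n.
  by rewrite (eqP ar) er raddfD.
have hb : gdeg (b, m).1 == f (b, m).2 by apply/eqP.
have hc : gdeg (c, n).1 == f (c, n).2 by apply/eqP.
exists (exist _ (b, m) hb, exist _ (c, n) hc); split=> /=.
  by split=> //; apply: val_inj; rewrite val_pb_comp //= abc er.
move=> [[[b' m'] hb'] [[c' n'] hc']] /= [e1 e2 e3 e4].
simpl in *; subst m' n'.
have [eb ec] : (b, c) = (b', c').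
  apply: uniq_bc; split=> /=; [exact: e1| | exact/eqP | exact/eqP].
  by move/(congr1 val): e2; rewrite val_pb_comp //= => -[].
by congr pair; apply: val_inj => /=; rewrite ?eb ?ec.
Qed.

Definition pullback : kgraph k.
refine (@KGraph k (gvert G) pb_mor pb_rng pb_src pb_id pb_comp pb_deg
  _ _ pb_rng_comp pb_src_comp _ _ _ _ _ pb_factor).
- by move=> v; rewrite /pb_rng /= grng_id.
- by move=> v; rewrite /pb_src /= gsrc_id.
- move=> x; apply: val_inj; rewrite val_pb_comp; last first.
    by rewrite /pb_src /= gsrc_id.
  by rewrite /= gcomp_idl add0r -surjective_pairing.
- move=> x; apply: val_inj; rewrite val_pb_comp; last first.
    by rewrite /pb_rng /= grng_id.
  by rewrite /= gcomp_idr addr0 -surjective_pairing.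
- move=> x y z xy yz; apply: val_inj.
  rewrite !val_pb_comp ?pb_rng_comp ?pb_src_comp //=.
  by rewrite gcompA // addrA.
- by [].
- by move=> x y xy; rewrite /pb_deg val_pb_comp.
Defined.

Lemma finitely_many_vertices_pullback :
  finitely_many_vertices G -> finitely_many_vertices pullback.
Proof. by []. Qed.

End Pullback.

Inductive kpgen (k : nat) (G : kgraph k) : Type :=
| gen_p of gvert G
| gen_s of gmor G
| gen_sstar of gmor G.

Section KumjianPask.
Variables (R : comPzRingType) (k : nat) (G : kgraph k).

Local Notation p v := (tgen (gen_p v)).
Local Notation s a := (tgen (gen_s a)).
Local Notation s' a := (tgen (gen_sstar a)).

(* The generators attached to identity morphisms are redundant: they are
   identified with the vertex generators by the first two relations.  In the
   last relation, e is any duplicate-free enumeration of the (finite) set of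
   paths of degree n with range v. *)
Inductive kprel : nuterm R (kpgen G) -> nuterm R (kpgen G) -> Prop :=
| kp_s_id v : kprel (s (gid G v)) (p v)
| kp_sstar_id v : kprel (s' (gid G v)) (p v)
| kp1 v w : kprel (tmul (p v) (p w)) (if v == w then p v else tzero)
| kp2_s a b : gsrc a = grng b -> kprel (tmul (s a) (s b)) (s (gcomp a b))
| kp2_sstar a b : gsrc a = grng b ->
    kprel (tmul (s' b) (s' a)) (s' (gcomp a b))
| kp2_ps a : kprel (tmul (p (grng a)) (s a)) (s a)
| kp2_sp a : kprel (tmul (s a) (p (gsrc a))) (s a)
| kp2_psstar a : kprel (tmul (p (gsrc a)) (s' a)) (s' a)
| kp2_sstarp a : kprel (tmul (s' a) (p (grng a))) (s' a)
| kp3 a b : gdeg a = gdeg b ->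
    kprel (tmul (s' a) (s b)) (if a == b then p (gsrc a) else tzero)
| kp4 v n (e : seq (gmor G)) : n != 0 -> uniq e ->
    (forall a, a \in e <-> paths_from v n a) ->
    kprel (p v) (foldr (fun a t => tadd (tmul (s a) (s' a)) t) tzero e).

Definition KP : Type := presalg kprel.
HB.instance Definition _ := GRing.Lmodule.on KP.

Definition kp_p (v : gvert G) : KP := pclass kprel (p v).
Definition kp_s (a : gmor G) : KP := pclass kprel (s a).
Definition kp_sstar (a : gmor G) : KP := pclass kprel (s' a).
Definition kp_mul (x y : KP) : KP := pmul x y.

Lemma kp_pp v w : kp_mul (kp_p v) (kp_p w) = if v == w then kp_p v else 0.
Proof.
rewrite [kp_mul _ _]pmulE [0]/(pclass kprel tzero) -fun_if.
by apply/pclassP/nueq_rel; exact: kp1.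
Qed.

End KumjianPask.

(* The algebra KP R G is not unital in general; the phantom argument fG allows
   a unital ring structure on it, with unit the sum of the vertex generators. *)
Definition KPu (R : comPzRingType) (k : nat) (G : kgraph k)
  (fG : finitely_many_vertices G) : Type := KP R G.

Section UnitalKumjianPask.
Variables (R : comPzRingType) (k : nat) (G : kgraph k).
Variable fG : finitely_many_vertices G.

HB.instance Definition _ := GRing.Lmodule.on (KPu R fG).

Definition kp_one : KPu R fG := \sum_(v \in [set: gvert G]) kp_p R v.

Lemma kp_oneE : kp_one = \sum_(v <- fset_set [set: gvert G]) kp_p R v.
Proof. by rewrite /kp_one fsbig_finite. Qed.

Lemma kp_one_mulp v : kp_mul kp_one (kp_p R v) = kp_p R v.
Proof.
rewrite kp_oneE /kp_mul.
rewrite (big_morph (fun x => pmul x (kp_p R v)) (id1 := 0) (op1 := +%R)).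
- rewrite (big_fsetD1 v) /=; last by rewrite in_fset_set // inE.
  rewrite [pmul _ _]kp_pp eqxx big1_fset ?addr0 // => w.
  by rewrite !inE => /andP[wv _] _; rewrite [pmul _ _]kp_pp (negbTE wv).
- by move=> x y; exact: pmulDl.
- exact: pmul0.
Qed.

Lemma kp_mulp_one v : kp_mul (kp_p R v) kp_one = kp_p R v.
Proof.
rewrite kp_oneE /kp_mul.
rewrite (big_morph (fun x => pmul (kp_p R v) x) (id1 := 0) (op1 := +%R)).
- rewrite (big_fsetD1 v) /=; last by rewrite in_fset_set // inE.
  rewrite [pmul _ _]kp_pp eqxx big1_fset ?addr0 // => w.
  by rewrite !inE => /andP[wv _] _; rewrite [pmul _ _]kp_pp eq_sym (negbTE wv).
- by move=> x y; exact: pmulDr.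
- exact: pmulr0.
Qed.

Lemma kp_gen_lr g : exists v w,
  kp_mul (kp_p R v) (pclass (@kprel R k G) (tgen g)) = pclass _ (tgen g) /\
  kp_mul (pclass (@kprel R k G) (tgen g)) (kp_p R w) = pclass _ (tgen g).
Proof.
case: g => [v|a|a].
- by exists v, v; rewrite !kp_pp eqxx.
- exists (grng a), (gsrc a); rewrite /kp_mul !pmulE.
  by split; apply/pclassP/nueq_rel; [exact: kp2_ps|exact: kp2_sp].
- exists (gsrc a), (grng a); rewrite /kp_mul !pmulE.
  by split; apply/pclassP/nueq_rel; [exact: kp2_psstar|exact: kp2_sstarp].
Qed.

Lemma kp_mul1l : left_id kp_one (@kp_mul R k G).
Proof.
elim/presalg_ind; elim=> [g||t IHt u IHu|t IHt|a t IHt|t IHt u IHu].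
- have [v [_ [<- _]]] := kp_gen_lr g.
  by rewrite /kp_mul pmulA [pmul kp_one _]kp_one_mulp.
- exact: pmulr0.
- by rewrite -paddE [LHS]pmulDr [pmul _ _]IHt [pmul _ _]IHu.
- by rewrite -poppE [LHS]pmulNr [pmul _ _]IHt.
- by rewrite -pscaleE [LHS]pmulZr [pmul _ _]IHt.
- by rewrite -pmulE /kp_mul pmulA [pmul kp_one _]IHt.
Qed.

Lemma kp_mul1r : right_id kp_one (@kp_mul R k G).
Proof.
elim/presalg_ind; elim=> [g||t IHt u IHu|t IHt|a t IHt|t IHt u IHu].
- have [_ [w [_ <-]]] := kp_gen_lr g.
  by rewrite /kp_mul -pmulA [pmul _ kp_one]kp_mulp_one.
- exact: pmul0.
- by rewrite -paddE [LHS]pmulDl [pmul _ _]IHt [pmul _ _]IHu.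
- by rewrite -poppE [LHS]pmulNl [pmul _ _]IHt.
- by rewrite -pscaleE [LHS]pmulZl [pmul _ _]IHt.
- by rewrite -pmulE /kp_mul -pmulA [pmul _ kp_one]IHu.
Qed.

HB.instance Definition _ := GRing.Zmodule_isPzRing.Build (KPu R fG)
  (@pmulA R _ (@kprel R k G)) kp_mul1l kp_mul1r
  (@pmulDl R _ (@kprel R k G)) (@pmulDr R _ (@kprel R k G)).

End UnitalKumjianPask.

Section Ideals.
Variable A : pzRingType.

Record two_sided_ideal (I : set A) : Prop := {
  tsi0 : I 0;
  tsiD : forall x y, I x -> I y -> I (x + y);
  tsiMl : forall a x, I x -> I (a * x);
  tsiMr : forall x a, I x -> I (x * a)
}.

Definition ideal_gen (X : set A) : set A :=
  \bigcap_(I in [set I | two_sided_ideal I /\ X `<=` I]) I.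

Definition left_span (X : set A) : set A :=
  [set a | exists2 s : seq (A * A),
     (forall u, u \in s -> X u.2) & a = \sum_(u <- s) u.1 * u.2].

Record maximal_ideal (I : set A) : Prop := {
  maxi_ideal : two_sided_ideal I;
  maxi_proper : I <> setT;
  maxi_max : forall J, two_sided_ideal J -> I `<=` J -> J = I \/ J = setT
}.

Definition MaxSpec : set (set A) := [set I | maximal_ideal I].

Record submodule (M : lmodType A) (N : set M) : Prop := {
  subm0 : N 0;
  submD : forall x y, N x -> N y -> N (x + y);
  submZ : forall a x, N x -> N (a *: x)
}.

Definition simple_module (M : lmodType A) : Prop :=
  (exists x : M, x != 0) /\
  forall N : set M, submodule N -> N = [set 0] \/ N = setT.

Definition annihilator (M : lmodType A) : set A :=
  [set a | forall x : M, a *: x = 0].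

Definition Prim : set (set A) :=
  [set I | exists2 M : lmodType A, simple_module M & I = annihilator M].

End Ideals.

Arguments MaxSpec A : clear implicits.
Arguments Prim A : clear implicits.

Section QuotientRing.
Variables (A : pzRingType) (I : set A) (hI : two_sided_ideal I).

Definition idealrel (x y : A) : bool := `[< I (x - y) >].

Lemma tsiN x : I x -> I (- x).
Proof. by move=> Ix; rewrite -mulN1r; exact: tsiMl. Qed.

Lemma idealrel_refl : reflexive idealrel.
Proof. by move=> x; apply/asboolP; rewrite subrr; exact: tsi0. Qed.

Lemma idealrel_sym : symmetric idealrel.
Proof.
by move=> x y; apply/asboolP/asboolP => h; rewrite -opprB; exact: tsiN.
Qed.

Lemma idealrel_trans : transitive idealrel.
Proof.
move=> y x z /asboolP xy /asboolP yz; apply/asboolP.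
by rewrite -(subrKA y); exact: tsiD.
Qed.

Canonical idealrel_equiv :=
  EquivRel idealrel idealrel_refl idealrel_sym idealrel_trans.

Definition ring_quot : Type := {eq_quot idealrel_equiv}.
HB.instance Definition _ := Choice.on ring_quot.

Definition quot_map (x : A) : ring_quot := \pi_{eq_quot idealrel_equiv} x.
Definition quot_repr (x : ring_quot) : A :=
  repr (x : {eq_quot idealrel_equiv}).

Lemma quot_reprK x : quot_map (quot_repr x) = x.
Proof. exact: reprK. Qed.

Lemma quot_mapP x y : quot_map x = quot_map y <-> I (x - y).
Proof.
rewrite /quot_map; split; first by move/eqmodP => /asboolP.
by move=> h; apply/eqmodP/asboolP.
Qed.

Lemma quot_repr_map x : I (quot_repr (quot_map x) - x).
Proof. by apply/quot_mapP; rewrite quot_reprK. Qed.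

Lemma ring_quot_ind (P : ring_quot -> Prop) :
  (forall x, P (quot_map x)) -> forall x, P x.
Proof. by move=> h x; rewrite -[x]quot_reprK. Qed.

Definition quot_add x y := quot_map (quot_repr x + quot_repr y).
Definition quot_opp x := quot_map (- quot_repr x).
Definition quot_mul x y := quot_map (quot_repr x * quot_repr y).

Lemma quot_addE x y : quot_add (quot_map x) (quot_map y) = quot_map (x + y).
Proof.
by apply/quot_mapP; rewrite opprD addrACA; apply: tsiD => //;
  exact: quot_repr_map.
Qed.

Lemma quot_oppE x : quot_opp (quot_map x) = quot_map (- x).
Proof. by apply/quot_mapP; rewrite -opprD; apply: tsiN; exact: quot_repr_map. Qed.

Lemma quot_mulE x y : quot_mul (quot_map x) (quot_map y) = quot_map (x * y).
Proof.
apply/quot_mapP; set x' := quot_repr _; set y' := quot_repr _.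
have -> : x' * y' - x * y = (x' - x) * y' + x * (y' - y).
  by rewrite mulrBl mulrBr addrA subrK.
apply: tsiD => //; [apply: tsiMr|apply: tsiMl] => //; exact: quot_repr_map.
Qed.

Let qE := (quot_addE, quot_oppE, quot_mulE).

Lemma quot_addA : associative quot_add.
Proof.
elim/ring_quot_ind=> x; elim/ring_quot_ind=> y; elim/ring_quot_ind=> z.
by rewrite !qE addrA.
Qed.
Lemma quot_addC : commutative quot_add.
Proof.
by elim/ring_quot_ind=> x; elim/ring_quot_ind=> y; rewrite !qE addrC.
Qed.
Lemma quot_add0 : left_id (quot_map 0) quot_add.
Proof. by elim/ring_quot_ind=> x; rewrite qE add0r. Qed.
Lemma quot_addN : left_inverse (quot_map 0) quot_opp quot_add.
Proof. by elim/ring_quot_ind=> x; rewrite !qE addNr. Qed.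

HB.instance Definition _ := GRing.isZmodule.Build ring_quot
  quot_addA quot_addC quot_add0 quot_addN.

Lemma quot_mulA : associative quot_mul.
Proof.
elim/ring_quot_ind=> x; elim/ring_quot_ind=> y; elim/ring_quot_ind=> z.
by rewrite !qE mulrA.
Qed.
Lemma quot_mul1 : left_id (quot_map 1) quot_mul.
Proof. by elim/ring_quot_ind=> x; rewrite qE mul1r. Qed.
Lemma quot_mulr1 : right_id (quot_map 1) quot_mul.
Proof. by elim/ring_quot_ind=> x; rewrite qE mulr1. Qed.
Lemma quot_mulDl : left_distributive quot_mul +%R.
Proof.
elim/ring_quot_ind=> x; elim/ring_quot_ind=> y; elim/ring_quot_ind=> z.
by rewrite /GRing.add /= !qE mulrDl.
Qed.
Lemma quot_mulDr : right_distributive quot_mul +%R.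
Proof.
elim/ring_quot_ind=> x; elim/ring_quot_ind=> y; elim/ring_quot_ind=> z.
by rewrite /GRing.add /= !qE mulrDr.
Qed.

HB.instance Definition _ := GRing.Zmodule_isPzRing.Build ring_quot
  quot_mulA quot_mul1 quot_mulr1 quot_mulDl quot_mulDr.

End QuotientRing.

Section QuotientComRing.
Variables (A : comPzRingType) (I : set A) (hI : two_sided_ideal I).

Lemma quot_mulC : commutative (@quot_mul A I hI).
Proof.
by elim/ring_quot_ind=> x; elim/ring_quot_ind=> y; rewrite !quot_mulE mulrC.
Qed.

HB.instance Definition _ :=
  GRing.PzRing_hasCommutativeMul.Build (ring_quot hI) quot_mulC.

End QuotientComRing.

(* The module underlying R[H] is the free module on H; monoid algebras in the
   library exclude nontrivial groups, so the convolution product is added here.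
   The basis element u_h is << h >>. *)
Definition grpalg (R : comNzRingType) (H : zmodType) : Type := {malg R[H]}.

Section GroupAlgebra.
Variables (R : comNzRingType) (H : zmodType).

Local Open Scope fset_scope.

HB.instance Definition _ := GRing.Lmodule.on (grpalg R H).

Implicit Types (x y z : grpalg R H) (g h : H).

Definition grpalg_u h : grpalg R H := << (1 : R) *g h >>.
Definition grpalg_one : grpalg R H := grpalg_u 0.

Definition grpalg_mul x y : grpalg R H :=
  \sum_(g <- msupp x) \sum_(h <- msupp y) << x@_g * y@_h *g (g + h)%R >>.

Lemma grpalg_mulw (d1 d2 : {fset H}) x y :
  msupp x `<=` d1 -> msupp y `<=` d2 ->
  grpalg_mul x y = \sum_(g <- d1) \sum_(h <- d2) << x@_g * y@_h *g (g + h)%R >>.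
Proof.
move=> le_d1 le_d2; rewrite /grpalg_mul (big_fset_incl _ le_d1) /=.
  apply/eq_bigr=> g _; apply/big_fset_incl => // h _ /mcoeff_outdom ->.
  by rewrite mulr0 monalgU0.
move=> g _ /mcoeff_outdom xg.
by rewrite big1 => // h _; rewrite xg mul0r monalgU0.
Qed.

Lemma grpalg_mulC : commutative grpalg_mul.
Proof.
move=> x y; rewrite /grpalg_mul exchange_big /=; apply/eq_bigr => g _.
by apply/eq_bigr => h _; rewrite mulrC addrC.
Qed.

Lemma grpalg_mulDl : left_distributive grpalg_mul +%R.
Proof.
move=> x y z.
rewrite (grpalg_mulw (fsubsetUl (msupp x) (msupp y)) (fsubset_refl (msupp z))).
rewrite (grpalg_mulw (fsubsetUr (msupp x) (msupp y)) (fsubset_refl (msupp z))).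
rewrite (grpalg_mulw (msuppD_le _ _) (fsubset_refl _)).
rewrite -big_split /=; apply/eq_bigr=> g _.
rewrite -big_split /=; apply/eq_bigr=> h _.
by rewrite mcoeffD mulrDl monalgUD.
Qed.

Lemma grpalg_mul0 : left_zero 0 grpalg_mul.
Proof. by move=> x; apply: (addIr (grpalg_mul 0 x)); rewrite -grpalg_mulDl !add0r. Qed.

Lemma grpalg_mulDr : right_distributive grpalg_mul +%R.
Proof. by move=> x y z; rewrite !(grpalg_mulC x) grpalg_mulDl. Qed.

Lemma grpalg_mulr0 : right_zero 0 grpalg_mul.
Proof. by move=> x; rewrite grpalg_mulC grpalg_mul0. Qed.

Lemma grpalg_mulUU a b g h :
  grpalg_mul << a *g g >> << b *g h >> = << a * b *g (g + h)%R >>.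
Proof. by rewrite (grpalg_mulw msuppU_le msuppU_le) !big_seq_fset1 !mcoeffUU. Qed.

Lemma grpalg_mulEl x y :
  grpalg_mul x y = \sum_(g <- msupp x) grpalg_mul << x@_g *g g >> y.
Proof.
rewrite {1}[x]monalgE.
by rewrite (big_morph (grpalg_mul^~ _) (fun _ _ => grpalg_mulDl _ _ _)
  (grpalg_mul0 _)).
Qed.

Lemma grpalg_mulEr x y :
  grpalg_mul x y = \sum_(h <- msupp y) grpalg_mul x << y@_h *g h >>.
Proof.
rewrite {1}[y]monalgE.
by rewrite (big_morph (grpalg_mul _) (fun _ _ => grpalg_mulDr _ _ _)
  (grpalg_mulr0 _)).
Qed.

Lemma grpalg_mulA : associative grpalg_mul.
Proof.
move=> x y z.
rewrite [RHS](big_morph (grpalg_mul^~ _) (fun _ _ => grpalg_mulDl _ _ _)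
  (grpalg_mul0 _)).
rewrite grpalg_mulEl; apply/eq_bigr=> g _.
rewrite [LHS](big_morph (grpalg_mul _) (fun _ _ => grpalg_mulDr _ _ _)
  (grpalg_mulr0 _)).
rewrite [RHS](big_morph (grpalg_mul^~ _) (fun _ _ => grpalg_mulDl _ _ _)
  (grpalg_mul0 _)).
apply/eq_bigr=> h _.
rewrite [LHS](big_morph (grpalg_mul _) (fun _ _ => grpalg_mulDr _ _ _)
  (grpalg_mulr0 _)).
rewrite grpalg_mulEr; apply/eq_bigr=> i _.
by rewrite !grpalg_mulUU mulrA addrA.
Qed.

Lemma grpalg_mul1 : left_id grpalg_one grpalg_mul.
Proof.
move=> x; rewrite grpalg_mulEr [RHS]monalgE; apply/eq_bigr => h _.
by rewrite grpalg_mulUU mul1r add0r.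
Qed.

Lemma grpalg_one_neq0 : grpalg_one != 0.
Proof. by rewrite monalgU_eq0 oner_eq0. Qed.

HB.instance Definition _ := GRing.Zmodule_isComNzRing.Build (grpalg R H)
  grpalg_mulA grpalg_mulC grpalg_mul1 grpalg_mulDl grpalg_one_neq0.

Lemma grpalg_uM g h : grpalg_u g * grpalg_u h = grpalg_u (g + h).
Proof. by rewrite [LHS]grpalg_mulUU mul1r. Qed.

End GroupAlgebra.

Section GroupCompletion.
Variables (k l : nat) (f : {additive 'rV[nat]_k -> 'rV[nat]_l}).

Definition zvec n (v : 'rV[nat]_n) : 'rV[int]_n := map_mx Posz v.

Definition pos_part n (h : 'rV[int]_n) : 'rV[nat]_n :=
  \row_i (if 0 <= h ord0 i then `|h ord0 i|%N else 0%N).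
Definition neg_part n (h : 'rV[int]_n) : 'rV[nat]_n := pos_part (- h).

(* By gcompletionD and gcompletion_sub, this is the unique additive map
   extending f from N^k to Z^k. *)
Definition gcompletion (h : 'rV[int]_k) : 'rV[int]_l :=
  zvec (f (pos_part h)) - zvec (f (neg_part h)).

Lemma zvecD n (a b : 'rV[nat]_n) : zvec (a + b) = zvec a + zvec b.
Proof. by apply/rowP => i; rewrite !mxE. Qed.

Lemma zvec_inj n : injective (@zvec n).
Proof. by move=> a b /rowP e; apply/rowP => i; move: (e i); rewrite !mxE => -[]. Qed.

Lemma pos_neg_partE n (h : 'rV[int]_n) :
  h = zvec (pos_part h) - zvec (neg_part h).
Proof.
apply/rowP => i; rewrite !mxE oppr_ge0.
by case: (h 0 i) => [[|m]|m]; rewrite /= ?subr0 ?sub0r.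
Qed.

Lemma gcompletion_sub a b : gcompletion (zvec a - zvec b) = zvec (f a) - zvec (f b).
Proof.
rewrite /gcompletion; set h := zvec a - zvec b.
have e : pos_part h + b = a + neg_part h.
  apply: zvec_inj; rewrite !zvecD; have := pos_neg_partE h.
  rewrite {1}/h => /(congr1 (fun x => x + zvec b + zvec (neg_part h))).
  by rewrite subrK => ->; rewrite addrAC subrK.
have := congr1 (fun x => zvec (f x)) e; rewrite !raddfD /= !zvecD => ef.
apply/eqP; rewrite subr_eq addrAC eq_sym subr_eq.
by rewrite -ef.
Qed.

Lemma gcompletionD : {morph gcompletion : g h / g + h}.
Proof.
move=> g h; rewrite {1}[g]pos_neg_partE {1}[h]pos_neg_partE addrACA -opprD.
by rewrite -!zvecD gcompletion_sub !raddfD /= !zvecD opprD addrACA.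
Qed.

Definition ker_gcompletion : {pred 'rV[int]_k} := [pred h | gcompletion h == 0].

Lemma ker_gcompletion_zmod_closed : zmod_closed ker_gcompletion.
Proof.
have z0 : gcompletion 0 = 0.
  by apply: (addIr (gcompletion 0)); rewrite -gcompletionD !add0r.
split; first by rewrite inE z0.
move=> g h; rewrite !inE => /eqP g0 /eqP h0; rewrite gcompletionD g0 add0r.
by apply/eqP/(addrI (gcompletion h)); rewrite -gcompletionD subrr z0 h0 addr0.
Qed.

HB.instance Definition _ := GRing.isZmodClosed.Build _ ker_gcompletion
  ker_gcompletion_zmod_closed.

Definition kerfbar : Type := {h : 'rV[int]_k | h \in ker_gcompletion}.
HB.instance Definition _ := Choice.on kerfbar.
HB.instance Definition _ := SubType.on kerfbar.
HB.instance Definition _ := [SubChoice_isSubZmodule of kerfbar by <:].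

End GroupCompletion.

Section PrimitiveIdeals.
Variables (K : fieldType) (k l : nat).
Variables (f : {additive 'rV[nat]_k -> 'rV[nat]_l}) (G : kgraph l).
Variable fG : finitely_many_vertices G.

Definition KPpb : Type := KPu K (finitely_many_vertices_pullback f fG).
HB.instance Definition _ := GRing.PzRing.on KPpb.
HB.instance Definition _ := GRing.Lmodule.on KPpb.

Definition Cker : Type := grpalg K (kerfbar f).
HB.instance Definition _ := GRing.ComNzRing.on Cker.
HB.instance Definition _ := GRing.Lmodule.on Cker.

Definition pb_p (v : gvert G) : KPpb := @kp_p K k (pullback f G) v.

(* Zero when (a, n) is not in the pullback, that is, when d(a) <> f(n). *)
Definition pb_s (a : gmor G) (n : 'rV[nat]_k) : KPpb :=
  if (insub (a, n) : option (pb_mor f G)) is Some x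
  then @kp_s K k (pullback f G) x else 0.
Definition pb_sstar (a : gmor G) (n : 'rV[nat]_k) : KPpb :=
  if (insub (a, n) : option (pb_mor f G)) is Some x
  then @kp_sstar K k (pullback f G) x else 0.

Definition Uh (h : 'rV[int]_k) : KPpb :=
  \sum_(v \in [set: gvert G]) \sum_(a \in paths_from v (f (pos_part h)))
    pb_s a (pos_part h) * pb_sstar a (neg_part h).

Definition iota_C (c : Cker) : KPpb :=
  \sum_(h <- msupp c) c@_h *: Uh (val h).

Definition ideal_H (T : set (gvert G)) : set KPpb :=
  ideal_gen [set pb_p v | v in ~` T].

Definition P_ideal (T : set (gvert G)) (m : set Cker) : set KPpb :=
  [set x + y | x in ideal_H T & y in left_span (iota_C @` m)].

Definition Phi (Tm : set (gvert G) * set Cker) : set KPpb :=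
  P_ideal Tm.1 Tm.2.

End PrimitiveIdeals.

Arguments Phi K {k l} f {G} fG Tm.
Arguments P_ideal K {k l} f {G} fG T m.
Arguments iota_C K {k l} f {G} fG c.

Definition strongly_aperiodic (l : nat) (G : kgraph l) : Prop :=
  forall (L : set (gvert G)) (hL : hereditary L),
    saturated L -> L <> setT -> aperiodic (subgraph hL).

(* Main.v *)
Require Import Defs.
From HB Require Import structures.
From mathcomp Require Import all_boot all_order all_algebra.
From mathcomp Require Import finmap monalg.
From mathcomp Require Import boolp classical_sets functions cardinality fsbigop.

Set Implicit Arguments.
Unset Strict Implicit.
Unset Printing Implicit Defensive.

Import GRing.Theory Num.Theory.
Local Open Scope ring_scope.
Local Open Scope classical_set_scope.

(** The idea is to stop seeing [A] as an algebra presented by the [k]-graph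
[f^*G] over [K] and to see it as an algebra presented by [G] over the larger
coefficient ring [C = K[H]].  A surjective monoid homomorphism [f] must hit each
basis vector of N^l by a basis vector of N^k, so it has an additive section
[sigma] ([monoid_section]).  Put [t_a = s_(a, sigma (d a))].  The elements [U_h]
are central and multiply like the group elements [u_h] ([iota_central]), because
[U_h] turns [s_(a, n)] into [s_(a, n + h)]; hence
[s_(a, n) = U_(n - sigma (f n)) t_a], and the [t_a] form a Kumjian-Pask family
of [G] which generates [A] together with the central image of [C]
([base_family], [base_generates]).  Moreover [A] is universal for such data
([base_universal]).

Everything then follows from one uniqueness theorem of Cuntz-Krieger type,
[ck_uniqueness], for a ring generated by a [G]-family and central coefficients.
Let [P] be an ideal that contains [p_v] for all [v] outside a set [T], such that
each coefficient is zero or invertible modulo [P], and suppose that each vertex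
of [T] carries an aperiodic infinite path inside [T].  If [b] is not in [P],
then a product [x b y] is congruent to some [p_v] with [v] in [T].  To prove
it, multiply [b] on the right by a path so long that [b t_a] is a combination
[sum_d c_d t_d] without ghost paths and is still not in [P].  All [d] end at
one vertex [w]; prolonging them along an aperiodic path at [w], the extended
paths differ already in an initial segment of some degree [N]
([infpath_separates]), so that one ghost path kills all of them but one.

For a maximal tail [T] and a maximal ideal [m], the ideal [P_(T,m)] satisfies
the hypotheses, strong aperiodicity providing the infinite paths.  Extending the
universal family of [G_T] by zero outside [T], the universal property gives a
surjection of [A] onto [KP_(C/m)(G_T)] that kills [P_(T,m)] but no [p_v] with
[v] in [T] (the vertex idempotents of a Kumjian-Pask algebra are nonzero,
[kp_p_neq0]); by the uniqueness theorem its kernel is exactly [P_(T,m)].  This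
is the isomorphism, and it shows that [T] and [m] can be read off from
[P_(T,m)].  Since [T] is finite and directed, a vertex [z] of [T] is reached
from all of [T], so every ideal strictly above [P_(T,m)] contains the idempotent
[p_z]; a maximal left ideal containing [P_(T,m)] and [1 - p_z] then gives a
simple module with annihilator [P_(T,m)] ([primitive_of_idempotent]).

Conversely let [M] be a simple module over an uncountable algebraically closed
field.  As [A] has countable dimension, Amitsur's trick shows that each central
element acts on [M] by a scalar ([central_scalar]).  So the elements of [C] that
kill [M] form a maximal ideal [m]; the vertices [v] with [p_v M] nonzero form a
maximal tail [T], the last axiom being primeness; and [P_(T,m)] is contained in
the annihilator of [M].  A further element of the annihilator would, by the
uniqueness theorem, put some [p_v] with [v] in [T] into it. *)


(** * Degrees *)

Section DegreeVectors.
Variable k : nat.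
Implicit Types p q r : 'rV[nat]_k.

Lemma natvE p q i : (p + q) ord0 i = (p ord0 i + q ord0 i)%N.
Proof. by rewrite mxE. Qed.

Lemma natv_addrI p : injective (+%R p).
Proof.
by move=> q r /rowP e; apply/rowP => i; move: (e i); rewrite !natvE => /addnI.
Qed.

Lemma lev_addr p r : lev p (p + r).
Proof. by apply/forallP => i; rewrite natvE leq_addr. Qed.

Lemma lev_ex p q : lev p q -> exists r, q = p + r.
Proof.
move=> /forallP h; exists (\row_i (q ord0 i - p ord0 i)%N).
by apply/rowP => i; rewrite natvE mxE subnKC.
Qed.

Lemma lev_addl p r : lev p (r + p).
Proof. by rewrite addrC lev_addr. Qed.

Lemma lev_refl p : lev p p.
Proof. by rewrite -{2}[p]addr0 lev_addr. Qed.

Lemma lev0 p : lev 0 p.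
Proof. by rewrite -[p]add0r lev_addr. Qed.

Lemma lev_trans q p r : lev p q -> lev q r -> lev p r.
Proof. by move=> /lev_ex[u ->] /lev_ex[v ->]; rewrite -addrA lev_addr. Qed.

End DegreeVectors.

(** * Paths and infinite paths in a higher-rank graph *)

Section Factorisation.
Variables (k : nat) (G : kgraph k).
Implicit Types a b c : gmor G.

Lemma factor_ex a m n : gdeg a = m + n ->
  exists b c, [/\ gsrc b = grng c, a = gcomp b c, gdeg b = m & gdeg c = n].
Proof. by move=> /gfactor[[b c] [/= ? _]]; exists b, c. Qed.

Lemma gcomp_inj a b a' b' : gsrc a = grng b -> gsrc a' = grng b' ->
  gcomp a b = gcomp a' b' -> gdeg a = gdeg a' -> a = a' /\ b = b'.
Proof.
move=> ab ab' e d.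
have d' : gdeg b = gdeg b'.
  by apply: (natv_addrI (p := gdeg a)); rewrite -gdeg_comp // e gdeg_comp // d.
have [[u v] [_ uniq_uv]] := gfactor (gdeg_comp ab).
have e1 : (u, v) = (a, b) by apply: uniq_uv.
have e2 : (u, v) = (a', b') by apply: uniq_uv.
by move: e2; rewrite e1 => -[-> ->].
Qed.

Lemma gdeg0_id a : gdeg a = 0 -> a = gid G (grng a).
Proof.
move=> d0.
have [] // := @gcomp_inj a (gid G (gsrc a)) (gid G (grng a)) a.
- by rewrite grng_id.
- by rewrite gsrc_id.
- by rewrite gcomp_idl gcomp_idr.
- by rewrite gdeg_id.
Qed.

Lemma infpath_ext (x y : infpath G) :
  (forall p q (h : lev p q), ip_mor x h = ip_mor y h) -> x = y.
Proof.
move=> e.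
have eo : ip_obj x = ip_obj y.
  by apply/funext => p; rewrite -(ip_rng x (lev_refl p)) e ip_rng.
case: x y e eo => ox mx rx sx ix cx dx [oy my ry sy iy cy dy] /= e eo.
subst oy.
have em : mx = my by do 3!apply: functional_extensionality_dep => ?; exact: e.
subst my.
by congr InfPath; exact: Prop_irrelevance.
Qed.

Definition aperiodic_path (x : infpath G) : Prop :=
  forall m n, m <> n -> shift m x <> shift n x.

Lemma ip_mor0_split (x : infpath G) p q N (h : lev p q) : lev q N ->
  exists u v, [/\ gsrc u = ip_obj x p, gsrc (ip_mor x h) = grng v,
    gdeg u = p, grng u = ip_obj x 0 &
    ip_mor x (lev0 N) = gcomp u (gcomp (ip_mor x h) v)].
Proof.
move=> qN; exists (ip_mor x (lev0 p)), (ip_mor x qN); split.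
- by rewrite ip_src.
- by rewrite ip_src ip_rng.
- by rewrite -[LHS]add0r (ip_deg x (lev0 p)).
- by rewrite ip_rng.
have pN := lev_trans h qN.
by rewrite -(ip_comp x h qN pN) -(ip_comp x _ pN (lev0 N)).
Qed.

(** If the prolongations of [a] and [b] along [x] had the same initial segments in
all degrees, the two infinite paths [a x] and [b x] would agree.  Removing from
both an initial segment of degree [gdeg a + gdeg b] would then identify two
shifts of [x], which are different unless [gdeg a = gdeg b]; and in that case
[a] and [b] are the initial segments of this common degree.  Agreement in a
degree passes to all smaller ones, so failure at [M] persists above [M]. *)
Lemma infpath_separates (x : infpath G) a b : aperiodic_path x ->
  gsrc a = ip_obj x 0 -> gsrc b = ip_obj x 0 -> a <> b ->
  exists M, forall N c u v, lev M N -> gdeg c = N ->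
    gsrc c = grng u -> gsrc c = grng v ->
    gcomp a (ip_mor x (lev0 N)) = gcomp c u ->
    gcomp b (ip_mor x (lev0 N)) = gcomp c v -> False.
Proof.
move=> ax sa sb ab.
have [dab|dab] := eqVneq (gdeg a) (gdeg b).
  exists (gdeg a) => N c u v /lev_ex[N' ->] dc cu cv ea eb.
  have [c1 [c2 [c12 ec d1 d2]]] := factor_ex dc.
  have c2u : gsrc c2 = grng u by rewrite -cu ec gsrc_comp.
  have c2v : gsrc c2 = grng v by rewrite -cv ec gsrc_comp.
  have key a' w : gsrc a' = ip_obj x 0 -> gsrc c2 = grng w -> gdeg a' = gdeg a ->
      gcomp a' (ip_mor x (lev0 (gdeg a + N'))) = gcomp c w -> a' = c1.
    move=> sa' cw da' e.
    have [] // := @gcomp_inj a' (ip_mor x (lev0 (gdeg a + N'))) c1 (gcomp c2 w).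
    - by rewrite sa' ip_rng.
    - by rewrite grng_comp.
    - by rewrite e ec -gcompA.
    - by rewrite d1.
  by apply: ab; rewrite (key a u) // (key b v).
have [p [q [h neq]]] : exists p q (h : lev p q),
    ip_mor x (lev_add2r (gdeg a) h) <> ip_mor x (lev_add2r (gdeg b) h).
  apply: contrapT => none.
  apply: (ax (gdeg a) (gdeg b)); first exact/eqP.
  apply: infpath_ext => p q h /=; apply: contrapT => ne.
  by apply: none; exists p, q, h.
(* the segment of [x] from [gdeg b + p] to [gdeg b + q] lies in [a x] between the
   degrees [gdeg a + gdeg b + p] and [gdeg a + gdeg b + q], and symmetrically *)
exists (gdeg a + gdeg b + q) => N c u v MN dc cu cv ea eb.
have [r er] := lev_ex h.
have [N' eN] := lev_ex MN.
have {}dc : gdeg c = (gdeg a + gdeg b + p) + (r + N').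
  by rewrite dc eN er !addrA.
have [c1 [c23 [c1_23 ec d1 d23]]] := factor_ex dc.
have [c2 [c3 [c2_3 ec23 d2 d3]]] := factor_ex d23.
have s3u : gsrc c3 = grng u by rewrite -cu ec gsrc_comp // ec23 gsrc_comp.
have s3v : gsrc c3 = grng v by rewrite -cv ec gsrc_comp // ec23 gsrc_comp.
have s1 : gsrc c1 = grng c2 by rewrite c1_23 ec23 grng_comp.
suff mid a' b' w : gsrc a' = ip_obj x 0 -> gsrc c3 = grng w ->
    gdeg a' + gdeg b' = gdeg a + gdeg b ->
    gcomp a' (ip_mor x (lev0 N)) = gcomp c w ->
    ip_mor x (lev_add2r (gdeg b') h) = c2.
  by apply: neq; rewrite (mid b a v) // 1?addrC // (mid a b u).
move=> sa' s3 dd e.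
have qN : lev (q + gdeg b') N.
  by rewrite eN -dd -addrA (addrC (gdeg a')) addrACA (addrC q) lev_addr.
have [y [z [sy sz dy ry ez]]] := ip_mor0_split x (lev_add2r (gdeg b') h) qN.
have syz : gsrc y = grng (gcomp (ip_mor x (lev_add2r (gdeg b') h)) z).
  by rewrite grng_comp // ip_rng.
have s2w : gsrc c2 = grng (gcomp c3 w) by rewrite grng_comp.
have e' : gcomp (gcomp a' y) (gcomp (ip_mor x (lev_add2r (gdeg b') h)) z)
        = gcomp c1 (gcomp c2 (gcomp c3 w)).
  rewrite -gcompA ?ry // -ez e ec ec23 gcompA // -gcompA //; last first.
    by rewrite gsrc_comp.
  by rewrite -!gcompA ?grng_comp // gsrc_comp.
have s12 : gsrc c1 = grng (gcomp c2 (gcomp c3 w)) by rewrite grng_comp.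
have s_y : gsrc (gcomp a' y) = grng (gcomp (ip_mor x (lev_add2r (gdeg b') h)) z).
  by rewrite gsrc_comp ?ry.
have [|_ {}e'] := gcomp_inj s_y s12 e'.
  by rewrite gdeg_comp ?ry // d1 dy -dd addrA addrAC.
have [] // := gcomp_inj sz s2w e'.
rewrite d2; apply: (natv_addrI (p := p + gdeg b')).
by rewrite (ip_deg x (lev_add2r (gdeg b') h)) er addrAC.
Qed.

End Factorisation.

(** * Maximal tails *)

Section MaximalTails.
Variables (k : nat) (G : kgraph k).
Variables (T : set (gvert G)) (hT : maximal_tail T).

Lemma mt_saturated : saturated (~` T).
Proof.
move=> v n _ h Tv; have [a va Ta] := mt2 hT n Tv.
by apply: (h (gsrc a)) => //; exists a.
Qed.

(** The directedness axiom is applied once for each of the finitely many vertices. *)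
Lemma mt_common_vertex : finitely_many_vertices G ->
  exists2 z, T z & forall v, T v -> paths_between v z !=set0.
Proof.
move=> /finite_seqP[s es].
suff [z Tz hz] : exists2 z, T z &
    forall v, v \in s -> T v -> paths_between v z !=set0.
  exists z => // v Tv; apply: hz => //.
  by have : [set: gvert G] v by []; rewrite es.
elim: s {es} => [|v s [z Tz hz]].
  by have [z Tz] := mt_nonempty hT; exists z.
have [Tv|nTv] := EM (T v); last first.
  by exists z => // u; rewrite inE => /orP[/eqP->|/hz].
have [w [Tw vw [b [rb sb]]]] := mt3 hT Tv Tz.
exists w => // u; rewrite inE => /orP[/eqP-> //|us Tu].
have [a [ra sa]] := hz u us Tu.
by exists (gcomp a b); split; rewrite ?grng_comp ?gsrc_comp // sa rb.
Qed.

Lemma mt_subP (v : gvert G) : (v \notin ~` T) <-> T v.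
Proof. by rewrite notin_setE /= not_notE. Qed.

Let sub := subgraph (hereditary_compl hT).

Definition lift_path (x : infpath sub) : infpath G.
refine (@InfPath k G (fun p => val (ip_obj x p))
  (fun p q h => val (ip_mor x h)) _ _ _ _ _).
- by move=> p q h; rewrite -(ip_rng x h).
- by move=> p q h; rewrite -(ip_src x h).
- by move=> p h; rewrite (ip_id x h).
- move=> p q r hpq hqr hpr; rewrite (ip_comp x hpq hqr hpr).
  exact: (val_sub_comp (etrans (ip_src x hpq) (esym (ip_rng x hqr)))).
- by move=> p q h; rewrite -[RHS](ip_deg x h).
Defined.

Lemma mt_aperiodic_paths : aperiodic sub -> forall w, T w ->
  exists x : infpath G, [/\ ip_obj x 0 = w, forall p, T (ip_obj x p) &
    aperiodic_path x].
Proof.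
move=> ap w /mt_subP Tw.
have [x x0 ax] := ap (Sub w Tw).
exists (lift_path x); split.
- by rewrite /= x0.
- by move=> p; apply/mt_subP; exact: (valP (ip_obj x p)).
move=> m n mn e; apply: (ax m n mn); apply: infpath_ext => p q h.
apply: val_inj; rewrite /=.
exact: (congr1 (fun y => ip_mor y h) e).
Qed.

End MaximalTails.


(** * Kumjian-Pask families and the uniqueness theorem *)

(** The rings considered here may be trivial and carry several algebra structures
at once; each of these is recorded by the central map from its coefficients. *)
Record central_hom (C : comPzRingType) (B : pzRingType) (j : C -> B) : Prop := {
  chD : {morph j : c d / c + d};
  chM : {morph j : c d / c * d};
  ch1 : j 1 = 1;
  chC : forall c b, j c * b = b * j c
}.

Section CentralHom.
Variables (C : comPzRingType) (B : pzRingType) (j : C -> B).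
Hypothesis hj : central_hom j.

Lemma ch0 : j 0 = 0.
Proof. by apply: (addIr (j 0)); rewrite -(chD hj) !add0r. Qed.

Lemma chN c : j (- c) = - j c.
Proof. by apply: (addIr (j c)); rewrite -(chD hj) !addNr ch0. Qed.

Lemma ch_sum (I : Type) (s : seq I) (P : pred I) (F : I -> C) :
  j (\sum_(i <- s | P i) F i) = \sum_(i <- s | P i) j (F i).
Proof. exact: (big_morph j (chD hj) ch0). Qed.

End CentralHom.

(** The Kumjian-Pask relations in a unital ring.  For a row-finite graph
with finitely many vertices, the last field is equivalent to (KP4) together with
the formula for the unit: multiplying it by [p v] selects the paths with range
[v], and degree 0 gives that the vertex idempotents sum to 1. *)
Record kp_family (B : pzRingType) (k : nat) (G : kgraph k)
    (p : gvert G -> B) (t t' : gmor G -> B) : Prop := {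
  fam_id : forall v, t (gid G v) = p v;
  fam_id' : forall v, t' (gid G v) = p v;
  fam_pp : forall v w, p v * p w = if v == w then p v else 0;
  fam_comp : forall a b, gsrc a = grng b -> t a * t b = t (gcomp a b);
  fam_comp' : forall a b, gsrc a = grng b -> t' b * t' a = t' (gcomp a b);
  fam_pt : forall a, p (grng a) * t a = t a;
  fam_tp : forall a, t a * p (gsrc a) = t a;
  fam_pt' : forall a, p (gsrc a) * t' a = t' a;
  fam_tp' : forall a, t' a * p (grng a) = t' a;
  fam_orth : forall a b, gdeg a = gdeg b ->
    t' a * t b = if a == b then p (gsrc a) else 0;
  fam_sum : forall n (e : seq (gmor G)), uniq e ->
    (forall a, a \in e <-> gdeg a = n) -> \sum_(a <- e) t a * t' a = 1
}.

(** Generation stated as an induction principle; closure under opposites follows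
from the coefficient [-1]. *)
Definition fam_generates (C : Type) (B : pzRingType) (k : nat) (G : kgraph k)
    (j : C -> B) (t t' : gmor G -> B) : Prop :=
  forall Q : B -> Prop, (forall c, Q (j c)) -> (forall a, Q (t a)) ->
    (forall a, Q (t' a)) -> (forall x y, Q x -> Q y -> Q (x + y)) ->
    (forall x y, Q x -> Q y -> Q (x * y)) -> forall b, Q b.

Section FiniteEnumerations.
Variables (k : nat) (G : kgraph k).
Hypotheses (G_rf : row_finite G) (G_fin : finitely_many_vertices G).

Lemma enum_paths_from (v : gvert G) n :
  exists e : seq (gmor G), uniq e /\ forall a, a \in e <-> paths_from v n a.
Proof.
have /finite_seqP[s es] := G_rf v n; exists (undup s); split.
  exact: undup_uniq.
by move=> a; rewrite mem_undup es.
Qed.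

Lemma finite_degree n : finite_set [set a : gmor G | gdeg a = n].
Proof.
have -> : [set a : gmor G | gdeg a = n] =
    \bigcup_(v in [set: gvert G]) paths_from v n.
  apply/seteqP; split=> a /=; last by case=> v _ [].
  by move=> da; exists (grng a).
by apply: bigcup_finite => // v _; exact: G_rf.
Qed.

Definition deg_paths n : seq (gmor G) := fset_set [set a : gmor G | gdeg a = n].

Lemma deg_paths_uniq n : uniq (deg_paths n).
Proof. exact: fset_uniq. Qed.

Lemma mem_deg_paths n a : a \in deg_paths n <-> gdeg a = n.
Proof.
rewrite /deg_paths in_fset_set; last exact: finite_degree.
by rewrite inE.
Qed.

End FiniteEnumerations.

Section FamilyTheory.
Variables (B : pzRingType) (k : nat) (G : kgraph k).
Variables (p : gvert G -> B) (t t' : gmor G -> B).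
Hypothesis fam : kp_family p t t'.

Lemma fam_comp0 a b : gsrc a <> grng b -> t a * t b = 0.
Proof.
move=> /eqP/negbTE ab.
by rewrite -(fam_tp fam) -(fam_pt fam b) mulrA -(mulrA (t a)) (fam_pp fam) ab
  mulr0 mul0r.
Qed.

Lemma fam_comp0' a b : gsrc a <> grng b -> t' b * t' a = 0.
Proof.
move=> /eqP/negbTE ab.
rewrite -(fam_tp' fam) -(fam_pt' fam a) mulrA -(mulrA (t' b)) (fam_pp fam).
by rewrite eq_sym ab mulr0 mul0r.
Qed.

Lemma fam_tp_eq a v : t a * p v = if gsrc a == v then t a else 0.
Proof.
rewrite -(fam_tp fam) -mulrA (fam_pp fam); case: eqP => // _.
by rewrite mulr0.
Qed.

Lemma fam_diag a : t' a * t a = p (gsrc a).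
Proof. by rewrite (fam_orth fam) // eqxx. Qed.

Lemma fam_pt_eq a v : p v * t a = if v == grng a then t a else 0.
Proof.
rewrite -(fam_pt fam) mulrA (fam_pp fam); case: eqP => [-> //|_].
by rewrite mul0r.
Qed.

Hypotheses (G_rf : row_finite G) (G_fin : finitely_many_vertices G).

Lemma fam_sum1 n : \sum_(a <- deg_paths G n) t a * t' a = 1.
Proof.
by apply: (fam_sum fam); [exact: deg_paths_uniq | exact: mem_deg_paths].
Qed.

Lemma fam_vertex v n (e : seq (gmor G)) : uniq e ->
  (forall a, a \in e <-> paths_from v n a) -> p v = \sum_(a <- e) t a * t' a.
Proof.
move=> ue me; rewrite -[LHS]mulr1 -(fam_sum1 n) mulr_sumr.
have -> : \sum_(a <- deg_paths G n) p v * (t a * t' a) =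
    \sum_(a <- deg_paths G n | grng a == v) t a * t' a.
  rewrite [RHS]big_mkcond; apply: eq_bigr => a _.
  by rewrite mulrA fam_pt_eq eq_sym; case: eqP => // _; rewrite mul0r.
rewrite -big_filter; apply: perm_big; apply: uniq_perm => //.
  exact/filter_uniq/deg_paths_uniq.
move=> a; rewrite mem_filter; apply/andP/idP.
  by move=> [/eqP ra /(mem_deg_paths G_rf G_fin) da]; apply/me.
by move=> /me[ra da]; split; [exact/eqP | exact/(mem_deg_paths G_rf G_fin)].
Qed.

Variables (C : comPzRingType) (j : C -> B).
Hypotheses (hj : central_hom j) (gen : fam_generates j t t').

Definition deep_span (N : 'rV[nat]_k) (b : B) : Prop :=
  exists s : seq (C * gmor G), (forall u, u \in s -> lev N (gdeg u.2)) /\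
    b = \sum_(u <- s) j u.1 * t u.2.

Lemma deep_span0 N : deep_span N 0.
Proof. by exists [::]; rewrite big_nil. Qed.

Lemma deep_spanD N x y : deep_span N x -> deep_span N y -> deep_span N (x + y).
Proof.
move=> [s [hs ->]] [r [hr ->]]; exists (s ++ r); rewrite big_cat.
by split=> // u; rewrite mem_cat => /orP[/hs|/hr].
Qed.

Lemma deep_spanZ N c x : deep_span N x -> deep_span N (j c * x).
Proof.
move=> [s [hs ->]]; exists [seq (c * u.1, u.2) | u <- s]; split.
  by move=> _ /mapP[u us ->]; exact: (hs u us).
by rewrite big_map mulr_sumr; apply: eq_bigr => u _; rewrite (chM hj) mulrA.
Qed.

Lemma deep_span_path N a : lev N (gdeg a) -> deep_span N (t a).
Proof.
move=> Na; exists [:: (1, a)]; split; last by rewrite big_seq1 (ch1 hj) mul1r.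
by move=> u; rewrite inE => /eqP->.
Qed.

(** A ghost path [t' a] is absorbed by a path of degree at least [gdeg a], at the
expense of shortening it.  Asking for a result of degree at least an arbitrary
[N] is what makes the statement stable under products. *)
Lemma deep_span_mul b N :
  exists n, forall a, lev n (gdeg a) -> deep_span N (b * t a).
Proof.
move: b N; apply: gen => [c N|a N|a N|x y IHx IHy N|x y IHx IHy N].
- by exists N => b Nb; apply: deep_spanZ; exact: deep_span_path.
- exists N => b Nb; have [ab|ab] := EM (gsrc a = grng b).
    rewrite (fam_comp fam) //; apply: deep_span_path; rewrite gdeg_comp //.
    exact: lev_trans Nb (lev_addl _ _).
  by rewrite fam_comp0 //; exact: deep_span0.
- exists (gdeg a + N) => b /lev_ex[r]; rewrite -addrA => /factor_ex.
  move=> [b1 [b2 [b12 -> d1 d2]]].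
  rewrite -(fam_comp fam) // mulrA (fam_orth fam) //.
  case: eqP => [->|_]; last by rewrite mul0r; exact: deep_span0.
  rewrite b12 (fam_pt fam); apply: deep_span_path; rewrite d2.
  exact: lev_addr.
- have [n hn] := IHx N; have [m hm] := IHy N; exists (n + m) => a nma.
  rewrite mulrDl; apply: deep_spanD; [apply: hn|apply: hm];
    apply: lev_trans nma; [exact: lev_addr|exact: lev_addl].
- have [n hn] := IHx N; have [m hm] := IHy n; exists m => a ma.
  rewrite -mulrA; have [s [hs ->]] := hm a ma; rewrite mulr_sumr.
  have : forall u, u \in s -> deep_span N (x * t u.2) by move=> u /hs/hn.
  elim: s {hs} => [|u s IHs] h; first by rewrite big_nil; exact: deep_span0.
  rewrite big_cons; apply: deep_spanD; last first.
    by apply: IHs => v vs; apply: h; rewrite inE vs orbT.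
  by rewrite mulrA -(chC hj) -mulrA; apply/deep_spanZ/h; rewrite mem_head.
Qed.

Lemma fam_spanning b : exists s : seq (C * (gmor G * gmor G)),
  b = \sum_(u <- s) j u.1 * (t u.2.1 * t' u.2.2).
Proof.
have [n hn] := deep_span_mul b 0.
rewrite -[b]mulr1 -(fam_sum1 n) mulr_sumr.
have: forall a, a \in deg_paths G n -> deep_span 0 (b * t a).
  by move=> a /(mem_deg_paths G_rf G_fin) da; apply: hn; rewrite da lev_refl.
elim: (deg_paths G n) => [|a e IHe] h; first by exists [::]; rewrite !big_nil.
rewrite big_cons.
have [|s ->] := IHe; first by move=> c ce; apply: h; rewrite inE ce orbT.
have [|r [_ er]] := h a; first by rewrite mem_head.
exists ([seq (u.1, (u.2, a)) | u <- r] ++ s); rewrite big_cat big_map /=.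
congr (_ + _); rewrite mulrA er mulr_suml; apply: eq_bigr => u _.
by rewrite mulrA.
Qed.

(** The coefficients of equal paths are added up, so that the paths can be
separated from each other afterwards. *)
Lemma deep_span_uniq N b : deep_span N b -> exists (s : seq (gmor G)) c,
  [/\ uniq s & b = \sum_(a <- s) j (c a) * t a].
Proof.
move=> [s [_ ->]].
exists (undup [seq u.2 | u <- s]), (fun a => \sum_(u <- s | u.2 == a) u.1).
split; first exact: undup_uniq.
under [RHS]eq_bigr do rewrite (ch_sum hj) mulr_suml.
rewrite (exchange_big_dep predT) //=.
rewrite big_seq [RHS]big_seq; apply: eq_bigr => u us.
under eq_bigl do rewrite eq_sym.
rewrite -big_filter filter_pred1_uniq ?big_seq1 ?undup_uniq //.
by rewrite mem_undup map_f.
Qed.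

(** The Cuntz-Krieger uniqueness theorem relative to an ideal [P] and to a set [T]
of vertices that contains those with a nonzero idempotent modulo [P]. *)
Theorem ck_uniqueness (P : set B) (T : set (gvert G)) :
  two_sided_ideal P -> (forall v, ~ T v -> P (p v)) ->
  (forall c, P (j c) \/ exists c', P (j (c' * c - 1))) ->
  (forall w, T w -> exists x : infpath G, [/\ ip_obj x 0 = w,
     forall n, T (ip_obj x n) & aperiodic_path x]) ->
  forall b, ~ P b -> exists x y v, T v /\ P (x * b * y - p v).
Proof.
move=> hP PnT hc hx b nPb.
have Psum (I : eqType) (s : seq I) (F : I -> B) :
    (forall i, i \in s -> P (F i)) -> P (\sum_(i <- s) F i).
  move=> h; rewrite big_seq.
  by apply: big_ind => //; [exact: tsi0 hP|exact: tsiD hP].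
have [n hn] := deep_span_mul b 0.
(* otherwise [b], the sum of the [b * t a * t' a], would be in [P] *)
have [a [da nPa]] : exists a, gdeg a = n /\ ~ P (b * t a).
  apply: contrapT => none; apply: nPb; rewrite -[b]mulr1 -(fam_sum1 n) mulr_sumr.
  apply: Psum => a /(mem_deg_paths G_rf G_fin) da.
  rewrite mulrA; apply: (tsiMr hP); apply: contrapT => nP.
  by apply: none; exists a.
have [|s [c [us ebs]]] := @deep_span_uniq 0 (b * t a).
  by apply: hn; rewrite da lev_refl.
set w := gsrc a.
have {ebs} eba : b * t a = \sum_(d <- s | gsrc d == w) j (c d) * t d.
  rewrite -(fam_tp fam) mulrA ebs mulr_suml [RHS]big_mkcond.
  apply: eq_bigr => d _; rewrite -mulrA fam_tp_eq; case: eqP => // _.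
  by rewrite mulr0.
have Tw : T w.
  apply: contrapT => nTw; apply: nPa; rewrite -(fam_tp fam) mulrA.
  by apply: (tsiMl hP); exact: PnT.
have [d0 [d0s sd0 nPd0]] : exists d0, [/\ d0 \in s, gsrc d0 = w & ~ P (j (c d0))].
  apply: contrapT => none; apply: nPa; rewrite eba -big_filter.
  apply: Psum => d; rewrite mem_filter => /andP[/eqP sd ds].
  by apply: (tsiMr hP); apply: contrapT => nP; apply: none; exists d.
have [x [x0 Tx ax]] := hx w Tw.
(* one degree that separates d0 from all the other paths of the list *)
have [N hN] : exists N, forall d, d \in s -> gsrc d = w -> d <> d0 ->
    forall c u v, gdeg c = N -> gsrc c = grng u -> gsrc c = grng v ->
    gcomp d0 (ip_mor x (lev0 N)) = gcomp c u ->
    gcomp d (ip_mor x (lev0 N)) = gcomp c v -> False.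
  suff [N hN] : exists N0, forall N, lev N0 N -> forall d, d \in s ->
      gsrc d = w -> d <> d0 ->
      forall c u v, gdeg c = N -> gsrc c = grng u -> gsrc c = grng v ->
      gcomp d0 (ip_mor x (lev0 N)) = gcomp c u ->
      gcomp d (ip_mor x (lev0 N)) = gcomp c v -> False.
    by exists N => d ds sd dd0; apply: hN => //; exact: lev_refl.
  elim: s {us eba d0s} => [|d s [N IHs]]; first by exists 0.
  have [M hM] : exists M, gsrc d = w -> d <> d0 -> forall N c u v, lev M N ->
      gdeg c = N -> gsrc c = grng u -> gsrc c = grng v ->
      gcomp d0 (ip_mor x (lev0 N)) = gcomp c u ->
      gcomp d (ip_mor x (lev0 N)) = gcomp c v -> False.
    have [[sd dd0]|nd] := EM (gsrc d = w /\ d <> d0); last first.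
      by exists 0 => sd dd0; case: nd.
    have [|||M hM] := @infpath_separates _ _ x d0 d ax; rewrite ?x0 //.
      by move/esym.
    by exists M.
  exists (M + N) => L ML e; rewrite inE => /orP[/eqP->|es] se ee0 c' u v dc'.
    by apply: (hM se ee0 L) => //; exact: lev_trans (lev_addr _ _) ML.
  by apply: (IHs L) => //; exact: lev_trans (lev_addl _ _) ML.
set nu := ip_mor x (lev0 N).
have rnu : grng nu = w by rewrite ip_rng.
have dnu : gdeg nu = N by rewrite -[LHS]add0r (ip_deg x (lev0 N)).
have split_nu d : gsrc d = w -> exists e f, [/\ gsrc e = grng f,
    gcomp d nu = gcomp e f & gdeg e = N].
  move=> sd; have : gdeg (gcomp d nu) = N + gdeg d.
    by rewrite gdeg_comp ?rnu // dnu addrC.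
  by move=> /factor_ex[e [f [ef -> de _]]]; exists e, f.
have [e0 [f0 [ef0 d0nu de0]]] := split_nu d0 sd0.
have [/nPd0 //|[c' Pc']] := hc (c d0).
(* [t' e0] kills the prolongations of all paths but [d0], which becomes [f0]; then
   [t' f0] and the inverse [c'] of the coefficient leave the vertex idempotent *)
exists (j c' * t' f0 * t' e0), (t a * t nu), (gsrc nu).
split; first by rewrite ip_src; exact: Tx.
suff -> : j c' * t' f0 * t' e0 * b * (t a * t nu) = j (c' * c d0) * p (gsrc nu).
  rewrite -[X in _ - X]mul1r -mulrBl -(ch1 hj) -(chN hj) -(chD hj).
  exact: (tsiMr hP).
rewrite -!mulrA [b * _]mulrA eba -big_filter mulr_suml mulr_sumr.
rewrite (bigD1_seq d0) /=; first last.
- exact: filter_uniq.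
- by rewrite mem_filter d0s sd0 eqxx.
rewrite [X in _ * (_ * (_ + X))]big1_seq ?addr0; last first.
  move=> d /andP[dd0]; rewrite mem_filter => /andP[/eqP sd ds].
  rewrite -mulrA (fam_comp fam) ?rnu //.
  have [e [f [ef dnu' de]]] := split_nu d sd.
  rewrite dnu' -(fam_comp fam) // mulrA -(chC hj) -mulrA.
  rewrite [t' e0 * (_ * _)]mulrA (fam_orth fam) ?de0 ?de //.
  case: eqP => [ee|_]; last by rewrite mul0r mulr0.
  exfalso; apply: (hN d ds sd _ e0 f0 f) => //; first exact/eqP.
  - by rewrite ee.
  - by rewrite -/nu dnu' ee.
rewrite -[j (c d0) * _ * _]mulrA (fam_comp fam) ?rnu // d0nu -(fam_comp fam) //.
rewrite [t' e0 * _]mulrA -(chC hj) -mulrA [t' e0 * (_ * _)]mulrA fam_diag ef0.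
rewrite (fam_pt fam) [t' f0 * _]mulrA -(chC hj) -mulrA fam_diag mulrA -(chM hj).
congr (_ * p _).
by rewrite -(gsrc_comp ef0) -d0nu gsrc_comp ?rnu.
Qed.

End FamilyTheory.


(** * The Kumjian-Pask algebra as a universal family *)

Section UniversalFamily.
Variables (R : comPzRingType) (k : nat) (G : kgraph k).
Hypotheses (G_rf : row_finite G) (fG : finitely_many_vertices G).

Local Notation A := (KPu R fG).

Definition kpu_p (v : gvert G) : A := kp_p R v.
Definition kpu_s (a : gmor G) : A := kp_s R a.
Definition kpu_s' (a : gmor G) : A := kp_sstar R a.
Definition kpu_scal (r : R) : A := r *: (1 : A).

Lemma kpu_scalE r (x : A) : r *: x = kpu_scal r * x.
Proof. by rewrite [RHS](pmulZl (E := @kprel R k G)) [pmul _ _](mul1r x). Qed.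

Lemma kpu_scal_central : central_hom kpu_scal.
Proof.
split=> [c d|c d||c b].
- exact: scalerDl.
- by rewrite -kpu_scalE /kpu_scal scalerA.
- exact: scale1r.
- rewrite -kpu_scalE [RHS](pmulZr (E := @kprel R k G)).
  by rewrite [pmul _ _](mulr1 b).
Qed.

Lemma kpu_sum_class (e : seq (gmor G)) :
  \sum_(a <- e) kpu_s a * kpu_s' a =
  pclass (@kprel R k G) (foldr (fun a t =>
    tadd (tmul (tgen (gen_s a)) (tgen (gen_sstar a))) t) tzero e).
Proof.
elim: e => [|a e IHe]; first by rewrite big_nil.
by rewrite big_cons IHe [kpu_s a * _]pmulE [LHS]paddE.
Qed.

Lemma kpu_s_id v : kpu_s (gid G v) = kpu_p v.
Proof. by apply/pclassP/nueq_rel; exact: kp_s_id. Qed.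

Lemma kpu_s'_id v : kpu_s' (gid G v) = kpu_p v.
Proof. by apply/pclassP/nueq_rel; exact: kp_sstar_id. Qed.

Lemma kpu_pp v w : kpu_p v * kpu_p w = if v == w then kpu_p v else 0.
Proof. exact: kp_pp. Qed.

(** In degree 0, which (KP4) does not cover, the only path with range [v] is the
identity. *)
Lemma kpu_vertex v n (e : seq (gmor G)) : uniq e ->
  (forall a, a \in e <-> gdeg a = n) ->
  kpu_p v = \sum_(a <- e | grng a == v) kpu_s a * kpu_s' a.
Proof.
move=> ue me; rewrite -big_filter.
have [n0|n0] := eqVneq n 0; last first.
  rewrite kpu_sum_class; apply/pclassP/nueq_rel/(kp4 _ n0).
    exact: filter_uniq.
  move=> a; rewrite mem_filter; split=> [/andP[/eqP ra /me da] //|[ra da]].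
  by apply/andP; split; [exact/eqP | exact/me].
rewrite (perm_big [:: gid G v]) ?big_seq1 /= ?kpu_s_id ?kpu_s'_id.
  by rewrite kpu_pp eqxx.
apply: uniq_perm => //; first exact: filter_uniq.
move=> a; rewrite mem_filter inE; apply/andP/eqP => [[/eqP <- /me]|->].
  by rewrite n0 => /gdeg0_id.
by split; [rewrite grng_id | apply/me; rewrite gdeg_id].
Qed.

Lemma kpu_family : kp_family kpu_p kpu_s kpu_s'.
Proof.
split.
- exact: kpu_s_id.
- exact: kpu_s'_id.
- exact: kpu_pp.
- by move=> a b ab; rewrite [LHS]pmulE; apply/pclassP/nueq_rel; exact: kp2_s.
- by move=> a b ab; rewrite [LHS]pmulE; apply/pclassP/nueq_rel; exact: kp2_sstar.
- by move=> a; rewrite [LHS]pmulE; apply/pclassP/nueq_rel; exact: kp2_ps.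
- by move=> a; rewrite [LHS]pmulE; apply/pclassP/nueq_rel; exact: kp2_sp.
- by move=> a; rewrite [LHS]pmulE; apply/pclassP/nueq_rel; exact: kp2_psstar.
- by move=> a; rewrite [LHS]pmulE; apply/pclassP/nueq_rel; exact: kp2_sstarp.
- move=> a b ab; rewrite [LHS]pmulE [0]/(pclass (@kprel R k G) tzero).
  by rewrite /kpu_p -fun_if; apply/pclassP/nueq_rel; exact: kp3.
- move=> n e ue me; rewrite [RHS]kp_oneE.
  under [RHS]eq_bigr => v _ do rewrite [kp_p R v](kpu_vertex v ue me).
  rewrite (exchange_big_dep predT) //=; apply: eq_bigr => a _.
  under eq_bigl do rewrite eq_sym.
  rewrite -big_filter filter_pred1_uniq ?big_seq1 ?fset_uniq //.
  by rewrite in_fset_set // inE.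
Qed.

Lemma kpu_generates : fam_generates kpu_scal kpu_s kpu_s'.
Proof.
move=> Q Qc Qt Qt' QD QM; elim/presalg_ind.
elim=> [[v|a|a]||t IHt u IHu|t IHt|r t IHt|t IHt u IHu].
- by rewrite -[pclass _ _]kpu_s_id.
- exact: Qt.
- exact: Qt'.
- by have := Qc 0; rewrite /kpu_scal scale0r.
- by rewrite -[pclass _ _]paddE; exact: QD.
- rewrite -[pclass _ _]poppE -[popp _](mulN1r (pclass _ t : A)).
  by apply: QM IHt; have := Qc (- 1); rewrite /kpu_scal scaleN1r.
- by rewrite -[pclass _ _]pscaleE [pscale _ _](kpu_scalE r); exact: QM.
- by rewrite -[pclass _ _]pmulE; exact: QM.
Qed.

Section UniversalMap.
Variables (B : pzRingType) (j : R -> B) (p : gvert G -> B) (t t' : gmor G -> B).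
Hypotheses (hj : central_hom j) (fam : kp_family p t t').

Fixpoint term_eval (x : nuterm R (kpgen G)) : B :=
  match x with
  | tgen (gen_p v) => p v
  | tgen (gen_s a) => t a
  | tgen (gen_sstar a) => t' a
  | tzero => 0
  | tadd x y => term_eval x + term_eval y
  | topp x => - term_eval x
  | tscale r x => j r * term_eval x
  | tmul x y => term_eval x * term_eval y
  end.

Lemma term_eval_nueq x y : nueq (@kprel R k G) x y -> term_eval x = term_eval y.
Proof.
elim=> {x y} /=.
- move=> x y; case=> {x y} /=.
  + exact: fam_id fam.
  + exact: fam_id' fam.
  + by move=> v w; rewrite (fam_pp fam); case: eqP.
  + exact: fam_comp fam.
  + exact: fam_comp' fam.
  + exact: fam_pt fam.
  + exact: fam_tp fam.
  + exact: fam_pt' fam.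
  + exact: fam_tp' fam.
  + by move=> a b /(fam_orth fam) ->; case: eqP.
  + move=> v n e _ ue me; rewrite (fam_vertex fam G_rf fG ue me).
    elim: e {ue me} => [|a e IHe] /=; first by rewrite big_nil.
    by rewrite big_cons IHe.
- by [].
- by [].
- by move=> x y z _ -> _ ->.
- by move=> x y z w _ -> _ ->.
- by move=> x y _ ->.
- by move=> r x y _ ->.
- by move=> x y z w _ -> _ ->.
- by move=> *; rewrite addrA.
- by move=> *; rewrite addrC.
- by move=> *; rewrite add0r.
- by move=> *; rewrite addNr.
- by move=> *; rewrite mulrA (chM hj).
- by move=> *; rewrite (ch1 hj) mul1r.
- by move=> *; rewrite mulrDr.
- by move=> *; rewrite (chD hj) mulrDl.
- by move=> *; rewrite mulrA.
- by move=> *; rewrite mulrDl.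
- by move=> *; rewrite mulrDr.
- by move=> *; rewrite mulrA.
- by move=> *; rewrite mulrA -(chC hj) mulrA.
Qed.

(** The family may live over other coefficients, so what is obtained is a ring
homomorphism that transports the scalars along [j]. *)
Lemma kpu_universal : exists q : {rmorphism A -> B},
  [/\ forall v, q (kpu_p v) = p v, forall a, q (kpu_s a) = t a,
      forall a, q (kpu_s' a) = t' a & forall r, q (kpu_scal r) = j r].
Proof.
pose q (x : A) : B := term_eval (prepr x).
have qE x : q (pclass (@kprel R k G) x) = term_eval x.
  by apply: term_eval_nueq; exact: prepr_class.
have qD x y : q (x + y) = q x + q y.
  by elim/presalg_ind: x => x; elim/presalg_ind: y => y; rewrite [x in q x]paddE !qE.
have qM x y : q (x * y) = q x * q y.
  by elim/presalg_ind: x => x; elim/presalg_ind: y => y; rewrite [x in q x]pmulE !qE.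
have q1 : q 1 = 1.
  rewrite -(fam_sum1 kpu_family G_rf fG 0) (big_morph q qD (qE tzero)).
  rewrite -[RHS](fam_sum1 fam G_rf fG 0); apply: eq_bigr => a _.
  by rewrite qM [q (kpu_s a)]qE [q (kpu_s' a)]qE.
have q0 : q 0 = 0 := qE tzero.
have qN : {morph q : x y / x - y}.
  move=> x y; rewrite qD; congr (_ + _); apply: (addIr (q y)).
  by rewrite -qD !addNr.
pose qm : {rmorphism A -> B} := HB.pack q
  (GRing.isZmodMorphism.Build A B q qN) (GRing.isMonoidMorphism.Build A B q (q1, qM)).
exists qm; split=> [v|a|a|r]; try exact: qE.
rewrite /= /kpu_scal -[1 : A]preprK [X in q X]pscaleE qE /= -/(q 1).
by rewrite q1 mulr1.
Qed.

End UniversalMap.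
End UniversalFamily.


(** * The vertex idempotents are nonzero *)

Section Germs.
Variables (R : comPzRingType) (k : nat) (G : kgraph k).
Implicit Types (a b c x : gmor G) (g : gmor G -> R).

Definition left_div a x : option (gmor G) :=
  if pselect (exists c, gsrc a = grng c /\ x = gcomp a c) is left h
  then Some (projT1 (cid h)) else None.

Lemma left_divP a x c :
  left_div a x = Some c <-> gsrc a = grng c /\ x = gcomp a c.
Proof.
rewrite /left_div; case: pselect => [h|nh]; last first.
  by split=> // ?; case: nh; exists c.
case: cid => /= d [ad xd]; split=> [[<-] //|[ac xc]].
by have [//|_ ->] := gcomp_inj ad ac (etrans (esym xd) xc).
Qed.

Lemma left_divE a c : gsrc a = grng c -> left_div a (gcomp a c) = Some c.
Proof. by move=> ac; apply/left_divP. Qed.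

(** The path-space representation with finite paths in place of infinite ones.  The
generators act on functions on paths by removing or adding an initial segment.
All relations but (KP4) hold exactly, and (KP4) at degree [n] holds on paths of
degree at least [n]; so the relations hold for germs at infinity. *)
Fixpoint germ_op (t : nuterm R (kpgen G)) g x : R :=
  match t with
  | tgen (gen_p v) => if grng x == v then g x else 0
  | tgen (gen_s a) => if left_div a x is Some c then g c else 0
  | tgen (gen_sstar a) => if gsrc a == grng x then g (gcomp a x) else 0
  | tzero => 0
  | tadd t u => germ_op t g x + germ_op u g x
  | topp t => - germ_op t g x
  | tscale r t => r * germ_op t g x
  | tmul t u => germ_op t (germ_op u g) x
  end.

Lemma germ_opD t g h x :
  germ_op t (fun y => g y + h y) x = germ_op t g x + germ_op t h x.
Proof.
elim: t g h x => [[v|a|a]||t IHt u IHu|t IHt|r t IHt|t IHt u IHu] g h x /=.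
- by case: eqP => //; rewrite addr0.
- by case: left_div => //; rewrite addr0.
- by case: eqP => //; rewrite addr0.
- by rewrite addr0.
- by rewrite IHt IHu addrACA.
- by rewrite IHt opprD.
- by rewrite IHt mulrDr.
- by rewrite -IHt; congr germ_op; apply/funext => y; rewrite IHu.
Qed.

Lemma germ_opZ t r g x : germ_op t (fun y => r * g y) x = r * germ_op t g x.
Proof.
elim: t g x => [[v|a|a]||t IHt u IHu|t IHt|s t IHt|t IHt u IHu] g x /=.
- by case: eqP => //; rewrite mulr0.
- by case: left_div => //; rewrite mulr0.
- by case: eqP => //; rewrite mulr0.
- by rewrite mulr0.
- by rewrite IHt IHu mulrDr.
- by rewrite IHt mulrN.
- by rewrite IHt mulrCA.
- by rewrite -IHt; congr germ_op; apply/funext => y; rewrite IHu.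
Qed.

(** The operators lower degrees by a bounded amount only, so they act on germs. *)
Lemma germ_op_local t : exists D, forall N g h,
  (forall x, lev N (gdeg x) -> g x = h x) ->
  forall x, lev (N + D) (gdeg x) -> germ_op t g x = germ_op t h x.
Proof.
elim: t => [[v|a|a]||t [D hD] u [E hE]|t [D hD]|r t [D hD]|t [D hD] u [E hE]].
- by exists 0 => N g h e x Nx /=; rewrite e // -[N]addr0.
- exists (gdeg a) => N g h e x Nx /=; case ax: left_div => [c|//].
  have [ac xc] := (left_divP _ _ _).1 ax; apply: e.
  move: Nx; rewrite xc gdeg_comp // addrC => /lev_ex[r]; rewrite -addrA.
  by move/natv_addrI ->; exact: lev_addr.
- exists 0 => N g h e x Nx /=; case: eqP => // ax; rewrite e // gdeg_comp //.
  by apply: lev_trans (lev_addl _ _); rewrite -[N]addr0.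
- by exists 0.
- exists (D + E) => N g h e x Nx /=.
  rewrite (hD N g h e) ?(hE N g h e) //; apply: lev_trans Nx.
    by rewrite [D + E]addrC addrA lev_addr.
  by rewrite addrA lev_addr.
- by exists D => N g h e x Nx /=; rewrite (hD N g h e).
- by exists D => N g h e x Nx /=; rewrite (hD N g h e).
- exists (E + D) => N g h e x Nx /=; apply: (hD (N + E)); last by rewrite -addrA.
  exact: hE.
Qed.

Definition germ_eq t u : Prop :=
  exists N, forall g x, lev N (gdeg x) -> germ_op t g x = germ_op u g x.

Lemma germ_eq_exact t u :
  (forall g x, germ_op t g x = germ_op u g x) -> germ_eq t u.
Proof. by move=> e; exists 0 => g x _. Qed.

Lemma germ_kp4 v n (e : seq (gmor G)) : uniq e ->
  (forall a, a \in e <-> paths_from v n a) ->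
  germ_eq (tgen (gen_p v)) (foldr (fun a t =>
    tadd (tmul (tgen (gen_s a)) (tgen (gen_sstar a))) t) tzero e).
Proof.
move=> ue me; exists n => g x nx.
have -> : germ_op (foldr (fun a t =>
    tadd (tmul (tgen (gen_s a)) (tgen (gen_sstar a))) t) tzero e) g x =
    \sum_(a <- e) if left_div a x is Some _ then g x else 0.
  elim: e {ue me} => [|a e IHe]; first by rewrite big_nil.
  rewrite big_cons /= IHe; congr (_ + _).
  case ax: left_div => [c|//]; have [ac ->] := (left_divP _ _ _).1 ax.
  by rewrite ac eqxx.
have [r dx] := lev_ex nx.
have [a [c [ac xac da _]]] := factor_ex dx.
have uniq_a b d : gdeg b = n -> left_div b x = Some d -> b = a.
  move=> db /left_divP[bd xbd].
  by have [] := gcomp_inj bd ac (etrans (esym xbd) xac) (etrans db (esym da)).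
rewrite /=; case: eqP => [xv|nxv]; last first.
  rewrite big1_seq // => b /andP[_ /me[rb db]].
  by case bx: left_div => [d|//]; case: nxv; rewrite xac grng_comp // -(uniq_a b d).
have ae : a \in e by apply/me; split=> //; rewrite -xv xac grng_comp.
have ax : left_div a x = Some c by apply/left_divP.
rewrite (bigD1_seq a) //= ax big1_seq ?addr0 // => b.
move=> /andP[/eqP ba /me[_ db]].
by case bx: left_div => [d|//]; case: ba; exact: uniq_a bx.
Qed.

(** Only (KP4) forces the passage to germs; congruence under products is where the
locality of the left factor is used. *)
Lemma germ_sound t u : nueq (@kprel R k G) t u -> germ_eq t u.
Proof.
elim=> {t u}.
- move=> t u; case=> {t u}.
  + move=> v; apply: germ_eq_exact => g x /=; case ax: left_div => [c|].
      have [] := (left_divP _ _ _).1 ax; rewrite gsrc_id => vc ->.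
      by rewrite vc gcomp_idl eqxx.
    case: eqP => // xv; move: ax; rewrite -{1}[x]gcomp_idl xv left_divE //.
    by rewrite gsrc_id.
  + move=> v; apply: germ_eq_exact => g x /=; rewrite gsrc_id eq_sym.
    by case: eqP => // <-; rewrite gcomp_idl.
  + move=> v w; apply: germ_eq_exact => g x /=; have [->|vw] := eqVneq v w.
      by rewrite /=; case: eqP.
    by rewrite /=; case: eqP => // ->; rewrite (negbTE vw).
  + move=> a b ab; apply: germ_eq_exact => g x /=.
    case abx: (left_div (gcomp a b) x) => [d|].
      have [] := (left_divP _ _ _).1 abx; rewrite gsrc_comp // => bd ->.
      by rewrite -gcompA // left_divE ?grng_comp // left_divE.
    case ax: left_div => [c|//]; case bc: left_div => [d|//].
    have [ac xc] := (left_divP _ _ _).1 ax.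
    have [bd cd] := (left_divP _ _ _).1 bc.
    by move: abx; rewrite xc cd gcompA // left_divE // gsrc_comp.
  + move=> a b ab; apply: germ_eq_exact => g x /=; rewrite gsrc_comp //.
    by case: eqP => // bx; rewrite grng_comp // -ab eqxx gcompA.
  + move=> a; apply: germ_eq_exact => g x /=; case ax: left_div => [c|]; last first.
      by case: ifP.
    by have [ac ->] := (left_divP _ _ _).1 ax; rewrite grng_comp // eqxx.
  + move=> a; apply: germ_eq_exact => g x /=; case ax: left_div => [c|//].
    by have [ac _] := (left_divP _ _ _).1 ax; rewrite ac eqxx.
  + by move=> a; apply: germ_eq_exact => g x /=; rewrite eq_sym; case: eqP.
  + move=> a; apply: germ_eq_exact => g x /=; case: eqP => // ax.
    by rewrite grng_comp // eqxx.
  + move=> a b dab; apply: germ_eq_exact => g x /=; have [<-|ab] := eqVneq a b.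
      by rewrite /= eq_sym; case: eqP => // ax; rewrite left_divE.
    case: eqP => //= ax; case bx: left_div => [c|//].
    have [bc e] := (left_divP _ _ _).1 bx.
    by have [ab' _] := gcomp_inj ax bc e dab; rewrite ab' eqxx in ab.
  + by move=> v n e _; exact: germ_kp4.
- by move=> t; apply: germ_eq_exact.
- by move=> t u _ [N h]; exists N => g x Nx; rewrite h.
- move=> t u w _ [N h] _ [M h']; exists (N + M) => g x NM.
  rewrite h ?h' //; apply: lev_trans NM; [exact: lev_addl|exact: lev_addr].
- move=> t t' u u' _ [N h] _ [M h']; exists (N + M) => g x NM /=.
  rewrite h ?h' //; apply: lev_trans NM; [exact: lev_addl|exact: lev_addr].
- by move=> t t' _ [N h]; exists N => g x Nx /=; rewrite h.
- by move=> r t t' _ [N h]; exists N => g x Nx /=; rewrite h.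
- move=> t t' u u' _ [N h] _ [M h']; have [D hD] := germ_op_local t.
  exists (N + (M + D)) => g x NMx /=.
  rewrite (hD M _ (germ_op u' g)).
  + by apply: h; apply: lev_trans NMx; exact: lev_addr.
  + by move=> y; exact: h'.
  + by apply: lev_trans NMx; exact: lev_addl.
- by move=> *; apply: germ_eq_exact => g x /=; rewrite addrA.
- by move=> *; apply: germ_eq_exact => g x /=; rewrite addrC.
- by move=> *; apply: germ_eq_exact => g x /=; rewrite add0r.
- by move=> *; apply: germ_eq_exact => g x /=; rewrite addNr.
- by move=> *; apply: germ_eq_exact => g x /=; rewrite mulrA.
- by move=> *; apply: germ_eq_exact => g x /=; rewrite mul1r.
- by move=> *; apply: germ_eq_exact => g x /=; rewrite mulrDr.
- by move=> *; apply: germ_eq_exact => g x /=; rewrite mulrDl.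
- by move=> *; apply: germ_eq_exact => g x /=.
- by move=> *; apply: germ_eq_exact => g x /=.
- by move=> *; apply: germ_eq_exact => g x /=; rewrite germ_opD.
- by move=> *; apply: germ_eq_exact => g x /=.
- by move=> *; apply: germ_eq_exact => g x /=; rewrite germ_opZ.
Qed.

(** Without sources there are paths of arbitrarily large degree with range [v], where
[p v] fixes the constant function 1. *)
Theorem kp_p_neq0 (v : gvert G) :
  (1 : R) <> 0 -> no_sources G -> kp_p R v <> 0.
Proof.
move=> R1 ns /pclassP/germ_sound[N h]; apply: R1.
have [x [rx dx]] := ns v N.
by have := h (fun=> 1) x; rewrite dx /= rx eqxx; apply; exact: lev_refl.
Qed.

End Germs.


(** * Extension of a family by zero from a subgraph *)

Section ExtensionByZero.
Variables (B : pzRingType) (k : nat) (G : kgraph k).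
Variables (L : set (gvert G)) (hL : hereditary L).
Let S := subgraph hL.
Variables (p : gvert S -> B) (t t' : gmor S -> B).
Hypothesis fam : kp_family p t t'.

Definition ext_p (v : gvert G) : B :=
  if (insub v : option (sub_vert L)) is Some w then p w else 0.
Definition ext_mor (u : gmor S -> B) (a : gmor G) : B :=
  if (insub a : option (sub_mor L)) is Some b then u b else 0.

Lemma ext_pE (w : sub_vert L) : ext_p (val w) = p w.
Proof. by rewrite /ext_p valK. Qed.

Lemma ext_p0 v : L v -> ext_p v = 0.
Proof.
by move=> Lv; rewrite /ext_p insubN // negbK inE.
Qed.

Lemma ext_morE u (b : sub_mor L) : ext_mor u (val b) = u b.
Proof. by rewrite /ext_mor valK. Qed.

Lemma ext_mor0 u a : L (gsrc a) -> ext_mor u a = 0.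
Proof. by move=> La; rewrite /ext_mor insubN // negbK inE. Qed.

Variant sub_vert_spec : gvert G -> Type :=
| InSubVert (w : sub_vert L) : sub_vert_spec (val w)
| OutSubVert v of L v : sub_vert_spec v.

Lemma sub_vertP v : sub_vert_spec v.
Proof.
case: (@insubP _ _ (sub_vert L) v) => [w _ <-|]; first exact: InSubVert.
by rewrite negbK inE => /OutSubVert.
Qed.

Variant sub_mor_spec : gmor G -> Type :=
| InSubMor (b : sub_mor L) : sub_mor_spec (val b)
| OutSubMor a of L (gsrc a) : sub_mor_spec a.

Lemma sub_morP a : sub_mor_spec a.
Proof.
case: (@insubP _ _ (sub_mor L) a) => [b _ <-|]; first exact: InSubMor.
by rewrite negbK inE => /OutSubMor.
Qed.

Lemma sub_mor_nL (b : sub_mor L) : ~ L (gsrc (val b)).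
Proof. by have := valP b; rewrite notin_setE. Qed.

Lemma ext_id (u : gmor S -> B) : (forall v, u (gid S v) = p v) ->
  forall v, ext_mor u (gid G v) = ext_p v.
Proof.
move=> hu v; case: (sub_vertP v) => [w|{}v Lv].
  by rewrite -[gid G _]/(val (gid S w)) ext_morE ext_pE.
by rewrite ext_mor0 ?ext_p0 // gsrc_id.
Qed.

(** Heredity of [L] makes the complement closed under ranges, so a product of two
paths survives exactly when its second factor does. *)
Lemma ext_family : kp_family ext_p (ext_mor t) (ext_mor t').
Proof.
split.
- exact: ext_id (fam_id fam).
- exact: ext_id (fam_id' fam).
- move=> v w; case: (sub_vertP v) => [x|{}v Lv]; last first.
    by rewrite (ext_p0 Lv) mul0r; case: eqP.
  case: (sub_vertP w) => [y|{}w Lw].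
    by rewrite !ext_pE (fam_pp fam) (inj_eq val_inj).
  rewrite (ext_p0 Lw) mulr0; case: eqP => // e.
  by move: (valP x); rewrite e notin_setE.
- move=> a b; case: (sub_morP b) => [y|{}b Lb] ab; last first.
    by rewrite (ext_mor0 _ Lb) mulr0 ext_mor0 // gsrc_comp.
  move: ab; case: (sub_morP a) => [x|{}a La] ab; last first.
    by case: (negP (sub_rng_subproof hL y)); rewrite -ab inE.
  have xy : gsrc (x : gmor S) = grng (y : gmor S) by apply: val_inj.
  by rewrite !ext_morE (fam_comp fam) // -(val_sub_comp xy) ext_morE.
- move=> a b; case: (sub_morP b) => [y|{}b Lb] ab; last first.
    by rewrite (ext_mor0 _ Lb) mul0r ext_mor0 // gsrc_comp.
  move: ab; case: (sub_morP a) => [x|{}a La] ab; last first.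
    by case: (negP (sub_rng_subproof hL y)); rewrite -ab inE.
  have xy : gsrc (x : gmor S) = grng (y : gmor S) by apply: val_inj.
  by rewrite !ext_morE (fam_comp' fam) // -(val_sub_comp xy) ext_morE.
- move=> a; case: (sub_morP a) => [x|{}a La]; last by rewrite ext_mor0 // mulr0.
  by rewrite -[grng _]/(val (grng (x : gmor S))) ext_pE !ext_morE (fam_pt fam).
- move=> a; case: (sub_morP a) => [x|{}a La]; last by rewrite ext_mor0 // mul0r.
  by rewrite -[gsrc _]/(val (gsrc (x : gmor S))) ext_pE !ext_morE (fam_tp fam).
- move=> a; case: (sub_morP a) => [x|{}a La]; last by rewrite !ext_mor0 // mulr0.
  by rewrite -[gsrc _]/(val (gsrc (x : gmor S))) ext_pE !ext_morE (fam_pt' fam).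
- move=> a; case: (sub_morP a) => [x|{}a La]; last by rewrite !ext_mor0 // mul0r.
  by rewrite -[grng _]/(val (grng (x : gmor S))) ext_pE !ext_morE (fam_tp' fam).
- move=> a b; case: (sub_morP a) => [x|{}a La]; last first.
    by rewrite ext_mor0 // mul0r ext_p0 //; case: eqP.
  case: (sub_morP b) => [y|{}b Lb] dab.
    rewrite !ext_morE (fam_orth fam) // (inj_eq val_inj).
    by rewrite -[gsrc (val x)]/(val (gsrc (x : gmor S))) ext_pE.
  rewrite (ext_mor0 _ Lb) mulr0; case: eqP => // e.
  by case: (@sub_mor_nL x); rewrite e.
- move=> n e ue me.
  rewrite -(fam_sum fam (n := n) (e := pmap insub e : seq (sub_mor L))).
  + rewrite [LHS](bigID (fun a => a \in map val (pmap insub e : seq (sub_mor L)))) /=.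
    rewrite [X in _ + X]big1_seq ?addr0; last first.
      move=> a /andP[na ae]; case: (sub_morP a) na ae => [x|{}a La _ _]; last first.
        by rewrite (ext_mor0 _ La) mul0r.
      by move=> + xe; rewrite mem_map ?mem_pmap_sub ?xe //; exact: val_inj.
    rewrite -big_filter; transitivity
      (\sum_(a <- map val (pmap insub e : seq (sub_mor L))) ext_mor t a * ext_mor t' a).
      apply: perm_big; apply: uniq_perm; first exact: filter_uniq.
        by rewrite map_inj_uniq ?pmap_sub_uniq //; exact: val_inj.
      move=> a; rewrite mem_filter; apply/andP/idP => [[] //|h]; split=> //.
      by move: h => /mapP[x + ->]; rewrite mem_pmap_sub.
    by rewrite big_map; apply: eq_bigr => x _; rewrite !ext_morE.
  + exact: pmap_sub_uniq.
  + by move=> x; rewrite mem_pmap_sub; exact: me.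
Qed.

End ExtensionByZero.


(** * An additive section of a surjection of free commutative monoids *)

Section MonoidSection.
Variables (k l : nat) (f : {additive 'rV[nat]_k -> 'rV[nat]_l}).
Hypothesis f_surj : forall n : 'rV[nat]_l, exists m : 'rV[nat]_k, f m = n.

Lemma natv_sum_delta n (m : 'rV[nat]_n) :
  m = \sum_j (delta_mx ord0 j : 'rV[nat]_n) *+ m ord0 j.
Proof.
apply/rowP => i; rewrite summxE (bigD1 i) //= big1 ?addr0 => [|j ji].
  by rewrite mulmxnE mxE !eqxx /= -[RHS]/(1%:R *+ m 0 i) natn -mulr_natr mul1r natn.
by rewrite mulmxnE mxE eqxx /= eq_sym (negbTE ji) mul0rn.
Qed.

(** If [f m] is a basis vector, then [m] is a sum of basis vectors of which exactly
one has a nonzero image, since a basis vector is not a sum of two nonzero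
vectors. *)
Lemma basis_lift (i : 'I_l) :
  exists j : 'I_k, f (delta_mx ord0 j) = delta_mx ord0 i.
Proof.
(* count, in each coordinate, the contributions of the basis vectors to [f m] *)
have [m fm] := f_surj (delta_mx ord0 i).
have {fm} e i' : \sum_j (f (delta_mx ord0 j) ord0 i' * m ord0 j)%N = (i == i' : nat).
  have := congr1 (fun v : 'rV[nat]_l => v ord0 i') fm.
  rewrite {1}[m]natv_sum_delta raddf_sum summxE mxE eqxx /= eq_sym natn => <-.
  by apply: eq_bigr => j _; rewrite raddfMn mulmxnE -mulr_natr natn.
have [j hj] : exists j, (f (delta_mx ord0 j) ord0 i * m ord0 j != 0)%N.
  apply: contrapT => none; have := e i; rewrite eqxx big1 // => j _.
  by apply/eqP; rewrite -[_ == _]negbK; apply/negP => h; apply: none; exists j.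
have le i' : (f (delta_mx ord0 j) ord0 i' * m ord0 j <= (i == i'))%N.
  by rewrite -e (bigD1 j) //= leq_addr.
move: hj; rewrite muln_eq0 negb_or => /andP[fi mj]; exists j.
apply/rowP => i'; rewrite mxE eqxx /= eq_sym natn.
case: eqP => [<-|/eqP/negbTE ii'].
  apply/eqP; rewrite eqn_leq lt0n fi andbT.
  by have := le i; rewrite eqxx; apply: leq_trans; rewrite leq_pmulr // lt0n.
by have := le i'; rewrite ii' leqn0 muln_eq0 (negbTE mj) orbF => /eqP.
Qed.

Lemma monoid_section : exists g : {additive 'rV[nat]_l -> 'rV[nat]_k},
  forall n, f (g n) = n.
Proof.
pose b i : 'rV[nat]_k := delta_mx ord0 (projT1 (cid (basis_lift i))).
pose g (n : 'rV[nat]_l) := \sum_i b i *+ n ord0 i.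
have g0 : g 0 = 0 by rewrite /g big1 // => i _; rewrite mxE mulr0n.
have gD : {morph g : m n / m + n}.
  move=> m n; rewrite /g -big_split; apply: eq_bigr => i _ /=.
  by rewrite mxE mulrnDr.
pose ga : {additive _ -> _} := HB.pack g (GRing.isNmodMorphism.Build _ _ g (g0, gD)).
exists ga => n; rewrite /= /g raddf_sum [RHS]natv_sum_delta.
apply: eq_bigr => i _; rewrite raddfMn /b; by case: cid => j /= ->.
Qed.

End MonoidSection.


(** * The Kumjian-Pask algebra of a pullback *)

Section PullbackPaths.
Variables (k l : nat) (f : {additive 'rV[nat]_k -> 'rV[nat]_l}) (G : kgraph l).
Local Notation D := (pullback f G).

Lemma pb_path (a : gmor G) n : gdeg a = f n ->
  exists x : gmor D, val (x : pb_mor f G) = (a, n).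
Proof.
move=> da; have h : gdeg (a, n).1 == f (a, n).2 by apply/eqP.
by exists (Sub (a, n) h).
Qed.

Lemma pb_path_inj (x y : gmor D) : (val (x : pb_mor f G)).1 = (val (y : pb_mor f G)).1 ->
  gdeg x = gdeg y -> x = y.
Proof.
move=> e1 e2; apply: val_inj.
by rewrite [LHS]surjective_pairing [RHS]surjective_pairing e1; congr pair.
Qed.

Lemma pb_enum n (e : seq (gmor D)) : uniq e ->
  (forall x, x \in e <-> gdeg x = n) ->
  uniq [seq (val (x : pb_mor f G)).1 | x <- e] /\
  forall a, a \in [seq (val (x : pb_mor f G)).1 | x <- e] <-> gdeg a = f n.
Proof.
move=> ue me; split.
  rewrite map_inj_in_uniq // => x y /me dx /me dy e1.
  by apply: pb_path_inj => //; rewrite dx.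
move=> a; split=> [/mapP[x /me dx ->]|/pb_path[x ex]].
  by rewrite -dx; exact/eqP/(valP (x : pb_mor f G)).
apply/mapP; exists x; last by rewrite ex.
by apply/me; rewrite /= /pb_deg ex.
Qed.

Lemma row_finite_pb : row_finite G -> row_finite D.
Proof.
move=> rf v n; have /finite_seqP[s es] := rf (v : gvert G) (f n).
apply/finite_seqP; exists (pmap insub [seq (a, n) | a <- s]).
apply/seteqP; split=> x /=; rewrite mem_pmap_sub.
  move=> [rx dx]; apply/mapP; exists (val (x : pb_mor f G)).1.
    have: @paths_from l G v (f n) (val (x : pb_mor f G)).1.
      by split=> //; rewrite -dx; exact/eqP/(valP (x : pb_mor f G)).
    by rewrite es.
  by rewrite [LHS]surjective_pairing -dx.
move=> /mapP[a as_ ex]; have: [set` s] a by [].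
by rewrite -es => -[ra da]; split; rewrite /= /pb_rng /pb_deg ex.
Qed.

End PullbackPaths.

Section PullbackAlgebra.
Variables (K : fieldType) (k l : nat).
Variables (f : {additive 'rV[nat]_k -> 'rV[nat]_l}) (G : kgraph l).
Hypotheses (G_rf : row_finite G) (G_fin : finitely_many_vertices G).
Local Notation A := (KPpb K f G_fin).
Local Notation D := (pullback f G).
Local Notation p := (@pb_p K k l f G G_fin).
Local Notation s := (@pb_s K k l f G G_fin).
Local Notation s' := (@pb_sstar K k l f G G_fin).
Implicit Types (a b : gmor G) (m n q : 'rV[nat]_k).

Definition pb_scal (r : K) : A := r *: (1 : A).
Definition pb_gs (x : gmor D) : A := kp_s K x.
Definition pb_gs' (x : gmor D) : A := kp_sstar K x.

Lemma pb_scalE r (x : A) : r *: x = pb_scal r * x.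
Proof. exact: (@kpu_scalE K k D (finitely_many_vertices_pullback f G_fin)). Qed.

Lemma pb_scal_central : central_hom (pb_scal : K -> A).
Proof. exact: (@kpu_scal_central K k D (finitely_many_vertices_pullback f G_fin)). Qed.

Lemma pb_gfamily : kp_family (B := A) (G := D) p pb_gs pb_gs'.
Proof. exact: (@kpu_family K k D (finitely_many_vertices_pullback f G_fin)). Qed.

Lemma pb_ggenerates : fam_generates (pb_scal : K -> A) pb_gs pb_gs'.
Proof. exact: (@kpu_generates K k D (finitely_many_vertices_pullback f G_fin)). Qed.

Lemma pb_sE (x : gmor D) : s (val (x : pb_mor f G)).1 (gdeg x) = pb_gs x.
Proof.
rewrite /pb_s; have -> : ((val (x : pb_mor f G)).1, gdeg x) = val (x : pb_mor f G).
  by rewrite [RHS]surjective_pairing.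
by rewrite valK.
Qed.

Lemma pb_s'E (x : gmor D) : s' (val (x : pb_mor f G)).1 (gdeg x) = pb_gs' x.
Proof.
rewrite /pb_sstar.
have -> : ((val (x : pb_mor f G)).1, gdeg x) = val (x : pb_mor f G).
  by rewrite [RHS]surjective_pairing.
by rewrite valK.
Qed.

Variant pb_path_spec a n : A -> A -> Prop :=
  PbPath (x : gmor D) of val (x : pb_mor f G) = (a, n) :
    pb_path_spec a n (pb_gs x) (pb_gs' x).

Lemma pb_pathP a n : gdeg a = f n -> pb_path_spec a n (s a n) (s' a n).
Proof.
move=> /pb_path[x ex]; have := PbPath ex.
by rewrite -pb_sE -pb_s'E -[gdeg x]/(val (x : pb_mor f G)).2 ex.
Qed.

Let gfam := pb_gfamily.

Section Relations.
Variables (a b : gmor G) (m n : 'rV[nat]_k).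
Hypotheses (am : gdeg a = f m) (bn : gdeg b = f n).

Lemma pb_sM : gsrc a = grng b -> s a m * s b n = s (gcomp a b) (m + n).
Proof.
move=> ab; case: (pb_pathP am) => x ex; case: (pb_pathP bn) => y ey.
have xy : pb_src (x : pb_mor f G) = pb_rng (y : pb_mor f G).
  by rewrite /pb_src /pb_rng ex ey.
rewrite (fam_comp gfam (a := x) (b := y) xy) -pb_sE.
by rewrite -[gdeg _]/(val (pb_comp x y)).2 -[gcomp x y]/(pb_comp x y) val_pb_comp // ex ey.
Qed.

Lemma pb_sM' : gsrc a = grng b -> s' b n * s' a m = s' (gcomp a b) (m + n).
Proof.
move=> ab; case: (pb_pathP am) => x ex; case: (pb_pathP bn) => y ey.
have xy : pb_src (x : pb_mor f G) = pb_rng (y : pb_mor f G).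
  by rewrite /pb_src /pb_rng ex ey.
rewrite (fam_comp' gfam (a := x) (b := y) xy) -pb_s'E.
by rewrite -[gdeg _]/(val (pb_comp x y)).2 -[gcomp x y]/(pb_comp x y) val_pb_comp // ex ey.
Qed.

Lemma pb_sM0 : gsrc a <> grng b -> s a m * s b n = 0.
Proof.
move=> ab; case: (pb_pathP am) => x ex; case: (pb_pathP bn) => y ey.
by apply: (fam_comp0 gfam); rewrite /= /pb_src /pb_rng ex ey.
Qed.

Lemma pb_sM0' : gsrc a <> grng b -> s' b n * s' a m = 0.
Proof.
move=> ab; case: (pb_pathP am) => x ex; case: (pb_pathP bn) => y ey.
by apply: (fam_comp0' gfam); rewrite /= /pb_src /pb_rng ex ey.
Qed.

Lemma pb_ps : p (grng a) * s a m = s a m.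
Proof.
by case: (pb_pathP am) => x ex; rewrite -[RHS](fam_pt gfam) /= /pb_rng ex.
Qed.

Lemma pb_sp : s a m * p (gsrc a) = s a m.
Proof.
by case: (pb_pathP am) => x ex; rewrite -[RHS](fam_tp gfam) /= /pb_src ex.
Qed.

Lemma pb_ps' : p (gsrc a) * s' a m = s' a m.
Proof.
by case: (pb_pathP am) => x ex; rewrite -[RHS](fam_pt' gfam) /= /pb_src ex.
Qed.

Lemma pb_sp' : s' a m * p (grng a) = s' a m.
Proof.
by case: (pb_pathP am) => x ex; rewrite -[RHS](fam_tp' gfam) /= /pb_rng ex.
Qed.

End Relations.

Lemma pb_orth a b n : gdeg a = f n -> gdeg b = f n ->
  s' a n * s b n = if a == b then p (gsrc a) else 0.
Proof.
move=> an bn; case: (pb_pathP an) => x ex; case: (pb_pathP bn) => y ey.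
rewrite (fam_orth gfam) /= /pb_deg ?ex ?ey // /pb_src ex; congr (if _ then _ else _).
by rewrite -(inj_eq val_inj) ex ey xpair_eqE eqxx andbT.
Qed.

Lemma pb_s_id v : s (gid G v) 0 = p v.
Proof.
have d0 : gdeg (gid G v) = f 0 by rewrite gdeg_id raddf0.
case: (pb_pathP d0) => x ex; rewrite -(fam_id gfam); congr pb_gs.
by apply: val_inj; rewrite ex.
Qed.

Lemma pb_s'_id v : s' (gid G v) 0 = p v.
Proof.
have d0 : gdeg (gid G v) = f 0 by rewrite gdeg_id raddf0.
case: (pb_pathP d0) => x ex; rewrite -(fam_id' gfam); congr pb_gs'.
by apply: val_inj; rewrite ex.
Qed.

Lemma pb_sum n (e : seq (gmor G)) : uniq e -> (forall a, a \in e <-> gdeg a = f n) ->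
  \sum_(a <- e) s a n * s' a n = 1.
Proof.
move=> ue me; have rfD := row_finite_pb (f := f) G_rf.
have [ue' me'] := pb_enum (deg_paths_uniq D n) (mem_deg_paths rfD G_fin n).
rewrite -(fam_sum1 gfam rfD G_fin n).
transitivity (\sum_(a <- [seq (val (x : pb_mor f G)).1 | x <- deg_paths D n])
   s a n * s' a n).
  apply: perm_big; apply: uniq_perm => // a.
  by apply/idP/idP => [/me/me'|/me'/me].
rewrite big_map; apply: eq_big_seq => x /(mem_deg_paths rfD G_fin) <-.
by rewrite pb_sE pb_s'E.
Qed.

Lemma pb_sum1 n : \sum_(a <- deg_paths G (f n)) s a n * s' a n = 1.
Proof. by apply: pb_sum; [exact: deg_paths_uniq|exact: mem_deg_paths]. Qed.

(** For [f m = f n] this is [U_h] with [h = m - n].  Two independent degrees are kept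
because they can be enlarged at will, while the positive and negative parts of
[h] are minimal. *)
Definition pb_shift m n : A := \sum_(a <- deg_paths G (f m)) s a m * s' a n.

Lemma mem_dp a n : a \in deg_paths G (f n) -> gdeg a = f n.
Proof. by move/(mem_deg_paths G_rf G_fin). Qed.

(** The initial segment of degree [f n], taken with label [n], is recognised by
one summand of [pb_shift m n], which relabels it by [m]. *)
Lemma pb_shift_s m n q a : f m = f n -> gdeg a = f (n + q) ->
  pb_shift m n * s a (n + q) = s a (m + q).
Proof.
move=> mn; rewrite raddfD => /factor_ex[b [c [bc -> db dc]]].
have db' : gdeg b = f m by rewrite mn.
rewrite -(pb_sM db dc bc) -(pb_sM db' dc bc) mulrA; congr (_ * _).
rewrite mulr_suml (bigD1_seq b) ?deg_paths_uniq //=; last first.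
  exact/(mem_deg_paths G_rf G_fin).
rewrite -mulrA pb_orth // eqxx pb_sp // big1_seq ?addr0 // => d /andP[db_ dd].
by rewrite -mulrA pb_orth ?(negbTE db_) ?mulr0 // (mem_dp dd).
Qed.

Lemma pb_s'_shift m n q a : f m = f n -> gdeg a = f (m + q) ->
  s' a (m + q) * pb_shift m n = s' a (n + q).
Proof.
move=> mn; rewrite raddfD => /factor_ex[b [c [bc -> db dc]]].
have db' : gdeg b = f n by rewrite -mn.
rewrite -(pb_sM' db dc bc) -(pb_sM' db' dc bc) -mulrA; congr (_ * _).
rewrite mulr_sumr (bigD1_seq b) ?deg_paths_uniq //=; last first.
  exact/(mem_deg_paths G_rf G_fin).
rewrite mulrA pb_orth // eqxx pb_ps' // big1_seq ?addr0 // => d /andP[db_ dd].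
by rewrite mulrA pb_orth 1?eq_sym ?(negbTE db_) ?mul0r // (mem_dp dd).
Qed.

Lemma pb_shift_refl n : pb_shift n n = 1.
Proof. exact: pb_sum1. Qed.

Lemma pb_shiftD m n q : f m = f n -> pb_shift (m + q) (n + q) = pb_shift m n.
Proof.
move=> mn; rewrite -[RHS]mulr1 -(pb_sum1 (n + q)) mulr_sumr {1}/pb_shift.
have -> : f (m + q) = f (n + q) by rewrite !raddfD mn.
apply: eq_big_seq => a /mem_dp da.
by rewrite mulrA pb_shift_s.
Qed.

Lemma pb_shift_trans m n q : f m = f n -> f n = f q ->
  pb_shift m n * pb_shift n q = pb_shift m q.
Proof.
move=> mn nq; rewrite [X in _ * X]/pb_shift mulr_sumr -mn.
apply: eq_big_seq => a /mem_dp da.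
by have := pb_shift_s (q := 0) (a := a) mn; rewrite !addr0 mulrA => -> //; rewrite da.
Qed.

(** Write [1] as the sum of the [s b n * s' b n].  In [s a q * s b n] the composite
path has the label [n + q], so the shift relabels it; relabelling the
factor [b] instead has the same effect. *)
Lemma pb_shift_sC m n q a : f m = f n -> gdeg a = f q ->
  pb_shift m n * s a q = s a q * pb_shift m n.
Proof.
move=> mn da; rewrite -[X in _ * X = _]mulr1 -(pb_sum1 n) [X in _ = _ * X]/pb_shift.
rewrite mn !mulr_sumr; apply: eq_big_seq => b /mem_dp db.
rewrite !mulrA -(mulrA (pb_shift _ _)).
have [ab|ab] := EM (gsrc a = grng b); last by rewrite !pb_sM0 ?mulr0 // mn.
rewrite !pb_sM // ?mn // ![q + _]addrC pb_shift_s //.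
by rewrite gdeg_comp // raddfD da db addrC.
Qed.

Lemma pb_s'_shiftC m n q a : f m = f n -> gdeg a = f q ->
  s' a q * pb_shift m n = pb_shift m n * s' a q.
Proof.
move=> mn da; rewrite -[X in X * _ = _]mul1r -(pb_sum1 m) [X in _ = X * _]/pb_shift.
rewrite !mulr_suml; apply: eq_big_seq => b /mem_dp db.
rewrite -!mulrA (mulrA (s' b m)).
have [ab|ab] := EM (gsrc a = grng b); last by rewrite !pb_sM0' ?mul0r // -mn.
rewrite !pb_sM' // -?mn // ![q + _]addrC pb_s'_shift //.
by rewrite gdeg_comp // raddfD da db addrC.
Qed.

Lemma pb_shift_central m n (x : A) : f m = f n ->
  pb_shift m n * x = x * pb_shift m n.
Proof.
move=> mn; move: x; apply: pb_ggenerates => [r|y|y|x y hx hy|x y hx hy].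
- by rewrite (chC pb_scal_central).
- by rewrite -pb_sE pb_shift_sC //; exact/eqP/(valP (y : pb_mor f G)).
- by rewrite -pb_s'E pb_s'_shiftC //; exact/eqP/(valP (y : pb_mor f G)).
- by rewrite mulrDr mulrDl hx hy.
- by rewrite mulrA hx -mulrA hy mulrA.
Qed.

Lemma pb_shift_eq m n m' n' : f m = f n -> f m' = f n' -> m + n' = m' + n ->
  pb_shift m n = pb_shift m' n'.
Proof.
move=> mn mn' e; rewrite -(pb_shiftD m' mn) -(pb_shiftD m mn') addrC.
by congr pb_shift; rewrite ?[n' + m]addrC ?e // addrC.
Qed.

End PullbackAlgebra.


(** * The central copy of the group algebra *)

Section GroupAlgebraAction.
Variables (K : fieldType) (k l : nat).
Variables (f : {additive 'rV[nat]_k -> 'rV[nat]_l}) (G : kgraph l).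
Hypotheses (G_rf : row_finite G) (G_fin : finitely_many_vertices G).
Local Notation A := (KPpb K f G_fin).
Local Notation C := (Cker K f).
Local Notation U := (@Uh K k l f G G_fin).
Local Notation shift := (@pb_shift K k l f G G_fin).
Implicit Types (g h : kerfbar f) (m n : 'rV[nat]_k).

Lemma kerfbar_parts h : f (pos_part (val h)) = f (neg_part (val h)).
Proof.
have := valP h; rewrite inE /gcompletion subr_eq0 => /eqP.
exact: zvec_inj.
Qed.

Lemma UhE x : U x = shift (pos_part x) (neg_part x).
Proof.
rewrite /Uh fsbig_finite //=.
under eq_bigr => v _.
  rewrite fsbig_finite; last exact: G_rf.
  rewrite (perm_big [seq a <- deg_paths G (f (pos_part x)) | grng a == v]) /=;
    last first.
    apply: uniq_perm; rewrite ?fset_uniq ?filter_uniq ?deg_paths_uniq //.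
    move=> a; rewrite mem_filter in_fset_set; last exact: G_rf.
    apply/idP/andP; first by rewrite inE => -[/eqP -> /(mem_deg_paths G_rf G_fin)].
    by rewrite inE => -[/eqP ra /(mem_deg_paths G_rf G_fin)].
  rewrite big_filter; over.
rewrite (exchange_big_dep predT) //=; apply: eq_bigr => a _.
under eq_bigl do rewrite eq_sym.
rewrite -big_filter filter_pred1_uniq ?big_seq1 ?fset_uniq //.
by rewrite in_fset_set // inE.
Qed.

Lemma Uh_shift h m n : f m = f n -> val h = zvec m - zvec n -> U (val h) = shift m n.
Proof.
move=> mn e; rewrite UhE; apply: pb_shift_eq => //; first exact: kerfbar_parts.
apply: zvec_inj; rewrite !zvecD; have := pos_neg_partE (val h); rewrite {1}e.
move=> /esym/(canRL (subrK _)) ->.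
by rewrite addrAC subrK.
Qed.

(** After enlarging the degrees the two shifts become composable. *)
Lemma UhD g h : U (val g) * U (val h) = U (val (g + h)).
Proof.
rewrite (Uh_shift (h := g + h) (m := pos_part (val g) + pos_part (val h))
  (n := neg_part (val h) + neg_part (val g))).
- rewrite !UhE -(pb_shiftD K G_rf G_fin (pos_part (val h)) (kerfbar_parts g)).
  rewrite -(pb_shiftD K G_rf G_fin (neg_part (val g)) (kerfbar_parts h)).
  rewrite [pos_part (val h) + neg_part _]addrC.
  apply: pb_shift_trans => //.
  + by rewrite !(raddfD f) !kerfbar_parts.
  + by rewrite !(raddfD f) !kerfbar_parts addrC.
- by rewrite !(raddfD f) !kerfbar_parts addrC.
- rewrite raddfD /= {1}[val g]pos_neg_partE {1}[val h]pos_neg_partE addrACA.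
  by rewrite !zvecD -opprD [zvec (neg_part _) + _]addrC.
Qed.

Lemma Uh0 : U (val (0 : kerfbar f)) = 1.
Proof. by rewrite (@Uh_shift 0 0 0) ?pb_shift_refl // raddf0 subrr. Qed.

Lemma Uh_central h (x : A) : U (val h) * x = x * U (val h).
Proof. by rewrite UhE pb_shift_central //; exact: kerfbar_parts. Qed.

Local Notation iota := (@iota_C K k l f G G_fin).

Lemma iota_w (d : {fset kerfbar f}) (c : C) : (msupp c `<=` d)%fset ->
  iota c = \sum_(h <- d) c@_h *: U (val h).
Proof.
move=> cd; rewrite /iota_C (big_fset_incl _ cd) // => h _ /mcoeff_outdom ->.
by rewrite scale0r.
Qed.

Lemma iotaD : {morph iota : c d / c + d}.
Proof.
move=> c d; rewrite (iota_w (fsubsetUl (msupp c) (msupp d))).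
rewrite (iota_w (fsubsetUr (msupp c) (msupp d))) (iota_w (msuppD_le _ _)).
rewrite -big_split; apply: eq_bigr => h _.
by rewrite mcoeffD scalerDl.
Qed.

Lemma iota0 : iota 0 = 0.
Proof. by apply: (addIr (iota 0)); rewrite -iotaD !add0r. Qed.

Lemma iotaU r h : iota << r *g h >> = r *: U (val h).
Proof. by rewrite (iota_w msuppU_le) big_seq_fset1 mcoeffUU. Qed.

Lemma iotaM : {morph iota : c d / c * d}.
Proof.
move=> c d; rewrite [c * d](grpalg_mulw (fsubset_refl _) (fsubset_refl _)).
rewrite (big_morph iota iotaD iota0) mulr_suml; apply: eq_bigr => g _.
rewrite (big_morph iota iotaD iota0) mulr_sumr; apply: eq_bigr => h _.
rewrite iotaU -UhD !pb_scalE (chM (pb_scal_central K f G_fin)) -!mulrA.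
by congr (_ * _); rewrite !mulrA; congr (_ * _); rewrite (chC (pb_scal_central K f G_fin)).
Qed.

Lemma iota_central : central_hom iota.
Proof.
split; [exact: iotaD|exact: iotaM| |].
  by rewrite iotaU Uh0 scale1r.
move=> c x; rewrite /iota_C mulr_suml mulr_sumr; apply: eq_bigr => h _.
by rewrite pb_scalE -mulrA Uh_central !mulrA (chC (pb_scal_central K f G_fin)).
Qed.

Lemma iota_scal r : iota << r *g (0 : kerfbar f) >> = pb_scal f G_fin r.
Proof. by rewrite iotaU Uh0. Qed.

Lemma iota_u h : iota (grpalg_u K h) = U (val h).
Proof. by rewrite iotaU scale1r. Qed.

End GroupAlgebraAction.

(** * The pullback algebra is a Kumjian-Pask algebra over the group algebra *)

Section BaseFamily.
Variables (K : fieldType) (k l : nat).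
Variables (f : {additive 'rV[nat]_k -> 'rV[nat]_l}) (G : kgraph l).
Hypotheses (G_rf : row_finite G) (G_fin : finitely_many_vertices G).
Variable sigma : {additive 'rV[nat]_l -> 'rV[nat]_k}.
Hypothesis sigmaK : forall n, f (sigma n) = n.
Local Notation A := (KPpb K f G_fin).
Local Notation C := (Cker K f).
Local Notation U := (@Uh K k l f G G_fin).
Local Notation D := (pullback f G).
Local Notation iota := (@iota_C K k l f G G_fin).
Local Notation p := (@pb_p K k l f G G_fin).
Local Notation s := (@pb_s K k l f G G_fin).
Local Notation s' := (@pb_sstar K k l f G G_fin).
Implicit Types (a b : gmor G) (m n : 'rV[nat]_k).

(** Among the labels [n] with [f n = gdeg a], the section picks one, additively
under composition. *)
Definition base_t a : A := s a (sigma (gdeg a)).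
Definition base_t' a : A := s' a (sigma (gdeg a)).

Lemma base_family : kp_family p base_t base_t'.
Proof.
have ds a : gdeg a = f (sigma (gdeg a)) by rewrite sigmaK.
split.
- by move=> v; rewrite /base_t gdeg_id raddf0 pb_s_id.
- by move=> v; rewrite /base_t' gdeg_id raddf0 pb_s'_id.
- exact: (fam_pp (pb_gfamily K f G_fin)).
- by move=> a b ab; rewrite /base_t pb_sM // gdeg_comp // raddfD.
- by move=> a b ab; rewrite /base_t' pb_sM' // gdeg_comp // raddfD.
- by move=> a; exact: pb_ps.
- by move=> a; exact: pb_sp.
- by move=> a; exact: pb_ps'.
- by move=> a; exact: pb_sp'.
- by move=> a b dab; rewrite /base_t /base_t' -dab pb_orth // sigmaK.
- move=> n e ue me; rewrite -(@pb_sum K k l f G G_rf G_fin (sigma n) e) //.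
    by apply: eq_big_seq => a /me da; rewrite /base_t /base_t' da.
  by rewrite sigmaK.
Qed.

Lemma kerdeg_subproof n : zvec n - zvec (sigma (f n)) \in ker_gcompletion f.
Proof. by rewrite inE gcompletion_sub sigmaK subrr. Qed.

(** The component of the degree in the kernel, for the splitting of Z^k that is
given by [sigma]. *)
Definition kerdeg n : kerfbar f := Sub (zvec n - zvec (sigma (f n))) (kerdeg_subproof n).

Lemma kerdegD m n : kerdeg (m + n) = kerdeg m + kerdeg n.
Proof.
apply: val_inj; rewrite [RHS]raddfD /= !raddfD /= !zvecD.
by rewrite opprD addrACA.
Qed.

Lemma kerdeg0 : kerdeg 0 = 0.
Proof. by apply: (addIr (kerdeg 0)); rewrite -kerdegD !add0r. Qed.

Lemma kerdegB h m n : f m = f n -> val h = zvec m - zvec n ->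
  kerdeg m - kerdeg n = h.
Proof.
move=> mn e; apply: val_inj; rewrite raddfB /= e mn opprB addrA.
by rewrite subrK.
Qed.

Lemma pb_s_base a n : gdeg a = f n -> s a n = iota (grpalg_u K (kerdeg n)) * base_t a.
Proof.
move=> da; rewrite iota_u (@Uh_shift K k l f G G_rf G_fin (kerdeg n) n (sigma (f n)) (esym (sigmaK _)) erefl).
have := @pb_shift_s K k l f G G_rf G_fin n (sigma (f n)) 0 a.
by rewrite !addr0 /base_t da => -> //; rewrite sigmaK.
Qed.

Lemma pb_s'_base a n : gdeg a = f n ->
  s' a n = iota (grpalg_u K (- kerdeg n)) * base_t' a.
Proof.
move=> da; rewrite iota_u Uh_central //.
have e : val (- kerdeg n) = zvec (sigma (f n)) - zvec n by rewrite raddfN /= opprB.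
rewrite (@Uh_shift K k l f G G_rf G_fin (- kerdeg n) (sigma (f n)) n (sigmaK _) e).
have := @pb_s'_shift K k l f G G_rf G_fin (sigma (f n)) n 0 a.
by rewrite !addr0 /base_t' da => -> //; rewrite sigmaK.
Qed.

Lemma base_generates : fam_generates iota base_t base_t'.
Proof.
move=> Q Qc Qt Qt' QD QM; apply: pb_ggenerates => // [r|x|x].
- by rewrite -iota_scal.
- rewrite -pb_sE pb_s_base; first exact: QM.
  exact/eqP/(valP (x : pb_mor f G)).
- rewrite -pb_s'E pb_s'_base; first exact: QM.
  exact/eqP/(valP (x : pb_mor f G)).
Qed.

Section Universal.
Variables (B : pzRingType) (j : C -> B).
Variables (q : gvert G -> B) (t t' : gmor G -> B).
Hypotheses (hj : central_hom j) (fam : kp_family q t t').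

Let gu h := j (grpalg_u K h).

Lemma guD g h : gu (g + h) = gu g * gu h.
Proof. by rewrite /gu -(chM hj) grpalg_uM. Qed.

Lemma gu0 : gu 0 = 1.
Proof. exact: (ch1 hj). Qed.

Let gt (x : gmor D) := gu (kerdeg (gdeg x)) * t (val (x : pb_mor f G)).1.
Let gt' (x : gmor D) := gu (- kerdeg (gdeg x)) * t' (val (x : pb_mor f G)).1.

Lemma gu_swap g h (x y : B) : gu g * x * (gu h * y) = gu (g + h) * (x * y).
Proof. by rewrite guD -!mulrA; congr (_ * _); rewrite mulrA -(chC hj) mulrA. Qed.

Lemma pulled_family : kp_family (G := D) q gt gt'.
Proof.
split.
- move=> v; rewrite /gt gdeg_id kerdeg0 gu0 mul1r; exact: (fam_id fam).
- move=> v; rewrite /gt' gdeg_id kerdeg0 oppr0 gu0 mul1r; exact: (fam_id' fam).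
- exact: (fam_pp fam).
- move=> x y xy; rewrite /gt gu_swap gdeg_comp // kerdegD; congr (_ * _).
  by rewrite (fam_comp fam) // -[gcomp x y]/(pb_comp x y) val_pb_comp.
- move=> x y xy; rewrite /gt' gu_swap gdeg_comp // kerdegD opprD addrC; congr (_ * _).
  by rewrite (fam_comp' fam) // -[gcomp x y]/(pb_comp x y) val_pb_comp.
- by move=> x; rewrite /gt mulrA -(chC hj) -mulrA (fam_pt fam).
- by move=> x; rewrite /gt -mulrA (fam_tp fam).
- by move=> x; rewrite /gt' mulrA -(chC hj) -mulrA (fam_pt' fam).
- by move=> x; rewrite /gt' -mulrA (fam_tp' fam).
- move=> x y dxy; rewrite /gt /gt' gu_swap dxy addNr gu0 mul1r (fam_orth fam).
    congr (if _ then _ else _); apply/eqP/eqP => [e|-> //].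
    exact: pb_path_inj.
  rewrite (eqP (valP (x : pb_mor f G))) (eqP (valP (y : pb_mor f G))).
  by congr (f _).
- move=> n e ue me; have [ue' me'] := pb_enum ue me.
  rewrite -(fam_sum fam ue' me') big_map; apply: eq_bigr => x _.
  by rewrite /gt /gt' gu_swap subrr gu0 mul1r.
Qed.

(** A family of [G] with coefficients in the group algebra yields a family of the
pullback: [s_(a, n)] is sent to [u_(kerdeg n) t_a], and its ghost to
[u_(- kerdeg n) t'_a].  Compatibility with [iota] holds because the group elements
come out of the sum that defines [U_h]. *)
Lemma base_universal : exists phi : {rmorphism A -> B},
  [/\ forall v, phi (p v) = q v, forall a, phi (base_t a) = t a,
      forall a, phi (base_t' a) = t' a & forall c, phi (iota c) = j c].
Proof.
pose jK (r : K) := j << r *g (0 : kerfbar f) >>.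
have hjK : central_hom jK.
  split=> [r r'|r r'||r b]; rewrite /jK.
  - by rewrite monalgUD (chD hj).
  - by rewrite -(chM hj) [_ * _ in RHS]grpalg_mulUU addr0.
  - exact: (ch1 hj).
  - exact: (chC hj).
have [phi [phip phit phit' phij]] : exists phi : {rmorphism A -> B},
    [/\ forall v, phi (p v) = q v, forall x, phi (pb_gs K G_fin x) = gt x,
        forall x, phi (pb_gs' K G_fin x) = gt' x &
        forall r, phi (pb_scal f G_fin r) = jK r].
  exact: (@kpu_universal K k D (row_finite_pb (f := f) G_rf)
    (finitely_many_vertices_pullback f G_fin) B jK q gt gt' hjK pulled_family).
exists phi.
have phis a n : gdeg a = f n -> phi (s a n) = gu (kerdeg n) * t a.
  move=> da; have [x ex] := pb_path da.
  have := phit x; rewrite /gt -[gdeg x]/(val (x : pb_mor f G)).2 ex /= => <-.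
  congr (phi _); rewrite -pb_sE.
  by rewrite -[gdeg x]/(val (x : pb_mor f G)).2 ex.
have phis' a n : gdeg a = f n -> phi (s' a n) = gu (- kerdeg n) * t' a.
  move=> da; have [x ex] := pb_path da.
  have := phit' x; rewrite /gt' -[gdeg x]/(val (x : pb_mor f G)).2 ex /= => <-.
  congr (phi _); rewrite -pb_s'E.
  by rewrite -[gdeg x]/(val (x : pb_mor f G)).2 ex.
have kd0 (n : 'rV[nat]_l) : kerdeg (sigma n) = 0 by apply: val_inj; rewrite /= sigmaK subrr.
split.
- exact: phip.
- by move=> a; rewrite /base_t phis ?sigmaK // kd0 gu0 mul1r.
- by move=> a; rewrite /base_t' phis' ?sigmaK // kd0 oppr0 gu0 mul1r.
move=> c; rewrite {2}[c]monalgE (big_morph j (chD hj) (ch0 hj)).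
rewrite /iota_C rmorph_sum; apply: eq_bigr => h _.
rewrite pb_scalE rmorphM phij /jK UhE //.
have -> : (<< c@_h *g h >> : C) = (<< c@_h *g (0 : kerfbar f) >> : C) * grpalg_u K h.
  by rewrite [RHS]grpalg_mulUU mulr1 add0r.
rewrite (chM hj); congr (_ * _).
rewrite /pb_shift rmorph_sum.
have -> : j (grpalg_u K h) =
    gu (kerdeg (pos_part (val h)) - kerdeg (neg_part (val h))).
  by rewrite (kerdegB (kerfbar_parts h) (pos_neg_partE _)).
rewrite -[RHS]mulr1.
rewrite -(fam_sum1 fam G_rf G_fin (f (pos_part (val h)))) mulr_sumr.
apply: eq_big_seq => a /(mem_deg_paths G_rf G_fin) da.
by rewrite rmorphM phis // phis' -?kerfbar_parts // gu_swap.
Qed.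

End Universal.
End BaseFamily.


(** * Maximal left ideals and primitive ideals *)

Local Open Scope quotient_scope.

Section LeftIdeals.
Variable A : pzRingType.

Record left_ideal (L : set A) : Prop := {
  li0 : L 0;
  liD : forall x y, L x -> L y -> L (x + y);
  liM : forall a x, L x -> L (a * x)
}.

Lemma maximal_left_ideal (L : set A) : left_ideal L -> ~ L 1 ->
  exists M, [/\ left_ideal M, L `<=` M, ~ M 1 &
    forall N, left_ideal N -> M `<=` N -> ~ N 1 -> N = M].
Proof.
move=> hL L1.
(* the empty set is included so that the union of the empty chain is admissible *)
pose Q (X : set A) := X = set0 \/ [/\ left_ideal X, L `<=` X & ~ X 1].
have [F FQ tot|M [QM maxM]] := @Zorn_bigcup A Q.
  have [[X0 FX0 nX0]|allE] := EM (exists2 X, F X & X <> set0); last first.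
    left; apply/seteqP; split=> // x [X FX Xx].
    by case: allE; exists X => // X0; rewrite X0 in Xx.
  have hX X : F X -> X !=set0 -> [/\ left_ideal X, L `<=` X & ~ X 1].
    by move=> /FQ[->|//] [].
  have X0n : X0 !=set0 by apply/set0P/eqP.
  have [hX0 LX0 _] := hX X0 FX0 X0n.
  right; split.
  - split.
    + by exists X0 => //; exact: li0 hX0.
    + move=> x y [X FX Xx] [Y FY Yy].
      have [idX _ _] := hX X FX (ex_intro _ x Xx).
      have [idY _ _] := hX Y FY (ex_intro _ y Yy).
      have [XY|YX] := tot X Y FX FY.
        by exists Y => //; apply: (liD idY) => //; exact: XY.
      by exists X => //; apply: (liD idX) => //; exact: YX.
    + move=> a x [X FX Xx]; exists X => //.
      by have [h _ _] := hX X FX (ex_intro _ x Xx); exact: liM h a x Xx.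
  - by move=> x Lx; exists X0 => //; exact: LX0.
  - by move=> [X FX X1]; have [_ _] := hX X FX (ex_intro _ 1 X1); apply.
have {QM} [hM LM M1] : [/\ left_ideal M, L `<=` M & ~ M 1].
  case: QM => // M0; exfalso; apply: (maxM L); last by right; split.
  by rewrite M0; split=> // L0; exact: (L0 0 (li0 hL)).
exists M; split=> // N hN MN N1; apply: contrapT => NM; apply: (maxM N).
  by split=> // NM'; apply: NM; apply/seteqP.
by right; split=> // x /LM /MN.
Qed.

Section LeftQuotient.
Variables (L : set A) (hL : left_ideal L).

Lemma liN x : L x -> L (- x).
Proof. by move=> Lx; rewrite -mulN1r; exact: liM. Qed.

Definition lirel (x y : A) : bool := `[< L (x - y) >].

Lemma lirel_refl : reflexive lirel.
Proof. by move=> x; apply/asboolP; rewrite subrr; exact: li0. Qed.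

Lemma lirel_sym : symmetric lirel.
Proof.
by move=> x y; apply/asboolP/asboolP => h; rewrite -opprB; exact: liN.
Qed.

Lemma lirel_trans : transitive lirel.
Proof.
move=> y x z /asboolP xy /asboolP yz; apply/asboolP.
by rewrite -(subrKA y); exact: liD.
Qed.

Canonical lirel_equiv := EquivRel lirel lirel_refl lirel_sym lirel_trans.

Definition lquot : Type := {eq_quot lirel_equiv}.
HB.instance Definition _ := Choice.on lquot.

Definition lq_map (x : A) : lquot := (\pi_{eq_quot lirel_equiv} x).
Definition lq_repr (x : lquot) : A := repr (x : {eq_quot lirel_equiv}).

Lemma lq_mapP x y : lq_map x = lq_map y <-> L (x - y).
Proof.
rewrite /lq_map; split; first by move/eqmodP => /asboolP.
by move=> h; apply/eqmodP/asboolP.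
Qed.

Lemma lq_reprK x : lq_map (lq_repr x) = x.
Proof. exact: reprK. Qed.

Lemma lq_repr_map x : L (lq_repr (lq_map x) - x).
Proof. by apply/lq_mapP; rewrite lq_reprK. Qed.

Lemma lquot_ind (P : lquot -> Prop) : (forall x, P (lq_map x)) -> forall x, P x.
Proof. by move=> h x; rewrite -[x]lq_reprK. Qed.

Definition lq_add x y := lq_map (lq_repr x + lq_repr y).
Definition lq_opp x := lq_map (- lq_repr x).
Definition lq_scale a x := lq_map (a * lq_repr x).

Lemma lq_addE x y : lq_add (lq_map x) (lq_map y) = lq_map (x + y).
Proof.
by apply/lq_mapP; rewrite opprD addrACA; apply: liD => //; exact: lq_repr_map.
Qed.

Lemma lq_oppE x : lq_opp (lq_map x) = lq_map (- x).
Proof. by apply/lq_mapP; rewrite -opprD; apply: liN; exact: lq_repr_map. Qed.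

Lemma lq_scaleE a x : lq_scale a (lq_map x) = lq_map (a * x).
Proof. by apply/lq_mapP; rewrite -mulrBr; apply: liM => //; exact: lq_repr_map. Qed.

Let lqE := (lq_addE, lq_oppE, lq_scaleE).

Lemma lq_addA : associative lq_add.
Proof.
elim/lquot_ind=> x; elim/lquot_ind=> y; elim/lquot_ind=> z.
by rewrite !lqE addrA.
Qed.
Lemma lq_addC : commutative lq_add.
Proof. by elim/lquot_ind=> x; elim/lquot_ind=> y; rewrite !lqE addrC. Qed.
Lemma lq_add0 : left_id (lq_map 0) lq_add.
Proof. by elim/lquot_ind=> x; rewrite lqE add0r. Qed.
Lemma lq_addN : left_inverse (lq_map 0) lq_opp lq_add.
Proof. by elim/lquot_ind=> x; rewrite !lqE addNr. Qed.

HB.instance Definition _ := GRing.isZmodule.Build lquot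
  lq_addA lq_addC lq_add0 lq_addN.

Lemma lq_scaleA a b x : lq_scale a (lq_scale b x) = lq_scale (a * b) x.
Proof. by elim/lquot_ind: x => x; rewrite !lqE mulrA. Qed.
Lemma lq_scale1 : left_id 1 lq_scale.
Proof. by elim/lquot_ind=> x; rewrite lqE mul1r. Qed.
Lemma lq_scaleDr : right_distributive lq_scale +%R.
Proof.
move=> a; elim/lquot_ind=> x; elim/lquot_ind=> y.
by rewrite /GRing.add /= !lqE mulrDr.
Qed.
Lemma lq_scaleDl x : {morph lq_scale^~ x : a b / a + b}.
Proof.
move=> a b; elim/lquot_ind: x => x.
by rewrite [RHS]/GRing.add /= !lqE mulrDl.
Qed.

HB.instance Definition _ := GRing.Zmodule_isLmodule.Build A lquot
  lq_scaleA lq_scale1 lq_scaleDr lq_scaleDl.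

Lemma lq_map_eq0 x : lq_map x = 0 <-> L x.
Proof. by rewrite -[x in L x]subr0; exact: lq_mapP. Qed.

Lemma lq_simple : ~ L 1 ->
  (forall N, left_ideal N -> L `<=` N -> ~ N 1 -> N = L) ->
  simple_module (lquot : lmodType A).
Proof.
move=> L1 maxL; split; first by exists (lq_map 1); apply/eqP => /lq_map_eq0.
move=> N hN; pose N' : set A := [set x | N (lq_map x)].
have lN' : left_ideal N'.
  split; first exact: subm0 hN.
  - by move=> x y Nx Ny; rewrite /N' /= -lq_addE; exact: (submD hN).
  - by move=> a x Nx; rewrite /N' /= -lq_scaleE; exact: (submZ hN).
have LN' : L `<=` N'.
  by move=> x /lq_map_eq0 Lx; rewrite /N' /= Lx; exact: subm0 hN.
have [N1|N1] := EM (N' 1).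
  right; apply/seteqP; split=> // x _; elim/lquot_ind: x => x.
  by rewrite -[x]mulr1; exact: (liM lN' x N1).
left; have N'L := maxL N' lN' LN' N1; apply/seteqP; split=> x /=.
  elim/lquot_ind: x => x Nx; apply/lq_map_eq0.
  by rewrite -N'L.
by move->; exact: subm0 hN.
Qed.

End LeftQuotient.

(** Let [L] be the left ideal of all [x] with [x e] in [P]; it contains [P] and
[1 - e], but not 1.  Let [M] be a maximal left ideal above [L].  An element
outside [P] that annihilates [A / M] would put [e] into the annihilator, hence
[e] and 1 into [M]. *)
Theorem primitive_of_idempotent (P : set A) (e : A) :
  two_sided_ideal P -> e * e = e -> ~ P e ->
  (forall a, ~ P a -> exists x y, P (x * a * y - e)) -> Prim A P.
Proof.
move=> hP ee Pe hPe.
(* this left ideal contains [1 - e] because [e] is idempotent *)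
pose L : set A := [set x | P (x * e)].
have hL : left_ideal L.
  split; rewrite /L /=.
  - by rewrite mul0r; exact: tsi0 hP.
  - by move=> x y Px Py; rewrite mulrDl; exact: (tsiD hP).
  - by move=> a x Px; rewrite -mulrA; exact: (tsiMl hP).
have [|M [hM LM M1 maxM]] := maximal_left_ideal hL; first by rewrite /L /= mul1r.
have PM x : P x -> M x by move=> Px; apply: LM; exact: (tsiMr hP).
exists (lquot hM : lmodType A); first exact: lq_simple.
apply/seteqP; split=> a.
  move=> Pa; elim/lquot_ind=> x; rewrite [LHS]lq_scaleE.
  by apply/lq_map_eq0/PM; exact: (tsiMr hP).
move=> ann_a; apply: contrapT => Pa; have [x [y Pxy]] := hPe a Pa.
apply: M1; have -> : 1 = (1 - e) + (x * a * y - (x * a * y - e)) :> A.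
  by rewrite subKr subrK.
apply: (liD hM); first by apply: LM; rewrite /L /= mulrBl mul1r ee subrr; exact: tsi0 hP.
apply: (liD hM); last by apply: (liN hM); exact: PM.
rewrite -mulrA; apply: (liM hM).
by have := ann_a (lq_map hM y); rewrite [LHS]lq_scaleE => /lq_map_eq0.
Qed.

End LeftIdeals.


(** * The ideals attached to maximal tails and maximal ideals *)

Section IdealLemmas.
Variable A : pzRingType.

Lemma ideal_gen_ideal (X : set A) : two_sided_ideal (ideal_gen X).
Proof.
split.
- by move=> I [hI _]; exact: tsi0 hI.
- by move=> x y hx hy I hI; apply: (tsiD hI.1); [exact: hx|exact: hy].
- by move=> a x hx I hI; apply: (tsiMl hI.1); exact: hx.
- by move=> x a hx I hI; apply: (tsiMr hI.1); exact: hx.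
Qed.

Lemma ideal_gen_sub (X I : set A) : two_sided_ideal I -> X `<=` I ->
  ideal_gen X `<=` I.
Proof. by move=> hI XI x; apply. Qed.

Lemma sub_ideal_gen (X : set A) : X `<=` ideal_gen X.
Proof. by move=> x Xx I [_]; apply. Qed.

Lemma ideal_eqT (I : set A) : two_sided_ideal I -> I 1 -> I = setT.
Proof.
move=> hI I1; apply/seteqP; split=> // x _.
by rewrite -[x]mulr1; exact: (tsiMl hI).
Qed.

Lemma left_span0 (X : set A) : left_span X 0.
Proof. by exists [::] => //; rewrite big_nil. Qed.

Lemma left_spanD (X : set A) x y :
  left_span X x -> left_span X y -> left_span X (x + y).
Proof.
move=> [s hs ->] [r hr ->]; exists (s ++ r); rewrite ?big_cat //.
by move=> u; rewrite mem_cat => /orP[/hs|/hr].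
Qed.

Lemma left_spanM (X : set A) a x : left_span X x -> left_span X (a * x).
Proof.
move=> [s hs ->]; exists [seq (a * u.1, u.2) | u <- s].
  by move=> _ /mapP[u us ->]; exact: (hs u us).
by rewrite big_map mulr_sumr; apply: eq_bigr => u _; rewrite mulrA.
Qed.

Lemma left_span_sub (X I : set A) : two_sided_ideal I -> X `<=` I ->
  left_span X `<=` I.
Proof.
move=> hI XI _ [s hs ->]; rewrite big_seq.
apply: big_ind; [exact: tsi0 hI|exact: tsiD hI|].
by move=> u us; apply: (tsiMl hI); apply: XI; exact: hs.
Qed.

Lemma sub_left_span (X : set A) : X `<=` left_span X.
Proof.
move=> x Xx; exists [:: (1, x)]; last by rewrite big_seq1 mul1r.
by move=> u; rewrite inE => /eqP->.
Qed.

Lemma left_span_ideal (X : set A) :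
  (forall x a, X x -> x * a = a * x) -> two_sided_ideal (left_span X).
Proof.
move=> cX; split.
- exact: left_span0.
- exact: left_spanD.
- exact: left_spanM.
move=> _ a [s hs ->]; exists [seq (u.1 * a, u.2) | u <- s].
  by move=> _ /mapP[u us ->]; exact: (hs u us).
rewrite big_map mulr_suml big_seq [RHS]big_seq; apply: eq_bigr => u us.
by rewrite -!mulrA (cX u.2 a (hs u us)).
Qed.

Lemma ideal_add_ideal (I J : set A) : two_sided_ideal I -> two_sided_ideal J ->
  two_sided_ideal [set x + y | x in I & y in J].
Proof.
move=> hI hJ; split.
- by exists 0; [exact: tsi0 hI|exists 0; rewrite ?addr0 //; exact: tsi0 hJ].
- move=> _ _ [x Ix [y Jy <-]] [x' Ix' [y' Jy' <-]].
  exists (x + x'); first exact: (tsiD hI).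
  by exists (y + y'); [exact: (tsiD hJ)|rewrite addrACA].
- move=> a _ [x Ix [y Jy <-]]; exists (a * x); first exact: (tsiMl hI).
  by exists (a * y); [exact: (tsiMl hJ)|rewrite mulrDr].
- move=> _ a [x Ix [y Jy <-]]; exists (x * a); first exact: (tsiMr hI).
  by exists (y * a); [exact: (tsiMr hJ)|rewrite mulrDl].
Qed.

End IdealLemmas.

Lemma kernel_ideal (R S : pzRingType) (phi : {rmorphism R -> S}) :
  two_sided_ideal [set a | phi a = 0].
Proof.
split=> /=; first exact: rmorph0.
- by move=> x y x0 y0; rewrite rmorphD x0 y0 addr0.
- by move=> a x x0; rewrite rmorphM x0 mulr0.
- by move=> x a x0; rewrite rmorphM x0 mul0r.
Qed.

Section MaximalIdeal.
Variables (C : comPzRingType) (m : set C) (hm : maximal_ideal m).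
Let him := maxi_ideal hm.

Lemma maximal_ideal_nunit : ~ m 1.
Proof. by move=> m1; apply: (maxi_proper hm); exact: ideal_eqT. Qed.

Lemma maximal_ideal_inv c : ~ m c -> exists c', m (c' * c - 1).
Proof.
move=> mc; pose J : set C := [set x | exists a, m (x - a * c)].
have hJ : two_sided_ideal J.
  have hl a x : J x -> J (a * x).
    move=> [b hb]; exists (a * b); rewrite -mulrA -mulrBr.
    exact: (tsiMl him).
  split=> //.
  - by exists 0; rewrite mul0r subrr; exact: tsi0 him.
  - move=> x y [a ha] [b hb]; exists (a + b); rewrite mulrDl opprD addrACA.
    exact: (tsiD him).
  - by move=> x a; rewrite mulrC; exact: hl.
have mJ : m `<=` J by move=> x mx; exists 0; rewrite mul0r subr0.
have [Jm|JT] := maxi_max hm hJ mJ.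
  by case: mc; rewrite -Jm; exists 1; rewrite mul1r subrr; exact: tsi0 him.
have [a ha] : J 1 by rewrite JT.
by exists a; rewrite -opprB; exact: (tsiN him).
Qed.

Lemma quot_mapM x y : quot_map him (x * y) = quot_map him x * quot_map him y.
Proof. by rewrite [RHS]quot_mulE. Qed.

Lemma quot_mapD x y : quot_map him (x + y) = quot_map him x + quot_map him y.
Proof. by rewrite [RHS]quot_addE. Qed.

Lemma quot_map_eq0 x : quot_map him x = 0 <-> m x.
Proof. by rewrite -[x in m x]subr0; exact: quot_mapP. Qed.

Lemma residue_nontrivial : (1 : ring_quot him) <> 0.
Proof. by move/quot_map_eq0; exact: maximal_ideal_nunit. Qed.

End MaximalIdeal.

Section PrimitiveIdealsOfPullback.
Variables (K : fieldType) (k l : nat).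
Variables (f : {additive 'rV[nat]_k -> 'rV[nat]_l}) (G : kgraph l).
Hypothesis f_surj : forall n : 'rV[nat]_l, exists m : 'rV[nat]_k, f m = n.
Hypotheses (G_rf : row_finite G) (G_fin : finitely_many_vertices G).
Local Notation A := (KPpb K f G_fin).
Local Notation C := (Cker K f).
Local Notation iota := (@iota_C K k l f G G_fin).
Local Notation p := (@pb_p K k l f G G_fin).
Local Notation P := (P_ideal K f G_fin).

Let sigma := projT1 (cid (monoid_section f_surj)).
Let sigmaK : forall n, f (sigma n) = n := projT2 (cid (monoid_section f_surj)).

Let hiota := iota_central K f G_rf G_fin.
Let fam := base_family K G_rf G_fin sigmaK.
Let gen : fam_generates iota (base_t K f G_fin sigma) (base_t' K f G_fin sigma) :=
  @base_generates K k l f G G_rf G_fin sigma sigmaK.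

Lemma P_ideal_ideal T m : two_sided_ideal (P T m).
Proof.
apply: ideal_add_ideal; first exact: ideal_gen_ideal.
by apply: left_span_ideal => _ a [c _ <-]; exact: (chC hiota).
Qed.

Lemma P_ideal_p (T : set (gvert G)) m v : ~ T v -> P T m (p v).
Proof.
move=> Tv; exists (p v); last by exists 0; rewrite ?addr0 //; exact: left_span0.
by apply: sub_ideal_gen; exists v.
Qed.

Lemma P_ideal_iota (T : set (gvert G)) (m : set C) c : m c -> P T m (iota c).
Proof.
move=> mc; exists 0; first exact: tsi0 (ideal_gen_ideal _).
by exists (iota c); rewrite ?add0r //; apply: sub_left_span; exists c.
Qed.

Lemma P_ideal_min (T : set (gvert G)) (m : set C) (I : set A) :
  two_sided_ideal I -> (forall v, ~ T v -> I (p v)) ->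
  (forall c, m c -> I (iota c)) -> P T m `<=` I.
Proof.
move=> hI Ip Iiota _ [x hx [y hy <-]]; apply: (tsiD hI).
  by move: x hx; apply: ideal_gen_sub => // _ [v nTv <-]; exact: Ip.
by move: y hy; apply: left_span_sub => // _ [c mc <-]; exact: Iiota.
Qed.

Hypothesis G_sa : strongly_aperiodic G.

Section OnePair.
Variables (T : set (gvert G)) (m : set C).
Hypotheses (hT : maximal_tail T) (hm : maximal_ideal m).

Lemma mt_paths w : T w -> exists x : infpath G, [/\ ip_obj x 0 = w,
  forall n, T (ip_obj x n) & aperiodic_path x].
Proof.
apply: (mt_aperiodic_paths (hT := hT)).
apply: G_sa; first exact: mt_saturated.
have [v Tv] := mt_nonempty hT; move=> e.
by have : (~` T) v by rewrite e.
Qed.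

(** Modulo [P_ideal T m] the coefficients act through the residue field of [m], so
the uniqueness theorem applies. *)
Lemma P_ideal_ck a : ~ P T m a ->
  exists x y v, T v /\ P T m (x * a * y - p v).
Proof.
apply: (ck_uniqueness fam G_rf G_fin hiota gen (P_ideal_ideal T m)).
- by move=> v; exact: P_ideal_p.
- move=> c; have [mc|mc] := EM (m c); first by left; exact: P_ideal_iota.
  by have [c' hc'] := maximal_ideal_inv hm mc; right; exists c'; exact: P_ideal_iota.
- exact: mt_paths.
Qed.

Local Notation B :=
  (KPu (ring_quot (maxi_ideal hm)) (finitely_many_vertices_sub (hereditary_compl hT) G_fin)).
Let S := subgraph (hereditary_compl hT).
Local Notation qm := (quot_map (maxi_ideal hm)).

Lemma no_sources_tail : no_sources S.
Proof.
move=> v n; have [a [ra da] Ta] := mt2 hT n ((mt_subP T _).1 (valP v)).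
have Ta' : gsrc a \notin ~` T by apply/mt_subP.
by exists (Sub a Ta' : sub_mor (~` T)); split=> //; apply: val_inj.
Qed.

(** The universal family of the subgraph on [T], extended by zero, is a family of
[G] whose coefficients factor through the residue field. *)
Lemma quotient_hom : exists phi : {rmorphism A -> B},
  [/\ forall c, phi (iota c) = qm c *: (1 : B),
      forall v, ~ T v -> phi (p v) = 0,
      forall v, T v -> phi (p v) <> 0 &
      forall b, exists a, phi a = b].
Proof.
have famB := ext_family (kpu_family (ring_quot (maxi_ideal hm))
  (finitely_many_vertices_sub (hereditary_compl hT) G_fin)).
have hj : central_hom (fun c : C => qm c *: (1 : B)).
  have h := kpu_scal_central (ring_quot (maxi_ideal hm))
    (finitely_many_vertices_sub (hereditary_compl hT) G_fin).
  split=> [c d|c d||c b].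
  - by rewrite quot_mapD; exact: (chD h).
  - by rewrite quot_mapM; exact: (chM h).
  - exact: (ch1 h).
  - exact: (chC h).
have [phi [phip phit phit' phij]] := base_universal G_rf G_fin sigmaK hj famB.
exists phi; split=> //.
- by move=> v nTv; rewrite phip ext_p0.
- move=> v /mt_subP Tv; rewrite phip.
  rewrite -[v]/(val (Sub v Tv : sub_vert (~` T))) ext_pE.
  apply: kp_p_neq0; [exact: residue_nontrivial|exact: no_sources_tail].
apply: (kpu_generates (R := ring_quot (maxi_ideal hm))
    (fG := finitely_many_vertices_sub (hereditary_compl hT) G_fin)).
- elim/ring_quot_ind => c; exists (iota c); exact: phij.
- by move=> b; exists (base_t K f G_fin sigma (val b)); rewrite phit ext_morE.
- by move=> b; exists (base_t' K f G_fin sigma (val b)); rewrite phit' ext_morE.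
- by move=> _ _ [x <-] [y <-]; exists (x + y); rewrite rmorphD.
- by move=> _ _ [x <-] [y <-]; exists (x * y); rewrite rmorphM.
Qed.

(** An element of the kernel outside the ideal would generate, modulo the ideal, a
vertex idempotent [p v] with [v] in [T], which is not in the kernel. *)
Lemma quotient_hom_kernel (phi : {rmorphism A -> B}) :
  (forall c, phi (iota c) = qm c *: (1 : B)) -> (forall v, ~ T v -> phi (p v) = 0) ->
  (forall v, T v -> phi (p v) <> 0) -> forall a, phi a = 0 <-> P T m a.
Proof.
move=> phic phi0 phi1 a; have hker := kernel_ideal phi.
have Pker : P T m `<=` [set a | phi a = 0].
  apply: P_ideal_min => //= c mc.
  by rewrite phic ((quot_map_eq0 hm c).2 mc) scale0r.
split=> [a0|/Pker //]; apply: contrapT => /P_ideal_ck[x [y [v [Tv /Pker /=]]]].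
rewrite rmorphB !rmorphM a0 mulr0 mul0r sub0r => /eqP.
by rewrite oppr_eq0 => /eqP; exact: phi1.
Qed.

Lemma P_ideal_vertex v : P T m (p v) <-> ~ T v.
Proof.
split=> [Pv Tv|]; last exact: P_ideal_p.
have [phi [phic phi0 phi1 _]] := quotient_hom.
by apply: (phi1 v Tv); apply/(quotient_hom_kernel phic phi0 phi1).
Qed.

(** If [iota c] is in the ideal and [c] is invertible modulo [m], then all vertex
idempotents are killed. *)
Lemma P_ideal_center c : P T m (iota c) <-> m c.
Proof.
split=> [Pc|]; last exact: P_ideal_iota.
have [phi [phic phi0 phi1 _]] := quotient_hom.
have [v Tv] := mt_nonempty hT.
apply: contrapT => mc; apply: (phi1 v Tv).
have [c' hc'] := maximal_ideal_inv hm mc.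
have : phi (iota (c' * c) * p v) = phi (p v).
  rewrite rmorphM phic -[qm _](subrK (qm 1)) -(addrC (qm 1)).
  have -> : qm (c' * c) = 1.
    by apply/(quot_mapP (maxi_ideal hm)).
  by rewrite [qm 1 + _]addrC subrK scale1r mul1r.
move=> <-; apply/(quotient_hom_kernel phic phi0 phi1).
have hP := P_ideal_ideal T m.
by rewrite (chM hiota); apply: (tsiMr hP); apply: (tsiMl hP).
Qed.

(** All vertices of [T] reach a single vertex [z], so an ideal containing [p v] for
some [v] in [T] contains [p z]. *)
Theorem P_ideal_primitive : Prim A (P T m).
Proof.
have [z Tz reach] := mt_common_vertex hT G_fin.
have hP := P_ideal_ideal T m.
apply: (@primitive_of_idempotent _ _ (p z)) => //.
- by rewrite (fam_pp fam) eqxx.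
- by move/P_ideal_vertex; apply.
move=> a /P_ideal_ck[x [y [v [Tv h]]]].
have [b [rb sb]] := reach v Tv.
exists (base_t' K f G_fin sigma b * x), (y * base_t K f G_fin sigma b).
have -> : p z = base_t' K f G_fin sigma b * p v * base_t K f G_fin sigma b.
  by rewrite -mulrA -rb (fam_pt fam) (fam_diag fam) sb.
rewrite -!mulrA -mulrBr !mulrA -mulrBl.
by rewrite -!mulrA; apply: (tsiMl hP); apply: (tsiMr hP); rewrite mulrA.
Qed.

Theorem P_ideal_quotient : exists (hP : two_sided_ideal (P T m))
    (phi : {rmorphism ring_quot hP -> B}), bijective phi /\
    forall c a, phi (quot_map hP (iota c * a)) = qm c *: phi (quot_map hP a).
Proof.
have [phi [phic phi0 phi1 phis]] := quotient_hom.
have phiK := quotient_hom_kernel phic phi0 phi1.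
have hP := P_ideal_ideal T m; exists hP.
pose psi (x : ring_quot hP) : B := phi (quot_repr x).
have psiE a : psi (quot_map hP a) = phi a.
  by apply/eqP; rewrite -subr_eq0 -rmorphB; apply/eqP/phiK; exact: quot_repr_map.
have psiB : {morph psi : x y / x - y}.
  elim/ring_quot_ind=> x; elim/ring_quot_ind=> y.
  by rewrite [- quot_map _ _]quot_oppE [_ + _ in LHS]quot_addE !psiE rmorphB.
have psiM : {morph psi : x y / x * y}.
  elim/ring_quot_ind=> x; elim/ring_quot_ind=> y.
  by rewrite [_ * _ in LHS]quot_mulE !psiE rmorphM.
have psi1 : psi 1 = 1 by rewrite psiE rmorph1.
pose psim : {rmorphism ring_quot hP -> B} := HB.pack psi
  (GRing.isZmodMorphism.Build _ _ psi psiB)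
  (GRing.isMonoidMorphism.Build _ _ psi (psi1, psiM)).
exists psim; split.
  pose inv (b : B) := quot_map hP (projT1 (cid (phis b))).
  exists inv => [x|b]; last by rewrite /inv [LHS]psiE; case: cid.
  elim/ring_quot_ind: x => x; rewrite /inv [psim _]psiE.
  by case: cid => /= y e; apply/quot_mapP/phiK; rewrite rmorphB e subrr.
move=> c a; rewrite [LHS]psiE [X in _ = _ *: X]psiE rmorphM phic.
rewrite (kpu_scalE (fG := finitely_many_vertices_sub (hereditary_compl hT) G_fin)).
by [].
Qed.

End OnePair.
End PrimitiveIdealsOfPullback.


(** * Central elements act by scalars on simple modules *)

Lemma wide_dependence (K : fieldType) m n (V : 'M[K]_(m, n)) : (n < m)%N ->
  exists2 u : 'rV[K]_m, u != 0 & u *m V = 0.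
Proof.
move=> nm; have : kermx V != 0.
  by rewrite kermx_eq0 /row_free neq_ltn (leq_ltn_trans (rank_leq_col V)).
by move=> /rowV0Pn[u /sub_kermxP uV u0]; exists u.
Qed.

Lemma uncountable_fiber (X : choiceType) (F : X -> nat) : ~ countable [set: X] ->
  exists n, forall m, exists2 a : 'I_m -> X, injective a & forall i, F (a i) = n.
Proof.
move=> uX; have [n hn] : exists n, ~ finite_set [set x | F x = n].
  apply: contrapT => none; apply: uX.
  have -> : [set: X] = \bigcup_(n in [set: nat]) [set x | F x = n].
    by apply/seteqP; split=> // x _; exists (F x).
  apply: bigcup_countable => [|n _]; first exact: countableP.
  by apply: finite_set_countable; apply: contrapT => nf; apply: none; exists n.
exists n => m; have [Y YF mY] := infinite_set_fset m hn.
case: m mY => [|m] mY; first by exists (fun i : 'I_0 => match notF (ltn_ord i) with end) => -[].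
have [x0 _] : exists x, x \in Y.
  by apply/fset0Pn; rewrite -cardfs_gt0; exact: leq_trans mY.
have lt_s (i : 'I_m.+1) : (i < size (Y : seq X))%N by exact: leq_trans mY.
exists (fun i : 'I_m.+1 => nth x0 Y i).
  move=> i i' /eqP; rewrite nth_uniq ?fset_uniq //.
  by move=> /eqP/val_inj.
by move=> i; apply: YF; rewrite /= mem_nth.
Qed.

Section Schur.
Variables (A : pzRingType) (M : lmodType A) (M_simple : simple_module M).

Lemma simple_cyclic (x y : M) : x != 0 -> exists a : A, y = a *: x.
Proof.
move=> x0; pose N : set M := [set y | exists a : A, y = a *: x].
have hN : submodule N.
  split.
  - by exists 0; rewrite scale0r.
  - by move=> _ _ [a ->] [b ->]; exists (a + b); rewrite scalerDl.
  - by move=> a _ [b ->]; exists (a * b); rewrite scalerA.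
have [N0|NT] := M_simple.2 N hN; last by have : N y by rewrite NT.
have : N x by exists 1; rewrite scale1r.
by rewrite N0 /= => x00; rewrite x00 eqxx in x0.
Qed.

Variables (z : A) (zC : forall a, z * a = a * z).
Hypothesis nz : ~ annihilator M z.

Lemma schur_inj (x : M) : z *: x = 0 -> x = 0.
Proof.
pose N : set M := [set x | z *: x = 0].
have hN : submodule N.
  split; rewrite /N /=.
  - by rewrite scaler0.
  - by move=> u v u0 v0; rewrite scalerDr u0 v0 addr0.
  - by move=> a u u0; rewrite scalerA zC -scalerA u0 scaler0.
move=> zx; have : N x by [].
have [->//|NT] := M_simple.2 N hN; case: nz => u.
by have : N u by rewrite NT.
Qed.

Lemma schur_surj (y : M) : exists x, z *: x = y.
Proof.
pose N : set M := [set y | exists x, z *: x = y].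
have hN : submodule N.
  split; rewrite /N /=.
  - by exists 0; rewrite scaler0.
  - by move=> _ _ [u <-] [v <-]; exists (u + v); rewrite scalerDr.
  - by move=> a _ [u <-]; exists (a *: u); rewrite !scalerA zC.
have [N0|NT] := M_simple.2 N hN; last by have : N y by rewrite NT.
case: nz => u; suff: N (z *: u) by rewrite N0.
by exists u.
Qed.

End Schur.

Section CentralEvaluation.
Variables (K : fieldType) (A : pzRingType) (j : K -> A) (hj : central_hom j).
Variable theta : A.

Definition peval (p : {poly K}) : A := \sum_(i < size p) j p`_i * theta ^+ i.

Lemma peval_wide n (p : {poly K}) : (size p <= n)%N ->
  peval p = \sum_(i < n) j p`_i * theta ^+ i.
Proof.
move=> pn; rewrite /peval (big_ord_widen n (fun i => j p`_i * theta ^+ i) pn).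
rewrite big_mkcond; apply: eq_bigr => i _; case: ltnP => // pi.
by rewrite nth_default // (ch0 hj) mul0r.
Qed.

Lemma pevalD p q : peval (p + q) = peval p + peval q.
Proof.
pose n := maxn (size p) (size q).
rewrite (peval_wide (size_polyD p q)) (@peval_wide n p) ?leq_maxl //.
rewrite (@peval_wide n q) ?leq_maxr // -big_split; apply: eq_bigr => i _ /=.
by rewrite coefD (chD hj) mulrDl.
Qed.

Lemma peval0 : peval 0 = 0.
Proof. by rewrite /peval size_poly0 big_ord0. Qed.

Lemma pevalZ c p : peval (c *: p) = j c * peval p.
Proof.
rewrite (peval_wide (size_scale_leq c p)) mulr_sumr; apply: eq_bigr => i _.
by rewrite coefZ (chM hj) mulrA.
Qed.

Lemma pevalX p : peval (p * 'X) = peval p * theta.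
Proof.
rewrite (@peval_wide (size p).+1) ?size_mul_leq //; last first.
  by apply: leq_trans (size_polyMleq _ _) _; rewrite size_polyX addn2.
rewrite big_ord_recl coefMX /= (ch0 hj) mul0r add0r mulr_suml.
by apply: eq_bigr => i _; rewrite coefMX /= exprSr mulrA.
Qed.

Lemma pevalXsubC p b : peval (p * ('X - b%:P)) = peval p * (theta - j b).
Proof.
rewrite !mulrBr pevalD pevalX -mulNr [_ * b%:P]mulrC mul_polyC pevalZ.
congr (_ + _); rewrite -[peval (- p)](addKr (peval p)) -pevalD subrr peval0.
by rewrite addr0 mulrN (chC hj).
Qed.

Lemma peval_sum (I : finType) (F : I -> {poly K}) :
  peval (\sum_i F i) = \sum_i peval (F i).
Proof. exact: (big_morph peval pevalD peval0). Qed.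

Lemma peval1 : peval 1 = 1.
Proof. by rewrite /peval size_poly1 big_ord1 coef1 (ch1 hj) mul1r. Qed.

Lemma pevalC c : peval c%:P = j c.
Proof. by rewrite -alg_polyC pevalZ peval1 mulr1. Qed.

End CentralEvaluation.

(** The closedness axiom speaks of monic equations, whence the division by the
leading coefficient. *)
Lemma closed_root (K : fieldType) (p : {poly K}) : GRing.closed_field_axiom K ->
  (1 < size p)%N -> exists x, root p x.
Proof.
move=> cK; case sp: (size p) => [//|n] n0.
have lc0 : p`_n != 0.
  by rewrite -[n]/n.+1.-1 -sp -lead_coefE lead_coef_eq0 -size_poly_eq0 sp.
have [x xn] := cK n (fun i => - p`_i / p`_n) n0.
exists x; apply/rootP; rewrite horner_coef sp big_ord_recr /= xn mulr_sumr.
rewrite -big_split big1 //= => i _.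
by rewrite mulrA mulrCA mulfV // mulr1 mulNr subrr.
Qed.

(** Amitsur's trick.  If no [theta - r] annihilates [M], all of them act bijectively,
by Schur's lemma.  Fix [x0] and let [y r] be the preimage of [x0] under [theta - r].
Uncountably many vectors in a space of countable dimension are dependent, so
[sum_i u_i y (a_i) = 0] for some distinct [a_i].  Clearing denominators gives a
nonzero polynomial in [theta] that kills [x0]; it splits into injective linear
factors, hence [x0 = 0]. *)
Theorem central_scalar (K : fieldType) (A : pzRingType) (j : K -> A)
    (e : nat -> A) (M : lmodType A) (theta : A) :
  central_hom j -> (forall a, exists n (c : nat -> K), a = \sum_(i < n) j (c i) * e i) ->
  simple_module M -> (forall a, theta * a = a * theta) ->
  ~ countable [set: K] -> GRing.closed_field_axiom K ->
  exists r, annihilator M (theta - j r).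
Proof.
move=> hj he M_simple thetaC uK cK; apply: contrapT => none.
have nann r : ~ annihilator M (theta - j r) by move=> h; apply: none; exists r.
have zC r a : (theta - j r) * a = a * (theta - j r).
  by rewrite mulrBl mulrBr thetaC (chC hj).
(* split off one linear factor at a time *)
have pinj (p : {poly K}) (x : M) : p != 0 -> peval j theta p *: x = 0 -> x = 0.
  move: {2}(size p) (leqnn (size p)) => n; elim: n p x => [|n IHn] p x.
    by rewrite size_poly_leq0 => ->.
  move=> pn p0; have [sp|sp] := ltnP 1 (size p); last first.
    have p1 : p = (p`_0)%:P by exact: size1_polyC.
    have p00 : p`_0 != 0 by apply: contra_neq p0 => e0; rewrite p1 e0.
    rewrite p1 (pevalC hj) => /(congr1 (fun y => j (p`_0)^-1 *: y)).
    by rewrite scaler0 scalerA -(chM hj) mulVf // (ch1 hj) scale1r.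
  have [b /factor_theorem[q pq]] := closed_root cK sp.
  have q0 : q != 0 by apply: contra_neq p0 => e0; rewrite pq e0 mul0r.
  rewrite pq (pevalXsubC hj) -zC -scalerA => /(schur_inj M_simple (zC b) (nann b)).
  apply: IHn => //; move: pn; rewrite pq size_mul ?polyXsubC_eq0 //.
  by rewrite size_XsubC addn2.
have [x0 x00] := M_simple.1.
have hx r : exists x : M, (theta - j r) *: x = x0.
  exact: (schur_surj M_simple (zC r) (nann r)).
have hc r : exists nc : nat * (nat -> K), (theta - j r) *:
    ((\sum_(i < nc.1) j (nc.2 i) * e i) *: x0) = x0.
  have [x rx] := hx r; have [a xa] := simple_cyclic M_simple x x00.
  by have [n [c ac]] := he a; exists (n, c); rewrite /= -ac -xa.
pose nc r := projT1 (cid (hc r)).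
pose y r : M := (\sum_(i < (nc r).1) j ((nc r).2 i) * e i) *: x0.
have yE r : (theta - j r) *: y r = x0 by rewrite /y /nc; case: cid.
have [n hn] := uncountable_fiber (fun r => (nc r).1) uK.
have [a ainj an] := hn n.+1.
have [u u0 uV] := wide_dependence (\matrix_(i < n.+1, t < n) (nc (a i)).2 t) (ltnSn n).
have dep : \sum_i j (u ord0 i) *: y (a i) = 0.
  have yw i : y (a i) = (\sum_(t < n) j ((nc (a i)).2 t) * e t) *: x0.
    by rewrite /y an.
  under eq_bigr do rewrite yw scalerA mulr_sumr.
  rewrite -scaler_suml exchange_big big1 ?scale0r // => t _ /=.
  under eq_bigr do rewrite mulrA -(chM hj).
  rewrite -mulr_suml -(ch_sum hj).
  have := congr1 (fun v : 'rV[K]_n => v ord0 t) uV.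
  rewrite !mxE; under eq_bigr do rewrite mxE.
  by move=> ->; rewrite (ch0 hj) mul0r.
(* the product of all [theta - a i'] sends [y (a i)] to [q i] evaluated at [theta]
   and applied to [x0] *)
pose q i : {poly K} := \prod_(i' | i' != i) ('X - (a i')%:P).
have qy i : peval j theta (\prod_i' ('X - (a i')%:P)) *: y (a i) =
    peval j theta (q i) *: x0.
  by rewrite (bigD1 i) //= mulrC (pevalXsubC hj) -scalerA yE.
have p0 : \sum_i u ord0 i *: q i = 0.
  apply/eqP; apply: contraT => pn0.
  move: x00; rewrite (pinj _ x0 pn0) ?eqxx // (peval_sum hj).
  under eq_bigr do rewrite (pevalZ hj).
  rewrite scaler_suml; under eq_bigr do rewrite -scalerA -qy scalerA (chC hj) -scalerA.
  by rewrite -scaler_sumr dep scaler0.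
have /matrix0Pn[i0 [i]] := u0; rewrite (ord1 i0) => ui.
have := congr1 (horner^~ (a i)) p0; rewrite horner0 horner_sum.
rewrite (bigD1 i) //= [X in _ + X]big1 ?addr0; last first.
  move=> i' i'i; rewrite hornerZ /q horner_prod (bigD1 i) 1?eq_sym //=.
  by rewrite hornerXsubC subrr mul0r mulr0.
rewrite hornerZ => /eqP; rewrite mulf_eq0 (negbTE ui) /= /q horner_prod.
move=> /prodf_eq0[i' i'i]; rewrite hornerXsubC subr_eq0 => /eqP/ainj e'.
by rewrite e' eqxx in i'i.
Qed.


(** * Primitive ideals over an uncountable algebraically closed field *)

Lemma countable_span (K : comPzRingType) (A : pzRingType) (j : K -> A)
    (X : countType) (g : X -> A) : central_hom j ->
  (forall a, exists s : seq (K * X), a = \sum_(u <- s) j u.1 * g u.2) ->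
  exists e : nat -> A,
    forall a, exists n (c : nat -> K), a = \sum_(i < n) j (c i) * e i.
Proof.
move=> hj hg; pose e i := if (choice.unpickle i : option X) is Some x then g x else 0.
exists e => a; have [s {a}->] := hg a.
elim: s => [|[r x] s [n [c IHs]]].
  by exists 0%N, (fun=> 0); rewrite big_nil big_ord0.
pose N := maxn (choice.pickle x).+1 n.
have xN : (choice.pickle x < N)%N by rewrite leq_max ltnSn.
exists N, (fun i => (if i == choice.pickle x then r else 0) + (if (i < n)%N then c i else 0)).
rewrite big_cons IHs; under [RHS]eq_bigr do rewrite (chD hj) mulrDl.
rewrite big_split /=; congr (_ + _).
  rewrite (bigD1 (Ordinal xN)) //= eqxx /e choice.pickleK big1 ?addr0 // => i.
  rewrite -val_eqE /= => /negbTE->.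
  by rewrite (ch0 hj) mul0r.
rewrite (big_ord_widen N (fun i => j (c i) * e i)) ?leq_maxr // big_mkcond.
by apply: eq_bigr => i _; case: ifP => //; rewrite (ch0 hj) mul0r.
Qed.

Lemma annihilator_ideal (A : pzRingType) (M : lmodType A) :
  two_sided_ideal (annihilator M).
Proof.
split.
- by move=> x; rewrite scale0r.
- by move=> a b ha hb x; rewrite scalerDl ha hb addr0.
- by move=> a b hb x; rewrite -scalerA hb scaler0.
- by move=> a b ha x; rewrite -scalerA ha.
Qed.

Section PrimitiveIdealsAreStandard.
Variables (K : fieldType) (k l : nat).
Variables (f : {additive 'rV[nat]_k -> 'rV[nat]_l}) (G : kgraph l).
Hypothesis f_surj : forall n : 'rV[nat]_l, exists m : 'rV[nat]_k, f m = n.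
Hypotheses (G_rf : row_finite G) (G_fin : finitely_many_vertices G).
Hypothesis G_sa : strongly_aperiodic G.
Local Notation A := (KPpb K f G_fin).
Local Notation C := (Cker K f).
Local Notation iota := (@iota_C K k l f G G_fin).
Local Notation p := (@pb_p K k l f G G_fin).

Variables (M : lmodType A) (M_simple : simple_module M).
Local Notation I := (annihilator M).

Let hI := annihilator_ideal M.
Let hiota := iota_central K f G_rf G_fin.

Lemma simple_proper : ~ I 1.
Proof.
have [x x0] := M_simple.1; move=> /(_ x); rewrite scale1r => e.
by rewrite e eqxx in x0.
Qed.

Definition ann_tail : set (gvert G) := [set v | ~ I (p v)].

Definition ann_center : set C := [set c | I (iota c)].

Section Tail.
Variables (t t' : gmor G -> A) (fam : kp_family p t t').
Hypothesis gen : fam_generates iota t t'.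

Lemma ideal_sum (X : eqType) (s : seq X) (F : X -> A) :
  (forall x, x \in s -> I (F x)) -> I (\sum_(x <- s) F x).
Proof.
move=> h; rewrite big_seq.
by apply: big_ind => //; [exact: tsi0 hI|exact: tsiD hI].
Qed.

Lemma ann_source a : I (p (gsrc a)) -> I (t a).
Proof. by move=> h; rewrite -(fam_tp fam); exact: (tsiMl hI). Qed.

(** The directedness axiom is primeness of the annihilator: for [v] and [w] in the
tail, [p v A p w] does not kill [M], so neither does some [p v t_b t'_d p w], and
the common source of [b] and [d] is reached from both vertices. *)
Lemma ann_tail_maximal : maximal_tail ann_tail.
Proof.
split.
- apply: contrapT => none; apply: simple_proper; rewrite -(fam_sum1 fam G_rf G_fin 0).
  apply: ideal_sum => a _; apply/(tsiMr hI)/ann_source; apply: contrapT => h.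
  by apply: none; exists (gsrc a).
- move=> v w nw [a [ra sa]] Iv; apply: nw.
  rewrite -sa -(fam_diag fam); apply: (tsiMl hI); rewrite -(fam_pt fam) ra.
  exact: (tsiMr hI).
- move=> v n nv; have [e [ue me]] := enum_paths_from G_rf v n.
  apply: contrapT => none; apply: nv; rewrite (fam_vertex fam G_rf G_fin ue me).
  apply: ideal_sum => a /me va; apply/(tsiMr hI)/ann_source; apply: contrapT => h.
  by apply: none; exists a.
move=> v w nv nw.
have nonzero z : ~ I z -> exists x : M, z *: x != 0.
  move=> nz; apply: contrapT => h; apply: nz => x; apply/eqP.
  by apply: contrapT => /negP zx; apply: h; exists x.
have [x px] := nonzero _ nw; have [y py] := nonzero _ nv.
have [a ya] := simple_cyclic M_simple y px.
have nvaw : ~ I (p v * a * p w).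
  by move=> /(_ x) /eqP; rewrite -!scalerA -ya (negbTE py).
have [s sa] := fam_spanning fam G_rf G_fin hiota gen a.
have [[c [b d]] /= nI] : exists u : C * (gmor G * gmor G),
    ~ I (p v * (t u.2.1 * t' u.2.2) * p w).
  apply: contrapT => none; apply: nvaw; rewrite sa mulr_sumr mulr_suml.
  apply: ideal_sum => u _; rewrite [p v * _]mulrA -(chC hiota) -!mulrA; apply: (tsiMl hI).
  by apply: contrapT => h; apply: none; exists u; rewrite -!mulrA in h *.
have vb : v = grng b.
  apply: contrapT => /eqP/negbTE vb; apply: nI.
  by rewrite mulrA (fam_pt_eq fam) vb !mul0r; exact: tsi0 hI.
have wd : w = grng d.
  apply: contrapT => /eqP/negbTE wd; apply: nI.
  rewrite -(fam_tp' fam) -!mulrA (fam_pp fam) eq_sym wd !mulr0.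
  exact: tsi0 hI.
have bd : gsrc b = gsrc d.
  apply: contrapT => /eqP/negbTE bd; apply: nI.
  rewrite -(fam_tp fam) -(fam_pt' fam d) -!mulrA [p (gsrc b) * _]mulrA (fam_pp fam).
  by rewrite bd mul0r !mulr0; exact: tsi0 hI.
exists (gsrc b); split.
- move=> /ann_source h; apply: nI; apply: (tsiMr hI); apply: (tsiMl hI).
  exact: (tsiMr hI).
- by exists b.
- by exists d.
Qed.

End Tail.

Hypotheses (K_unc : ~ countable [set: K]) (K_closed : GRing.closed_field_axiom K).

Lemma ann_center_scalar c : exists r, I (iota c - pb_scal f G_fin r).
Proof.
pose g (x : gmor (pullback f G) * gmor (pullback f G)) : A :=
  pb_gs K G_fin x.1 * pb_gs' K G_fin x.2.
have [e he] := @countable_span _ _ _ _ g (pb_scal_central K f G_fin)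
  (fam_spanning (pb_gfamily K f G_fin) (row_finite_pb (f := f) G_rf) G_fin
     (pb_scal_central K f G_fin) (@pb_ggenerates K k l f G G_fin)).
exact: (central_scalar (pb_scal_central K f G_fin) he M_simple (chC hiota c)).
Qed.

(** Every coefficient is a scalar modulo this ideal, and nonzero scalars are units. *)
Lemma ann_center_maximal : maximal_ideal ann_center.
Proof.
have hm : two_sided_ideal ann_center.
  split; rewrite /ann_center /=.
  - by rewrite (ch0 hiota); exact: tsi0 hI.
  - by move=> c d hc hd; rewrite (chD hiota); exact: (tsiD hI).
  - by move=> c d hd; rewrite (chM hiota); exact: (tsiMl hI).
  - by move=> c d hc; rewrite (chM hiota); exact: (tsiMr hI).
split=> //.
  move=> e; apply: simple_proper; rewrite -(ch1 hiota).
  by have : ann_center 1 by rewrite e.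
move=> J hJ mJ; have [Jm|nJm] := EM (J `<=` ann_center); [left|right].
  by apply/seteqP.
have [c Jc nc] : exists2 c, J c & ~ ann_center c.
  apply: contrapT => none; apply: nJm => c Jc; apply: contrapT => nc.
  by apply: none; exists c.
have [r hr] := ann_center_scalar c.
pose rC : C := << r *g (0 : kerfbar f) >>.
have mcr : ann_center (c - rC).
  by rewrite /ann_center /= (chD hiota) (chN hiota) iota_scal.
have r0 : r != 0.
  apply: contra_not_neq nc => r0; move: mcr.
  by rewrite /rC r0 monalgU0 subr0.
have JrC : J rC.
  have -> : rC = c - (c - rC) by rewrite subKr.
  by apply: (tsiD hJ) => //; apply: (tsiN hJ); exact: mJ.
apply: (ideal_eqT hJ).
have <- : (<< r^-1 *g (0 : kerfbar f) >> : C) * rC = 1.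
  by rewrite [LHS]grpalg_mulUU (mulVf r0) addr0; reflexivity.
exact: (tsiMl hJ).
Qed.

(** An element of the annihilator outside the standard ideal would, by the
uniqueness theorem, put a vertex idempotent of the tail into the annihilator. *)
Theorem annihilator_standard :
  [/\ maximal_tail ann_tail, maximal_ideal ann_center &
      P_ideal K f G_fin ann_tail ann_center = I].
Proof.
have [sigma sigmaK] := monoid_section f_surj.
have hT : maximal_tail ann_tail.
  exact: (ann_tail_maximal (base_family K G_rf G_fin sigmaK)
    (@base_generates K k l f G G_rf G_fin sigma sigmaK)).
have hm := ann_center_maximal.
have PI : P_ideal K f G_fin ann_tail ann_center `<=` I.
  by apply: P_ideal_min => // v; apply: contrapT.
split=> //; apply/seteqP; split=> // a Ia; apply: contrapT.
move=> /(P_ideal_ck f_surj G_rf G_sa hT hm)[x [y [v [Tv /PI h]]]].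
apply: Tv; rewrite -[p v](subKr (x * a * y)); apply: (tsiD hI); last exact: (tsiN hI).
by apply: (tsiMr hI); apply: (tsiMl hI).
Qed.

End PrimitiveIdealsAreStandard.

Theorem theorem5p1 (K : fieldType) (k l : nat)
    (f : {additive 'rV[nat]_k -> 'rV[nat]_l})
    (f_surj : forall n : 'rV[nat]_l, exists m : 'rV[nat]_k, f m = n)
    (G : kgraph l) (G_rf : row_finite G) (G_ns : no_sources G)
    (G_fin : finitely_many_vertices G) (G_sa : strongly_aperiodic G) :
  [/\ set_fun (MT G `*` MaxSpec (Cker K f)) (Prim (KPpb K f G_fin))
        (Phi K f G_fin),
      set_inj (MT G `*` MaxSpec (Cker K f)) (Phi K f G_fin),
      forall (T : set (gvert G)) (m : set (Cker K f))
          (hT : maximal_tail T) (hm : maximal_ideal m),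
        exists (hP : two_sided_ideal (P_ideal K f G_fin T m))
          (phi : {rmorphism ring_quot hP ->
             KPu (ring_quot (maxi_ideal hm))
               (finitely_many_vertices_sub (hereditary_compl hT) G_fin)}),
          bijective phi /\
          forall (c : Cker K f) (a : KPpb K f G_fin),
            phi (quot_map hP (iota_C K f G_fin c * a)) =
            quot_map (maxi_ideal hm) c *: phi (quot_map hP a)
    & ~ countable [set: K] -> GRing.closed_field_axiom K ->
      set_bij (MT G `*` MaxSpec (Cker K f)) (Prim (KPpb K f G_fin))
        (Phi K f G_fin)].
Proof.
have welldef : set_fun (MT G `*` MaxSpec (Cker K f)) (Prim (KPpb K f G_fin))
    (Phi K f G_fin).
  by move=> [T m] [/= hT hm]; exact: P_ideal_primitive.
have inj : set_inj (MT G `*` MaxSpec (Cker K f)) (Phi K f G_fin).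
  move=> [T m] [T' m']; rewrite !inE => -[/= hT hm] [/= hT' hm'].
  rewrite /Phi /= => e; congr pair; apply/seteqP; split.
  - move=> v Tv; apply: contrapT.
    by move=> /(P_ideal_vertex f_surj G_rf G_fin G_sa hT' hm'); rewrite -e;
      move=> /(P_ideal_vertex f_surj G_rf G_fin G_sa hT hm).
  - move=> v Tv; apply: contrapT.
    by move=> /(P_ideal_vertex f_surj G_rf G_fin G_sa hT hm); rewrite e;
      move=> /(P_ideal_vertex f_surj G_rf G_fin G_sa hT' hm').
  - move=> c /(P_ideal_center f_surj G_rf G_fin G_sa hT hm).
    by rewrite e => /(P_ideal_center f_surj G_rf G_fin G_sa hT' hm').
  - move=> c /(P_ideal_center f_surj G_rf G_fin G_sa hT' hm').
    by rewrite -e => /(P_ideal_center f_surj G_rf G_fin G_sa hT hm).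
split=> //; first by move=> T m hT hm; exact: P_ideal_quotient.
move=> K_unc K_closed; split=> // _ [M hM ->].
have [hT hm e] := annihilator_standard f_surj G_rf G_sa hM K_unc K_closed.
by exists (ann_tail M, ann_center M).
Qed.
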